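(* Let $n>2$. The homology groups of the face poset of the cyclopermutohedron $\mathcal{CP}_{n+1}$, that is, the groups $H_k(CP_{n+1},\mathbb{Z})$ of the regular cell complex $CP_{n+1}$, are free abelian groups, and their ranks are $$\mathrm{rk}\,H_k(CP_{n+1},\mathbb{Z})=\begin{cases}\dbinom{n}{k}, & \text{if } 0\le k<n-2,\\[2mm] 2^n+\dfrac{n^2-3n-2}{2}, & \text{if } k=n-2,\\[2mm] 0, & \text{otherwise.}\end{cases}$$
   Context: Let $n>2$. A cyclically ordered partition of $[n+1]=\{1,\dots,n+1\}$ into $m$ non-empty parts is a sequence $(I_1,\dots,I_m)$ of pairwise disjoint non-empty sets with union $[n+1]$, considered up to cyclic rotation of the sequence. A cyclically ordered partition $\alpha'$ refines $\alpha=(I_1,\dots,I_m)$ if $\alpha'$ is obtained (up to rotation) by replacing each $I_j$ in its place by a linearly ordered partition of $I_j$ into non-empty parts (order-preserving refinement). The regular cell complex $CP_{n+1}$: for $k=0,\dots,n-2$ its (closed) $k$-cells are labeled by all cyclically ordered partitions of $[n+1]$ into $n-k+1$ non-empty parts (so the number of parts is always at least $3$); a closed cell $F$ contains a cell $F'$ iff the label of $F'$ refines the label of $F$. The cell complex is determined by these incidences; its homology is that of the order complex of the poset of its (non-empty) cells. The cyclopermutohedron $\mathcal{CP}_{n+1}$ is a virtual polytope (a formal Minkowski difference of two convex polytopes) whose face poset is isomorphic to the complex $CP_{n+1}$; the homology of its face poset means the homology of $CP_{n+1}$. *)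

(* Defs.v *)
From HB Require Import structures.
From mathcomp Require Import all_boot all_order all_algebra.
From mathcomp Require Import ring_quotient boolp.

Set Implicit Arguments.
Unset Strict Implicit.
Unset Printing Implicit Defensive.

Import Order.TTheory GRing.Theory Num.Theory.

Local Open Scope quotient_scope.

Lemma all2_cat S U (e : S -> U -> bool) s1 s2 t1 t2 : size s1 = size t1 ->
  all2 e (s1 ++ s2) (t1 ++ t2) = all2 e s1 t1 && all2 e s2 t2.
Proof. by elim: s1 t1 => [|x s IHs] [|y t] //= [/IHs->]; rewrite andbA. Qed.

Section CyclicPartitions.
Variable T : finType.
Implicit Types (A : {set T}) (p q r : seq {set T}).

Definition ordered_partition A p := uniq p && partition [set:: p] A.

(* The bound #|T| on the number of parts is no restriction; it only makes the
   type finite. *)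
Record opart := OPart {
  parts_of :> #|T|.-bseq {set T};
  _ : ordered_partition [set: T] parts_of
}.

HB.instance Definition _ := [isSub for parts_of].
HB.instance Definition _ := [Finite of opart by <:].

Definition rotation p q := [exists i : 'I_(size p).+1, q == rot i p].

Lemma rotationP p q : reflect (exists i, q = rot i p) (rotation p q).
Proof.
apply: (iffP existsP) => [[i /eqP->]|[i ->]]; first by exists i.
have [lt_i|ge_i] := ltnP i (size p).+1; first by exists (Ordinal lt_i).
by exists ord0; rewrite rot0 rot_oversize // ltnW.
Qed.

Lemma rotation_refl p : rotation p p.
Proof. by apply/rotationP; exists 0; rewrite rot0. Qed.

Lemma rotation_sym p q : rotation p q = rotation q p.
Proof.
suff H p' q' : rotation p' q' -> rotation q' p' by apply/idP/idP; apply: H.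
case/rotationP=> i ->; apply/rotationP; exists (size (rot i p') - i).
by rewrite -/(rotr i (rot i p')) rotK.
Qed.

Lemma rotation_trans p q r : rotation p q -> rotation q r -> rotation p r.
Proof.
case/existsP=> -[i /= lti] /eqP-> /existsP[[j /=]]; rewrite size_rot => ltj.
move=> /eqP->; apply/rotationP.
by rewrite rot_add_mod //; eexists.
Qed.

Definition opart_rotation (p q : opart) := rotation p q.

Lemma opart_rotation_equiv : equiv_class_of opart_rotation.
Proof.
split; first exact: (fun p : opart => rotation_refl p).
- exact: (fun p q : opart => rotation_sym p q).
- exact: (fun q p r : opart => @rotation_trans p q r).
Qed.

Canonical opart_rotation_equivRel := EquivRelPack opart_rotation_equiv.

Definition cpart := {eq_quot opart_rotation}.
HB.instance Definition _ := EqQuotient.on cpart.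
HB.instance Definition _ := Choice.on cpart.
HB.instance Definition _ := Countable.copy cpart (can_type (@reprK _ cpart)).
HB.instance Definition _ : isFinite cpart := CanIsFinite (@reprK _ cpart).

Definition number_of_parts (x : cpart) := size (repr x).

Lemma number_of_partsE (p : opart) : number_of_parts (\pi_cpart p) = size p.
Proof.
rewrite /number_of_parts; case: piP => q /eqmodP/rotationP[i ->].
by rewrite size_rot.
Qed.

Lemma ordered_partitionP A p :
  reflect (set0 \notin p /\
           forall x, count (fun B : {set T} => x \in B) p = (x \in A))
          (ordered_partition A p).
Proof.
apply: (iffP andP) => [[Up /and3P[/eqP covp trivp]]|[n0 cnt]].
  rewrite inE => n0; split=> // x; rewrite -covp.
  case: (boolP (x \in cover _)) => [/bigcupP[B]|notx].
    rewrite inE => pB xB; rewrite -(@eq_in_count _ (pred1 B)).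
      by rewrite count_uniq_mem ?pB.
    move=> C pC /=; apply/eqP/idP => [->//|xC]; apply/eqP.
    apply: contraTT xC => neqCB; move/trivIsetP: trivp => /(_ B C).
    rewrite !inE => /(_ pB pC); rewrite eq_sym => /(_ neqCB).
    by move/disjointFr=> ->.
  apply/eqP; rewrite eqn0Ngt -has_count; apply: contra notx => /hasP[B pB xB].
  by apply/bigcupP; exists B; rewrite ?inE.
have uniq1 (B C : {set T}) x : B \in p -> C \in p -> x \in B -> x \in C -> B = C.
  move=> pB pC xB xC; apply: contraTeq isT => neq; have := cnt x.
  have := perm_to_rem pB => /permP->/=; rewrite xB.
  have pC' : C \in rem B p.
    by move: pC; rewrite (perm_mem (perm_to_rem pB)) inE eq_sym (negPf neq).
  by have := perm_to_rem pC' => /permP->/=; rewrite xC; case: (x \in A).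
split.
  apply: count_mem_uniq => B; case: (boolP (B \in p)) => [pB|/count_memPn //].
  have /set0Pn[x xB] : B != set0 by apply: contraNneq n0 => <-.
  apply/eqP; rewrite eqn_leq -[0 < _]has_count has_pred1 pB andbT.
  rewrite (leq_trans _ (leq_b1 (x \in A))) // -cnt.
  by apply: sub_count => C /eqP->.
apply/and3P; split; last by rewrite inE.
  apply/eqP/setP=> x; apply/bigcupP/idP => [[B]|xA].
    rewrite inE => pB xB; have := cnt x; case: (x \in A) => // /eqP.
    by rewrite eqn0Ngt -has_count => /hasP[]; exists B.
  have: has (fun B : {set T} => x \in B) p by rewrite has_count cnt xA.
  by case/hasP=> B pB xB; exists B; rewrite ?inE.
apply/trivIsetP=> B C; rewrite !inE => pB pC neq.
rewrite -setI_eq0; apply: contraNT neq => /set0Pn[x /setIP[xB xC]].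
by rewrite (uniq1 _ _ x pB pC).
Qed.

(* [p] replaces each part of [q], in place, by an ordered partition of it. *)
Definition linear_refines p q :=
  exists2 ps : seq (seq {set T}), p = flatten ps & all2 ordered_partition q ps.

Lemma all2_flatten q ps : all2 ordered_partition q ps ->
  set0 \notin flatten ps /\
  forall x, count (fun B : {set T} => x \in B) (flatten ps)
            = count (fun B : {set T} => x \in B) q.
Proof.
elim: q ps => [|A q IHq] [|p ps] //= /andP[/ordered_partitionP[n0 cnt]].
case/IHq=> n0' cnt'; split=> [|x]; first by rewrite mem_cat negb_or n0.
by rewrite count_cat cnt cnt'.
Qed.

Lemma linear_refines_partition A p q :
  linear_refines p q -> ordered_partition A q -> ordered_partition A p.
Proof.
case=> ps -> /all2_flatten[n0 cnt] /ordered_partitionP[_ cntq].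
by apply/ordered_partitionP; split=> // x; rewrite cnt.
Qed.

Lemma linear_refines_refl p : set0 \notin p -> linear_refines p p.
Proof.
move=> n0; exists [seq [:: A] | A <- p]; first by rewrite flatten_map1 map_id.
elim: p n0 => //= A p IHp; rewrite inE negb_or => /andP[nA /IHp->].
rewrite andbT; apply/ordered_partitionP; split=> [|x /=]; last by rewrite addn0.
by rewrite inE.
Qed.

Lemma linear_refines_trans q p r :
  linear_refines p q -> linear_refines q r -> linear_refines p r.
Proof.
case=> ps -> {p} + [qs eq_q]; rewrite {}eq_q.
elim: qs r ps => [|s qs IHqs] [|A r] //= ps; first by case: ps => // _; exists [::].
move=> psP /andP[sA /IHqs IH].
have := psP; rewrite all2E => /andP[/eqP]; rewrite size_cat => sz _.
move: psP; rewrite -{1}(cat_take_drop (size s) ps) all2_cat; last first.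
  by rewrite size_takel // -sz leq_addr.
case/andP=> take_s /IH[ps' eq_ps' ps'P].
exists (flatten (take (size s) ps) :: ps').
  by rewrite -{1}(cat_take_drop (size s) ps) flatten_cat /= eq_ps'.
by rewrite /= ps'P andbT (linear_refines_partition _ sA) //; exists (take (size s) ps).
Qed.

Lemma linear_refines_size p q : set0 \notin q -> linear_refines p q ->
  size q <= size p /\ (size p <= size q -> p = q).
Proof.
move=> n0 [ps ->] {p}; elim: q n0 ps => [|A q IHq] n0 [|p ps] //=.
move: n0; rewrite inE negb_or eq_sym => /andP[An0 n0].
case/andP=> pA /(IHq n0)[le_q eq_q]; rewrite size_cat.
case: p pA => [|B [|C p]].
- case/ordered_partitionP=> _ /= cnt; case/set0Pn: An0 => x xA.
  by have := cnt x; rewrite xA.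
- case/ordered_partitionP=> _ /= cnt; split=> // /eq_q->; congr (_ :: _).
  by apply/setP=> x; have := cnt x; rewrite addn0; case: (x \in B) (x \in A) => -[].
- move=> _ /=; rewrite !addSn !ltnS; split; first by rewrite leqW // (leq_trans le_q) ?leq_addl.
  by rewrite ltnNge (leq_trans le_q) // leq_addl.
Qed.

Lemma linear_refines_rotation p q q' : linear_refines p q -> rotation q q' ->
  exists2 p', rotation p p' & linear_refines p' q'.
Proof.
case=> ps -> qP /rotationP[i ->].
exists (flatten (rot i ps)).
  apply/rotationP; exists (size (flatten (take i ps))).
  by rewrite -{3}(cat_take_drop i ps) !flatten_cat rot_size_cat.
exists (rot i ps) => //; move: (qP); rewrite all2E => /andP[/eqP sz _].
move: qP; rewrite -{1}(cat_take_drop i q) -{1}(cat_take_drop i ps) /rot.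
have szt : size (take i q) = size (take i ps) by rewrite !size_take sz.
have szd : size (drop i q) = size (drop i ps) by rewrite !size_drop sz.
by rewrite !all2_cat // andbC.
Qed.

Lemma opart_n0 (p : opart) : set0 \notin (p : seq {set T}).
Proof. by case: p => p /= /ordered_partitionP[]. Qed.

Definition refines (x y : cpart) :=
  `[< exists p q : opart,
      [/\ x = \pi_cpart p, y = \pi_cpart q & linear_refines p q] >].

Lemma refines_pi (p q : opart) : refines (\pi_cpart p) (\pi_cpart q) ->
  exists p' : opart, \pi_cpart p = \pi_cpart p' /\ linear_refines p' q.
Proof.
case/asboolP=> p1 [q1 [-> /esym/eqmodP rot_q lin]].
have [p' /rotationP[i def_p'] lin'] := linear_refines_rotation lin rot_q.
have p'P : ordered_partition [set: T] p'.
  by case: q {rot_q} lin' => q /= + lin'; apply: linear_refines_partition.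
have szp' : size p' <= #|T| by rewrite def_p' size_rot size_bseq.
exists (@OPart (Bseq szp') p'P); split=> //.
by apply/eqmodP/rotationP; exists i.
Qed.

Lemma refines_refl : reflexive refines.
Proof.
move=> x; apply/asboolP; exists (repr x), (repr x); rewrite reprK; split=> //.
exact/linear_refines_refl/opart_n0.
Qed.

Lemma refines_anti : antisymmetric refines.
Proof.
move=> x y; rewrite -[x]reprK -[y]reprK; move: (repr x) (repr y) => p q.
case/andP=> /refines_pi[p' [-> pq]] /refines_pi[q' [eq_q qp]].
have [le_q eq_pq] := linear_refines_size (opart_n0 q) pq.
have [le_p _] := linear_refines_size (opart_n0 p') qp.
have szq : size q' = size q.
  by rewrite -!number_of_partsE eq_q.
congr (\pi_cpart _); apply/val_inj/val_inj/eq_pq.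
by rewrite -szq.
Qed.

Lemma refines_trans : transitive refines.
Proof.
move=> y x z; rewrite -[x]reprK -[y]reprK -[z]reprK.
move: (repr x) (repr y) (repr z) => p q r pq.
case/refines_pi=> q' [eq_q qr]; move: pq; rewrite eq_q.
case/refines_pi=> p' [-> pq]; apply/asboolP; exists p', r; split=> //.
exact: linear_refines_trans qr.
Qed.

End CyclicPartitions.

Fact refinement_display : Order.disp_t. Proof. exact: Order.Disp tt tt. Qed.

HB.instance Definition _ (T : finType) :=
  Order.Le_isPOrder.Build refinement_display (cpart T)
    (@refines_refl T) (@refines_anti T) (@refines_trans T).

(* A cell F' lies in a closed cell F iff the label of F' refines that of F, so
   the face order is refinement, and the dimension #|T| - m of a cell with m
   parts increases along it. *)
Record cell (T : finType) := Cell {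
  label_of :> cpart T;
  _ : 3 <= number_of_parts label_of
}.

HB.instance Definition _ (T : finType) := [isSub for @label_of T].
HB.instance Definition _ (T : finType) := [Finite of cell T by <:].
HB.instance Definition _ (T : finType) :=
  [SubChoice_isSubPOrder of cell T by <: with refinement_display].

Local Open Scope ring_scope.

Section OrderComplex.
Variables (disp : Order.disp_t) (P : finPOrderType disp).

Record simplex k := Simplex {
  vertices_of :> k.+1.-tuple P;
  _ : sorted <%O vertices_of
}.

HB.instance Definition _ k := [isSub for @vertices_of k].
HB.instance Definition _ k := [Finite of simplex k by <:].

Definition chain k := {ffun simplex k -> int}.
HB.instance Definition _ k := GRing.Zmodule.on (chain k).

Definition face k (t : simplex k.+1) (i : 'I_k.+2) : k.+1.-tuple P :=
  [tuple tnth t (lift i j) | j < k.+1].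

Definition boundary k (c : chain k.+1) : chain k :=
  [ffun s : simplex k =>
     \sum_(t : simplex k.+1) \sum_(i < k.+2 | face t i == s) (-1) ^+ i * c t].

Lemma boundary_is_zmod_morphism k : zmod_morphism (@boundary k).
Proof.
move=> c d; apply/ffunP=> s; rewrite !ffunE -sumrB; apply: eq_bigr => t _.
by rewrite -sumrB; apply: eq_bigr => i _; rewrite !ffunE mulrBr.
Qed.

HB.instance Definition _ k :=
  GRing.isZmodMorphism.Build (chain k.+1) (chain k) (@boundary k)
    (@boundary_is_zmod_morphism k).

(* The complex is not augmented: every 0-chain is a cycle. *)
Definition is_cycle k : {pred chain k} :=
  if k is k'.+1 then fun c : chain k'.+1 => boundary c == 0 else xpredT.
Arguments is_cycle : clear implicits.

Lemma is_cycle_zmod_closed k : zmod_closed (is_cycle k).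
Proof.
case: k => [|k]; split=> //; first by rewrite unfold_in /= raddf0.
by move=> c d; rewrite !unfold_in /= => /eqP bc /eqP bd; rewrite raddfB /= bc bd subr0.
Qed.

HB.instance Definition _ k :=
  GRing.isZmodClosed.Build (chain k) (is_cycle k) (is_cycle_zmod_closed k).

Record cycle k := Cycle {
  chain_of :> chain k;
  _ : chain_of \in is_cycle k
}.

HB.instance Definition _ k := [isSub for @chain_of k].
HB.instance Definition _ k := [Choice of cycle k by <:].
HB.instance Definition _ k := [SubChoice_isSubZmodule of cycle k by <:].

(* Boundaries are cycles, so this is the whole image of [boundary]. *)
Definition is_boundary k : {pred cycle k} :=
  fun z => `[< exists c : chain k.+1, boundary c = z >].
Arguments is_boundary : clear implicits.

Lemma is_boundary_zmod_closed k : zmod_closed (is_boundary k).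
Proof.
split=> [|y z]; rewrite !unfold_in /=; first by apply/asboolP; exists 0; rewrite !raddf0.
move=> /asboolP[c eq_c] /asboolP[d eq_d]; apply/asboolP; exists (c - d).
by rewrite !raddfB /= eq_c eq_d.
Qed.

HB.instance Definition _ k :=
  GRing.isZmodClosed.Build (cycle k) (is_boundary k) (is_boundary_zmod_closed k).

Definition homology k : zmodType := @Quotient.quot (cycle k) (is_boundary k).

End OrderComplex.

Definition free_abelian_of_rank (G : zmodType) (r : nat) :=
  exists f : {additive G -> 'rV[int]_r}, bijective f.

(* Main.v *)
From HB Require Import structures.
From mathcomp Require Import all_boot all_order all_algebra.
From mathcomp Require Import fingroup perm generic_quotient ring_quotient boolp.
From mathcomp Require Import zify ring.
Require Import Defs.

(** Place #|T| = n + 1 points on a circle, up to rotation of the circle: the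
configurations form an n-torus, and the cyclic order in which the points occur,
with coincidences allowed, cuts it into open simplices.  A cyclically ordered
partition into k + 1 parts names one k-simplex.  Refining the partition opens
up coincidences, so the cells with at least three parts, ordered by refinement,
form the dual cell structure of the torus minus its 1-skeleton.  Therefore
H_k of the complex is the relative cohomology group of degree n - k of the
torus modulo its 1-skeleton: the cohomology of the torus when n - k > 2, and,
when n - k = 2, all cocycles of degree 2.  The latter have rank 'C(n, 2) plus
the rank of the coboundaries of degree 2, which is 2 ^ n - 1 (the number of
edges) minus n.

Fixing a base point, a partition is recorded by its block function F, with F x
the index of the block of x and F ord0 = 0.  The faces of a simplex merge
cyclically adjacent blocks ([face_at]); they satisfy the simplicial identities,
so the alternating sum [coboundary] squares to 0 ([coboundaryK]).  Read on
chains of cells, this same operator is the cellular boundary of the dual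
complex ([boundary_code]).

The homology in question is that of the order complex, so the cellular complex
must first be compared with it ([cellular_homology]).  Barycentric subdivision
sends a cell to the signed sum of its complete flags ([subdivision]), and the
mapping cone of this chain map is exact over every down-set, by induction on
the down-set, as soon as each closed cell is acyclic ([exact_in_down]).  A
closed cell is a product of permutohedra, and it is acyclic by induction
([local_exact]): when some block has a second element, take one element a of
it; all refinements in which a is not by itself at the front of that block
cancel in pairs, according to whether a forms a block of its own or is joined
to the block on its left ([local_exact_step]).

The cocycles of the torus are found by a matching of the same kind.  Look for
the first point that fails to follow the smaller ones as the next singleton
block (its pivot): a simplex whose pivot is a singleton is paired with the one
where the pivot is joined to the block on its left, and the unpaired simplices
are the increasing arrangements of singletons, one for each set S of points.
The matching is triangular ([upper_face]), so coboundaries of matched cochains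
can be prescribed at will on one half of the pairs ([solve_lower]).  The
fundamental cycle of the subtorus on S, the signed sum of all orderings of S,
pairs to 0 with coboundaries ([pairing_coboundary]) and is dual to the cup
product of the coordinate classes in S ([pairing_cup]).  So a cocycle is a
coboundary exactly when all its pairings vanish ([exact_of_pairings]), the
pairings take arbitrary values, and in degree 2 the values on one half of the
pairs give the remaining coordinates ([cocycle_exists], [cocycle_unique]). *)

Set Implicit Arguments.
Unset Strict Implicit.
Unset Printing Implicit Defensive.

Import Order.TTheory GRing.Theory Num.Theory.

Local Open Scope ring_scope.

(** * Chains of a poset as lists *)

Lemma sum_neq0 (I : finType) (g : I -> int) :
  \sum_i g i != 0 -> exists i, g i != 0.
Proof.
move=> nz; case: (pickP (fun i => g i != 0)) => [i gi|g0]; first by exists i.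
by rewrite big1 ?eqxx // in nz => i _; apply/eqP/negbFE/g0.
Qed.

Section ListChains.
Variable P : finType.
Implicit Types (f g : seq P -> int) (s t : seq P).

(** Chains are functions on all lists of vertices, the largest vertex first, and
the boundary sums over the ways to insert a vertex into [s].  With the insertion
at the head split off, identities between chains follow by induction on [s];
the sign counts the vertices below the inserted one. *)
Fixpoint list_boundary f s : int :=
  (-1) ^+ size s * (\sum_y f (y :: s)) +
  (if s is x :: t then list_boundary (fun u => f (x :: u)) t else 0).

Lemma list_boundary_nil f : list_boundary f [::] = \sum_y f [:: y].
Proof. by rewrite /= addr0 mul1r. Qed.

Lemma eq_in_list_boundary f g s :
  (forall u, size u = (size s).+1 -> f u = g u) ->
  list_boundary f s = list_boundary g s.
Proof.
elim: s f g => [|x s IHs] f g eq_fg /=.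
  by congr (_ * _ + _); apply: eq_bigr => y _; apply: eq_fg.
congr (_ * _ + _); first by apply: eq_bigr => y _; apply: eq_fg.
by apply: IHs => u su; apply: eq_fg; rewrite /= su.
Qed.

Lemma eq_list_boundary f g : f =1 g -> list_boundary f =1 list_boundary g.
Proof. by move=> eq_fg s; apply: eq_in_list_boundary => u _. Qed.

Lemma list_boundary_linear a f g s :
  list_boundary (fun u => a * f u + g u) s
  = a * list_boundary f s + list_boundary g s.
Proof.
elim: s f g => [|x s IHs] f g /=; last rewrite (IHs (fun u => f (x :: u)));
  rewrite big_split -mulr_sumr /=; ring.
Qed.

Lemma list_boundary0 s : list_boundary (fun=> 0) s = 0.
Proof.
by elim: s => [|x s IHs] /=; rewrite big1 // mulr0 add0r.
Qed.

Lemma list_boundaryD f g s :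
  list_boundary (fun u => f u + g u) s = list_boundary f s + list_boundary g s.
Proof.
rewrite -[list_boundary f s]mul1r -list_boundary_linear.
by apply: eq_list_boundary => u; rewrite mul1r.
Qed.

Lemma list_boundaryZ a f s :
  list_boundary (fun u => a * f u) s = a * list_boundary f s.
Proof.
rewrite -[RHS]addr0 -(list_boundary0 s) -list_boundary_linear.
by apply: eq_list_boundary => u; rewrite addr0.
Qed.

Lemma list_boundaryB f g s :
  list_boundary (fun u => f u - g u) s = list_boundary f s - list_boundary g s.
Proof.
by rewrite list_boundaryD -mulN1r -list_boundaryZ; congr (_ + _);
  apply: eq_list_boundary => u; rewrite mulN1r.
Qed.

Lemma list_boundary_sum (I : finType) (F : I -> seq P -> int) s :
  list_boundary (fun u => \sum_i F i u) s = \sum_i list_boundary (F i) s.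
Proof.
elim: (index_enum I) => [|i r IHr].
  rewrite big_nil -[RHS](list_boundary0 s).
  by apply: eq_list_boundary => u; rewrite big_nil.
rewrite big_cons -IHr -list_boundaryD; apply: eq_list_boundary => u.
by rewrite big_cons.
Qed.

Lemma list_boundary_sign f s :
  list_boundary (fun u => (-1) ^+ size u * f u) s
  = (-1) ^+ (size s).+1 * list_boundary f s.
Proof.
elim: s f => [|x s IHs] f /=.
  by rewrite -mulr_sumr /=; ring.
rewrite -mulr_sumr /=.
under eq_list_boundary do rewrite exprS -mulrA.
rewrite list_boundaryZ IHs; move: (\sum_y _) (list_boundary _ _) => A B.
by rewrite !exprS; ring.
Qed.

(** The two orders in which two vertices can be inserted at the head come with
opposite signs; insertions further down are taken care of by induction. *)
Lemma list_boundaryK f s : list_boundary (list_boundary f) s = 0.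
Proof.
elim: s f => [|x s IHs] f.
  rewrite /= addr0 expr0 mul1r big_split /= -mulr_sumr.
  under [X in _ + X]eq_bigr do rewrite /= addr0 mul1r.
  by rewrite [X in _ + X]exchange_big /=; ring.
rewrite [LHS]/= -/(list_boundary f).
pose n := size s; pose G y w := f [:: w, y, x & s].
pose H y := list_boundary (fun u => f [:: y, x & u]) s.
have -> : list_boundary (fun u => list_boundary f (x :: u)) s
          = (-1) ^+ n * \sum_y H y.
  pose S u := \sum_y f [:: y, x & u].
  have E u : list_boundary f (x :: u)
             = (-1) ^+ size u * (-1 * S u) + list_boundary (fun v => f (x :: v)) u.
    by rewrite /= exprS /S; ring.
  rewrite (eq_list_boundary E) list_boundaryD IHs addr0 list_boundary_sign.
  by rewrite list_boundaryZ list_boundary_sum exprS /H /n; ring.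
under eq_bigr => y _ do rewrite /= -/(H y) exprS -/n.
rewrite !big_split /= -!mulr_sumr -/n.
rewrite [\sum_y \sum_w f [:: y, w, x & s]]exchange_big /=.
by rewrite exprS; ring.
Qed.

Lemma list_boundary_support f s : list_boundary f s != 0 ->
  exists2 u, f u != 0 & subseq s u.
Proof.
elim: s f => [|x s IHs] f /=.
  rewrite addr0 mul1r => /sum_neq0[y fy]; first by exists [:: y].
have [->|nz _] := eqVneq (\sum_y f [:: y, x & s]) 0.
  rewrite mulr0 add0r => /IHs[u fu sub]; exists (x :: u) => //=.
  by rewrite eqxx.
by case/sum_neq0: nz => y fy; exists [:: y, x & s] => //; apply: subseq_cons.
Qed.

End ListChains.

(** * Subdividing a cellular complex *)

Section Comparison.
Variables (disp : Order.disp_t) (P : finPOrderType disp).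
Implicit Types (x y : P) (Q : {set P}) (z w : seq P -> int) (c e : P -> int).

Definition below x : {set P} := [set y | (y <= x)%O].

Definition chain_in Q s := [&& s != [::], sorted >%O s & all (mem Q) s].

Lemma sorted_gt_head x s y : sorted >%O (x :: s) -> y \in s -> (y < x)%O.
Proof.
have trans : transitive (>%O : rel P) by move=> ? ? ? lt1 lt2; apply: lt_trans lt2 lt1.
by move/(order_path_min trans)/allP/[apply].
Qed.

Lemma chain_in_subseq Q s t :
  s != [::] -> subseq s t -> chain_in Q t -> chain_in Q s.
Proof.
move=> s0 sub /and3P[_ st Qt]; rewrite /chain_in s0 /=.
rewrite (subseq_sorted _ sub st) /=; last by move=> y u v /= lt1 lt2; apply: lt_trans lt2 lt1.
by apply/allP=> x /(mem_subseq sub) /(allP Qt).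
Qed.

Lemma chain_in_sub Q Q' s : Q \subset Q' -> chain_in Q s -> chain_in Q' s.
Proof.
move=> /subsetP sub /and3P[s0 st /allP Qs]; rewrite /chain_in s0 st.
by apply/allP=> x /Qs /sub.
Qed.

Definition supported_in Q z := forall s, z s != 0 -> chain_in Q s.

Lemma supported_boundary Q z s : supported_in Q z -> s != [::] ->
  list_boundary z s != 0 -> chain_in Q s.
Proof. by move=> zQ s0 /list_boundary_support[u /zQ Qu /chain_in_subseq->]. Qed.

(** The chains below [x] form a cone: a cycle is the boundary of the chain
obtained by putting the apex [x] on top of those of its lists that avoid [x]. *)
Lemma cone_acyclic x z : supported_in (below x) z ->
  (forall s, list_boundary z s = 0) ->
  exists2 w, supported_in (below x) w & forall s, list_boundary w s = z s.
Proof.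
move=> zQ dz.
pose w s := if s is y :: t then
  if (y == x) && sorted >%O s then (-1) ^+ size t * z t else 0 else 0.
have z0 s : ~~ chain_in (below x) s -> z s = 0.
  by move=> nch; apply/eqP; apply: contraNT nch => /zQ.
have zxx t : z [:: x, x & t] = 0 by apply: z0; rewrite /chain_in /= ltxx.
have zlex y t : z [:: y, x & t] = 0.
  apply: z0; rewrite /chain_in /= inE; apply/negP => /andP[/andP[lt _] /andP[le _]].
  by rewrite (lt_geF lt) in le.
have wE y t : w (y :: t) = if y == x then (-1) ^+ size t *
    (z t - (if ohead t == Some x then z t else 0)) else 0.
  rewrite /w; case: eqP => //= ->; have [->|/zQ] := eqVneq (z t) 0.
    by case: ifP; case: ifP; rewrite ?subrr ?mulr0.
  case: t => [//|v t] /and3P[_ /= st /andP[]]; rewrite inE => le_v _.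
  rewrite st andbT; have [->|neq] := eqVneq v x; first by rewrite ltxx eqxx subrr mulr0.
  by rewrite lt_def eq_sym neq le_v (inj_eq Some_inj) (negPf neq) subr0.
have w0 : w [::] = 0 by [].
exists w; first case=> [|y t] //=.
  case: ifP => [/andP[/eqP-> st]|_] //.
  have [->|/zQ /and3P[_ _ Qt] _] := eqVneq (z t) 0; first by rewrite mulr0.
  by rewrite /chain_in /= st inE lexx.
clearbody w.
case=> [|y t].
  rewrite /= addr0 mul1r (z0 [::]) ?big1 // => y _.
  by rewrite wE (z0 [::]) // sub0r oppr0 mulr0; case: ifP.
have [->{y}|neq] := eqVneq y x; last first.
  rewrite /= [X in _ + X](eq_list_boundary (g := fun=> 0)) ?list_boundary0; last first.
    by move=> u; rewrite wE (negPf neq).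
  rewrite addr0 (bigD1 x) //= big1 ?addr0; last by move=> v /negPf nvx; rewrite wE nvx.
  rewrite wE eqxx /= (inj_eq Some_inj) (negPf neq) subr0; by rewrite mulrA -expr2 sqrr_sign mul1r.
rewrite [LHS]/= big1 ?mulr0 ?add0r; last first.
  by move=> y _; rewrite wE /= eqxx subrr mulr0; case: ifP.
pose zx u := if ohead u == Some x then z u else 0.
have E u : w (x :: u) = (-1) ^+ size u * (z u - zx u) by rewrite wE eqxx.
rewrite (eq_list_boundary E) list_boundary_sign list_boundaryB dz sub0r.
case: t => [|y t].
  rewrite /= addr0 mul1r (bigD1 x) //= big1 ?addr0 /zx /= ?eqxx; first by ring.
  by move=> v neq; rewrite (inj_eq Some_inj) (negPf neq).
have -> : list_boundary zx (y :: t) = (-1) ^+ (size t).+1 * z [:: x, y & t].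
  rewrite /= (bigD1 x) //= big1 ?addr0 ?{1}/zx /= ?eqxx => [|v neq]; last first.
    by rewrite /zx /= (inj_eq Some_inj) (negPf neq).
  rewrite -[RHS]addr0; congr (_ + _).
  have [->|neq] := eqVneq y x; last first.
    rewrite -[RHS](list_boundary0 t); apply: eq_list_boundary => u.
    by rewrite /zx /= (inj_eq Some_inj) (negPf neq).
  rewrite -[RHS](dz (x :: t)) [RHS]/= big1 ?mulr0 ?add0r; last by move=> v _.
  by apply: eq_list_boundary => u; rewrite /zx /= eqxx.
rewrite /= !exprS; have := sqrr_sign int (size t); rewrite expr2.
move: ((-1) ^+ size t) (z _) => e Z ee; transitivity (e * e * Z); first by ring.
by rewrite ee mul1r.
Qed.


Variables (inc : P -> P -> int) (aug : P -> int).

Definition cell_boundary c y := \sum_x inc x y * c x.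

(** The coefficient of a complete flag in the barycentric subdivision of its
largest cell.  The sign compensates for the place at the head of the list where
the boundary of an order chain inserts the next larger cell. *)
Fixpoint flag_weight s : int :=
  if s is x :: t then
    if t is y :: _ then (-1) ^+ size t * inc x y * flag_weight t else aug x
  else 0.

Definition subdivision c s := if s is x :: _ then c x * flag_weight s else 0.

Lemma subdivisionD c e s :
  subdivision (fun x => c x + e x) s = subdivision c s + subdivision e s.
Proof. by case: s => [|x s] /=; rewrite ?addr0 // mulrDl. Qed.

Lemma subdivisionN c s : subdivision (fun x => - c x) s = - subdivision c s.
Proof. by case: s => [|x s] /=; rewrite ?oppr0 // mulNr. Qed.

Lemma cell_boundaryD c e y :
  cell_boundary (fun x => c x + e x) y = cell_boundary c y + cell_boundary e y.
Proof. by rewrite -big_split; apply: eq_bigr => x _; rewrite mulrDr. Qed.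

Lemma cell_boundaryN c y :
  cell_boundary (fun x => - c x) y = - cell_boundary c y.
Proof. by rewrite -sumrN; apply: eq_bigr => x _; rewrite mulrN. Qed.

Hypothesis inc_lt : forall x y, inc x y != 0 -> (y < x)%O.
Hypothesis incK : forall x y, \sum_w inc x w * inc w y = 0.
Hypothesis inc_aug : forall x, \sum_y inc x y * aug y = 0.

Lemma flag_weight_sorted s : flag_weight s != 0 -> (s != [::]) && sorted >%O s.
Proof.
elim: s => [|x [|y s] IHs] //; rewrite [flag_weight _]/=.
rewrite !mulf_eq0 !negb_or => /andP[/andP[_ /inc_lt lt] /IHs /= ->].
by rewrite lt.
Qed.

Lemma cell_boundaryK c y : cell_boundary (cell_boundary c) y = 0.
Proof.
rewrite /cell_boundary; under eq_bigr do rewrite mulr_sumr.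
rewrite exchange_big big1 // => x _ /=.
transitivity ((\sum_w inc x w * inc w y) * c x); last by rewrite incK mul0r.
by rewrite mulr_suml; apply: eq_bigr => w _; ring.
Qed.

(** Insertions strictly inside a flag cancel because the cellular boundary squares
to zero; at the bottom of the flag this is the augmentation. *)
Lemma flag_weight_inner x t : list_boundary (fun u => flag_weight (x :: u)) t = 0.
Proof.
elim: t x => [|y t IHt] x.
  rewrite /= addr0 mul1r -[RHS]oppr0 -[in RHS](inc_aug x) -sumrN.
  by apply: eq_bigr => y _; ring.
rewrite [LHS]/= [X in _ * X](_ : _ = 0) ?mulr0 ?add0r; last first.
  transitivity (- flag_weight (y :: t) * \sum_w inc x w * inc w y); last first.
    by rewrite incK mulr0.
  rewrite mulr_sumr.
  apply: eq_bigr => w _; rewrite /= !exprS.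
  have := sqrr_sign int (size t); rewrite expr2.
  move: ((-1) ^+ size t) (if t is _ :: _ then _ else _) => e Z ee.
  transitivity (- (e * e) * Z * (inc x w * inc w y)); first by ring.
  by rewrite ee; ring.
have E u : flag_weight [:: x, y & u]
           = (-1) ^+ size u * (- inc x y * flag_weight (y :: u)).
  by rewrite /= exprS; ring.
by rewrite (eq_list_boundary E) list_boundary_sign list_boundaryZ IHt !mulr0.
Qed.

(** By [flag_weight_inner] only insertions on top survive, and these add up to the
cellular boundary. *)
Lemma subdivision_boundary c s : s != [::] ->
  list_boundary (subdivision c) s = subdivision (cell_boundary c) s.
Proof.
case: s => [//|x t] _; rewrite [LHS]/= list_boundaryZ flag_weight_inner mulr0 addr0.
rewrite /subdivision /cell_boundary mulr_suml mulr_sumr; apply: eq_bigr => y _.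
rewrite -/(flag_weight (x :: t)) exprS.
have := sqrr_sign int (size t); rewrite expr2.
move: ((-1) ^+ size t) (flag_weight _) => e Z ee.
transitivity ((e * e) * (inc y x * c y * Z)); first by ring.
by rewrite ee; ring.
Qed.

Lemma subdivision_supported Q c :
  (forall x y, x \in Q -> (y <= x)%O -> y \in Q) ->
  (forall x, c x != 0 -> x \in Q) -> supported_in Q (subdivision c).
Proof.
move=> downQ cQ [|x s]; first by rewrite eqxx.
rewrite mulf_eq0 negb_or => /andP[/cQ Qx /flag_weight_sorted] /= st.
rewrite /chain_in /= st Qx /=; apply/allP => y sy; apply: (downQ x) => //.
exact/ltW/(sorted_gt_head st).
Qed.

Hypothesis local_exact : forall x c (e : int),
  (forall y, c y != 0 -> (y <= x)%O) ->
  (forall y, cell_boundary c y = 0) -> \sum_y c y * aug y = 0 ->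
  exists c', [/\ forall y, c' y != 0 -> (y <= x)%O,
                 forall y, cell_boundary c' y = c y & \sum_y c' y * aug y = e].

(** Exactness of the mapping cone of [subdivision] over the down-set [Q]: the pair
[(z, c)] is a cycle of the cone and [(w, e)] bounds it. *)
Definition exact_in Q := forall z c,
  supported_in Q z -> (forall x, c x != 0 -> x \in Q) ->
  (forall s, s != [::] -> list_boundary z s = subdivision c s) ->
  (forall y, cell_boundary c y = 0) ->
  exists w e, [/\ supported_in Q w, forall x, e x != 0 -> x \in Q,
    forall s, s != [::] -> z s = list_boundary w s + subdivision e s &
    forall y, c y = cell_boundary e y].

Lemma below_down x y y' : y \in below x -> (y' <= y)%O -> y' \in below x.
Proof. by rewrite !inE => le1 le2; apply: le_trans le2 le1. Qed.

(** Over a principal down-set both complexes are acyclic: after [c] has been bounded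
by a cellular chain with the right augmentation, what is left of [z] is bounded
in the cone over [x]. *)
Lemma exact_in_below x : exact_in (below x).
Proof.
move=> z c zQ cQ dz dc.
have aug_c : \sum_y c y * aug y = 0.
  transitivity (list_boundary (list_boundary z) [::]); last exact: list_boundaryK.
  by rewrite list_boundary_nil; apply: eq_bigr => y _; rewrite dz.
have [|e [eQ de aug_e]] := local_exact (\sum_y z [:: y]) _ dc aug_c (x := x).
  by move=> y /cQ; rewrite inE.
have eQ' y : e y != 0 -> y \in below x by move/eQ; rewrite inE.
have [|s|w wQ dw] := cone_acyclic (x := x) (z := fun s => z s - subdivision e s).
- move=> s; have [->|/zQ //] := eqVneq (z s) 0.
  by rewrite sub0r oppr_eq0; apply: subdivision_supported eQ' _; apply: below_down.
- rewrite list_boundaryB; case: s => [|y s].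
    by rewrite /= !addr0 !mul1r aug_e subrr.
  rewrite dz // subdivision_boundary // -[RHS](subrr (subdivision c (y :: s))).
  by rewrite /subdivision de.
- by exists w, e; split=> // s _; rewrite dw subrK.
Qed.

(** A maximal element [x] of [Q] splits a cycle of the cone into the part that
involves [x], which lives below [x], and the rest.  The boundary of the first
part lives strictly below [x], where it can be bounded; correcting both parts
accordingly makes them cycles over [below x] and over [Q :\ x]. *)
Theorem exact_in_down Q :
  (forall x y, x \in Q -> (y <= x)%O -> y \in Q) -> exact_in Q.
Proof.
have [m] := ubnP #|Q|; elim: m Q => // m IHm Q leQ downQ.
case: (set_0Vmem Q) => [Q0|[x0 Qx0]].
  move=> z c zQ cQ _ _; exists (fun=> 0), (fun=> 0); split=> [s|x|s _|y].
  - by rewrite eqxx.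
  - by rewrite eqxx.
  - rewrite list_boundary0; case: s => [|x s] /=.
      by apply/eqP; apply: contraT => /zQ.
    rewrite mul0r addr0; apply/eqP; apply: contraT => /zQ /and3P[_ _ /=].
    by rewrite Q0 inE.
  - rewrite /cell_boundary big1 => [|x _]; last by rewrite mulr0.
    by apply/eqP; apply: contraT => /cQ; rewrite Q0 inE.
have [x Qx maxx] : exists2 x, x \in Q & forall y, y \in Q -> ~~ (x < y)%O.
  pose h x := #|[set y in Q | (y <= x)%O]|.
  exists [arg max_(x > x0 in Q) h x]; case: arg_maxnP => //= x Qx mx y Qy.
  apply/negP => lt; have := mx y Qy; rewrite leqNgt => /negP[].
  apply: proper_card; apply/properP; split.
    apply/subsetP => u; rewrite !inE => /andP[-> le].
    by rewrite (le_trans le) ?ltW.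
  by exists y; rewrite !inE Qy ?lexx // lt_geF.
have [eqQ|neqQ] := eqVneq Q (below x).
  by rewrite eqQ; apply: exact_in_below.
have subQ : below x \subset Q by apply/subsetP => y; rewrite inE; apply: downQ.
have ltQ : (#|below x| < #|Q|)%N by rewrite proper_card // properEneq eq_sym neqQ.
have Qx' : Q :\ x \subset Q by apply: subsetDl.
have bx' : below x :\ x \subset below x by apply: subsetDl.
have bQ : below x :\ x \subset Q :\ x by apply: setSD.
have down1 u v : u \in Q :\ x -> (v <= u)%O -> v \in Q :\ x.
  rewrite !inE => /andP[nu Qu] le; rewrite (downQ u) // andbT.
  apply: contraNneq nu => eqv; rewrite eqv in le.
  by have := maxx u Qu; rewrite lt_def le andbT negbK.
have down2 u v : u \in below x :\ x -> (v <= u)%O -> v \in below x :\ x.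
  rewrite !inE => /andP[nu lu] le; rewrite (le_trans le lu) andbT.
  by apply: contraNneq nu => eqv; rewrite eq_le lu -eqv le.
have ex1 : exact_in (Q :\ x).
  apply: IHm => //; rewrite -ltnS; apply: leq_trans leQ.
  by rewrite ltnS [in leqRHS](cardsD1 x) Qx.
have ex2 : exact_in (below x :\ x).
  apply: IHm => //; rewrite -ltnS; apply: leq_trans leQ; rewrite ltnS.
  by rewrite (leq_ltn_trans _ ltQ) // subset_leq_card.
have ex3 : exact_in (below x) by apply: exact_in_below.
move=> z c zQ cQ dz dc.
pose zx s := if ohead s == Some x then z s else 0.
pose cx y := if y == x then c y else 0.
pose zr s := z s - zx s; pose cr y := c y - cx y.
have sub_chain s : z s != 0 -> ohead s = Some x -> chain_in (below x) s.
  move=> /zQ; case: s => [//|y s] /and3P[_ st _] /= [eqy].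
  rewrite /chain_in st /= inE eqy lexx; apply/allP => v sv /=.
  by rewrite inE; apply: ltW; rewrite -eqy; apply: sorted_gt_head st sv.
have zxb : supported_in (below x) zx.
  by move=> s; rewrite /zx; case: (ohead s =P _) => [eqs nz|_ /eqP//]; apply: sub_chain nz eqs.
have zrb : supported_in (Q :\ x) zr.
  move=> s; rewrite /zr /zx; case: (ohead s =P _) => [_|neq]; first by rewrite subrr eqxx.
  rewrite subr0 => /zQ /and3P[s0 st /allP Qs]; rewrite /chain_in s0 st /=.
  apply/allP => v sv; have Qv : v \in Q by apply: Qs.
  rewrite /= !inE Qv andbT; apply/eqP => eqv.
  case: s s0 st Qs sv neq => [//|y s] _ /= st Qs; rewrite inE eqv.
  case/predU1P=> [->//|sx] _; have := maxx y (Qs y (mem_head _ _)).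
  by rewrite (sorted_gt_head st).
have cxb y : cx y != 0 -> y \in below x.
  by rewrite /cx; case: (y =P x) => [->|_ /eqP//]; rewrite inE lexx.
have crb y : cr y != 0 -> y \in Q :\ x.
  rewrite /cr /cx; case: (y =P x) => [->|neq]; first by rewrite subrr eqxx.
  by rewrite subr0 !inE => /cQ ->; rewrite andbT; apply/eqP.
pose p s := if s is [::] then 0 else list_boundary zx s - subdivision cx s.
pose q y := cell_boundary cx y.
have zE s : z s = zx s + zr s by rewrite /zr addrC subrK.
have cE y : c y = cx y + cr y by rewrite /cr addrC subrK.
have pE s : s != [::] -> p s = subdivision cr s - list_boundary zr s.
  move=> s0; have := dz s s0; rewrite (eq_list_boundary zE) list_boundaryD.
  have -> : subdivision c s = subdivision cx s + subdivision cr s.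
    by rewrite -subdivisionD; case: s {s0} => //= y s; rewrite cE.
  by case: s s0 => // y s _; rewrite /p; lia.
have qE y : q y = - cell_boundary cr y.
  apply/eqP; rewrite -addr_eq0 -(dc y) -cell_boundaryD; apply/eqP.
  by apply: eq_bigr => v _; rewrite -cE.
have [|y|s s0|y|w1 [e1 [w1Q e1Q pw qe]]] := ex2 p (fun y => - q y).
- move=> s; case: (eqVneq s [::]) => [->//|s0 ps].
  have ch1 : chain_in (below x) s.
    have [/eqP eq0|nz] := boolP (list_boundary zx s == 0).
      move: ps; case: s s0 eq0 => // y s _; rewrite /p => ->.
      rewrite sub0r oppr_eq0; apply: subdivision_supported cxb _.
      exact: below_down.
    exact: supported_boundary zxb s0 nz.
  have ch2 : chain_in (Q :\ x) s.
    move: ps; rewrite pE //.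
    have [/eqP eq0|nz _] := boolP (list_boundary zr s == 0).
      by rewrite eq0 subr0; apply: subdivision_supported crb _.
    exact: supported_boundary zrb s0 nz.
  case/and3P: ch1 => _ _ /allP in1; case/and3P: ch2 => _ st /allP in2.
  rewrite /chain_in s0 st; apply/allP => v sv; have := in1 v sv; have := in2 v sv.
  by rewrite /= !inE => /andP[-> _] ->.
- rewrite oppr_eq0 => nz.
  rewrite inE; apply/andP; split.
    move: nz; rewrite qE oppr_eq0 => /sum_neq0[v]; rewrite mulf_eq0 negb_or.
    case/andP=> /inc_lt lt /crb Qv; have := down1 v y Qv (ltW lt).
    by rewrite !inE => /andP[].
  move: nz => /sum_neq0[v]; rewrite mulf_eq0 negb_or => /andP[/inc_lt/ltW le /cxb].
  by move/below_down; apply.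
- rewrite (eq_in_list_boundary (g := fun t => list_boundary zx t - subdivision cx t)).
    2: by case.
  rewrite list_boundaryB list_boundaryK sub0r.
  by rewrite subdivision_boundary // -subdivisionN.
- by rewrite cell_boundaryN cell_boundaryK oppr0.
have e1Q' y : e1 y != 0 -> y \in below x by move/e1Q/(subsetP bx').
have [|y|s s0|y|w2 [e2 [w2Q e2Q z2 c2]]] := ex3 (fun s => zx s - w1 s) (fun y => cx y + e1 y).
- move=> s; have [->|/zxb //] := eqVneq (zx s) 0.
  by rewrite sub0r oppr_eq0 => /w1Q/(chain_in_sub bx').
- by have [->|/cxb //] := eqVneq (cx y) 0; rewrite add0r => /e1Q'.
- rewrite list_boundaryB subdivisionD.
  by have := pw s s0; case: s s0 => // v s _; rewrite /p; lia.
- by rewrite cell_boundaryD -qe -/(q y) subrr.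
have [|y|s s0|y|w3 [e3 [w3Q e3Q z3 c3]]] :=
  ex1 (fun s => zr s + w1 s) (fun y => cr y + - e1 y).
- move=> s; have [->|/zrb //] := eqVneq (zr s) 0.
  by rewrite add0r => /w1Q/(chain_in_sub bQ).
- have [->|/crb //] := eqVneq (cr y) 0.
  by rewrite add0r oppr_eq0 => /e1Q/(subsetP bQ).
- rewrite list_boundaryD subdivisionD subdivisionN.
  by have := pw s s0; rewrite pE //; lia.
- by rewrite cell_boundaryD cell_boundaryN -qe qE; lia.
exists (fun s => w2 s + w3 s), (fun y => e2 y + e3 y); split=> [s|y|s s0|y].
- have [->|/w2Q /(chain_in_sub subQ) //] := eqVneq (w2 s) 0.
  by rewrite add0r => /w3Q/(chain_in_sub Qx').
- have [->|/e2Q /(subsetP subQ) //] := eqVneq (e2 y) 0.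
  by rewrite add0r => /e3Q/(subsetP Qx').
- rewrite zE list_boundaryD subdivisionD.
  by have := z2 s s0; have := z3 s s0; lia.
- by rewrite cell_boundaryD -c2 -c3 cE; lia.
Qed.

End Comparison.

(** * Lists and simplices *)

Section SimplexLists.
Variables (disp : Order.disp_t) (P : finPOrderType disp).
Implicit Types (s u v : seq P) (f : seq P -> int).

Definition remove_at i v := take i v ++ drop i.+1 v.

Lemma remove_at_subseq i v : subseq (remove_at i v) v.
Proof.
rewrite -{2}(cat_take_drop i v) /remove_at cat_subseq //.
by rewrite -(addn1 i) addnC -drop_drop drop_subseq.
Qed.

Lemma size_remove_at i v : (i < size v)%N -> size (remove_at i v) = (size v).-1.
Proof. by move=> lti; rewrite size_cat size_take size_drop lti; lia. Qed.

Lemma val_face k (t : simplex P k.+1) (i : 'I_k.+2) : face t i = remove_at i t :> seq P.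
Proof.
have st : size t = k.+2 by rewrite size_tuple.
pose x0 := tnth t ord0.
apply: (@eq_from_nth _ x0) => [|j]; first by rewrite size_tuple size_remove_at st.
rewrite size_tuple => ltj; rewrite -[j]/(val (Ordinal ltj)) -tnth_nth tnth_mktuple.
rewrite (tnth_nth x0) /= /remove_at nth_cat size_take st ltn_ord /bump.
case: ltnP => [ltji|leij]; first by rewrite nth_take.
by rewrite nth_drop; congr nth; lia.
Qed.

Lemma rev_face k (t : simplex P k.+1) (i : 'I_k.+2) :
  rev (face t i) = remove_at (k.+1 - i) (rev t).
Proof.
have st : size t = k.+2 by rewrite size_tuple.
rewrite val_face /remove_at rev_cat take_rev drop_rev st.
by congr (rev (drop _ _) ++ rev (take _ _)); have := ltn_ord i; lia.
Qed.

Lemma face_sorted k (t : simplex P k.+1) i : sorted <%O (face t i).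
Proof.
rewrite val_face; apply: (subseq_sorted lt_trans (remove_at_subseq _ _)).
by case: t.
Qed.

(** The faces of a list are numbered from its end, as simplices list their vertices
in increasing order. *)
Lemma list_boundary_delta v s :
  list_boundary (fun u => (u == v)%:R) s
  = \sum_(i < size v | remove_at ((size v).-1 - i) v == s) (-1) ^+ i.
Proof.
elim: v s => [|y v IHv] s.
  rewrite big_ord0 -[RHS](list_boundary0 s); apply: eq_in_list_boundary.
  by case.
rewrite big_mkcond big_ord_recr /= subnn.
have -> : remove_at 0 (y :: v) = v by rewrite /remove_at take0 /= drop0.
have step : \sum_x ([:: x & s] == y :: v)%:R = (v == s)%:R :> int.
  rewrite (bigD1 y) //= big1 ?addr0 => [|x neq]; first by rewrite eqseq_cons eqxx eq_sym.
  by rewrite eqseq_cons (negPf neq).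
have E (i : 'I_(size v)) :
    remove_at (size v - i) (y :: v) = y :: remove_at ((size v).-1 - i) v.
  by have -> : (size v - i = ((size v).-1 - i).+1)%N by have := ltn_ord i; lia.
have -> : list_boundary (fun u => (u == y :: v)%:R) s = (-1) ^+ size s * (v == s)%:R
   + \sum_(i < size v) (if remove_at (size v - i) (y :: v) == s then (-1) ^+ i else 0).
  rewrite -step; case: s {step} => [|x s] /=; congr (_ + _).
    by rewrite big1 // => i _; rewrite E.
  have [->|neq] := eqVneq x y; last first.
    rewrite -[LHS]/(list_boundary _ s) big1 => [|i _]; last first.
      by rewrite E eqseq_cons eq_sym (negPf neq).
    rewrite -[RHS](list_boundary0 s); apply: eq_list_boundary => u.
    by rewrite eqseq_cons (negPf neq).
  rewrite -big_mkcond; transitivity (list_boundary (fun u => (u == v)%:R) s).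
    by apply: eq_list_boundary => u; rewrite eqseq_cons eqxx.
  by rewrite IHv; apply: eq_bigl => i; rewrite E eqseq_cons eqxx.
rewrite addrC; congr (_ + _); case: eqP => [->|_]; by rewrite ?mulr1 ?mulr0.
Qed.

(** Simplices are increasing tuples, whence the reversal. *)
Definition to_list k (c : chain P k) s : int := \sum_(t : simplex P k) c t * (s == rev t)%:R.

Definition of_list k f : chain P k := [ffun t : simplex P k => f (rev t)].

Lemma to_listE k (c : chain P k) (t : simplex P k) : to_list c (rev t) = c t.
Proof.
rewrite /to_list (bigD1 t) //= eqxx mulr1 big1 ?addr0 // => u neq.
rewrite (can_eq revK) -[_ == _]/(val (val t) == val (val u)) !val_eqE.
by rewrite eq_sym (negPf neq) mulr0.
Qed.

Lemma to_list_simplex k (c : chain P k) s : to_list c s != 0 ->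
  exists t : simplex P k, s = rev t.
Proof.
case: (pickP (fun t : simplex P k => s == rev t)) => [t /eqP|none]; first by exists t.
by rewrite /to_list big1 ?eqxx // => t _; rewrite none mulr0.
Qed.

Lemma list_simplex k s : sorted >%O s -> size s = k.+1 ->
  exists t : simplex P k, s = rev t.
Proof.
move=> st sz; have sz' : size (rev s) == k.+1 by rewrite size_rev sz.
have st' : sorted <%O (Tuple sz') by rewrite rev_sorted.
by exists (Simplex st'); rewrite /= revK.
Qed.

Lemma simplex_list k (t : simplex P k) : chain_in [set: P] (rev t).
Proof.
rewrite /chain_in -size_eq0 size_rev size_tuple rev_sorted /=.
case: t => t /= ->; apply/allP => x _; exact: in_setT.
Qed.

Lemma to_list_supported k (c : chain P k) : supported_in [set: P] (to_list c).
Proof. by move=> s /to_list_simplex[t ->]; apply: simplex_list. Qed.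

Lemma of_listK k f : supported_in [set: P] f ->
  forall s, size s = k.+1 -> to_list (of_list k f) s = f s.
Proof.
move=> fP s sz; have [/and3P[_ st _]|nch] := boolP (chain_in [set: P] s).
  by have [t ->] := list_simplex st sz; rewrite to_listE ffunE.
have -> : f s = 0 by apply/eqP; apply: contraNT nch => /fP.
by apply/eqP; apply: contraNT nch => /to_list_supported.
Qed.

Lemma boundaryE k (c : chain P k.+1) (s : simplex P k) : boundary c s =
  \sum_(t : simplex P k.+1) \sum_(i < k.+2 | face t i == s) (-1) ^+ i * c t.
Proof. by rewrite /boundary ffunE. Qed.

Lemma of_listE k f (t : simplex P k) : of_list k f t = f (rev t).
Proof. by rewrite /of_list ffunE. Qed.

Lemma to_list_boundary k (c : chain P k.+1) s : s != [::] ->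
  to_list (boundary c) s = list_boundary (to_list c) s.
Proof.
move=> s0; rewrite /to_list list_boundary_sum.
under [RHS]eq_bigr => t _ do rewrite list_boundaryZ list_boundary_delta size_rev size_tuple.
under [LHS]eq_bigr => t _ do rewrite boundaryE mulr_suml.
rewrite exchange_big; apply: eq_bigr => t _ /=.
rewrite mulr_sumr [RHS]big_mkcond /=.
under eq_bigr do rewrite mulr_suml big_mkcond /=.
rewrite exchange_big /=; apply: eq_bigr => i _; rewrite -rev_face.
pose u := Simplex (face_sorted t i).
rewrite (bigD1 u) // big1 ?addr0 => [|v neq]; last first.
  by case: eqP => // eqv; case/eqP: neq; apply/val_inj/esym.
rewrite -[vertices_of u]/(face t i) eqxx eq_sym.
by rewrite [LHS]addr0; case: eqP => _; rewrite ?mulr0 ?mulr1 // mulrC.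
Qed.

Lemma of_list_boundary k f : supported_in [set: P] f ->
  boundary (of_list k.+1 f) = of_list k (list_boundary f).
Proof.
move=> fP; apply/ffunP => t; rewrite -to_listE to_list_boundary ?of_listE.
  by apply: eq_in_list_boundary => u; rewrite size_rev size_tuple; apply: of_listK.
by rewrite -size_eq0 size_rev size_tuple.
Qed.

End SimplexLists.

(** * Homology from a cellular complex *)

(** An additive, onto functional on cycles that vanishes exactly on boundaries
identifies the homology group with its target. *)
Lemma free_homology (disp : Order.disp_t) (P : finPOrderType disp) k r
    (phi : cycle P k -> 'rV[int]_r) :
  (forall z z', phi (z - z') = phi z - phi z') ->
  (forall v, exists z, phi z = v) ->
  (forall z, phi z = 0 <-> exists c : chain P k.+1, boundary c = z) ->
  free_abelian_of_rank (homology P k) r.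
Proof.
move=> phiB phi_surj ker_phi.
pose H := homology P k; pose f (q : H) := phi (repr q).
have phi_pi z : f (\pi_H z)%qT = phi z.
  apply/eqP; rewrite -subr_eq0 -phiB; apply/eqP/ker_phi.
  suff : repr (\pi_H z)%qT - z \in @is_boundary _ P k by move/asboolP.
  by rewrite Quotient.idealrBE reprK.
have fB : zmod_morphism f.
  move=> q q'; rewrite -[q]reprK -[q']reprK; set x := repr q; set y := repr q'.
  have -> : (\pi_H x - \pi_H y)%qT = (\pi_H (x - y))%qT by rewrite !piE.
  by rewrite !phi_pi phiB.
have [g gP] : exists g : 'rV[int]_r -> cycle P k, forall v, phi (g v) = v.
  by exists (fun v => projT1 (cid (phi_surj v))) => v; case: cid.
pose F : {additive H -> 'rV[int]_r} := HB.pack f (GRing.isZmodMorphism.Build _ _ f fB).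
exists F, (fun v => \pi_H (g v))%qT => [q|v]; last by rewrite /= phi_pi gP.
rewrite -[RHS]reprK; apply/eqP; rewrite -Quotient.idealrBE; apply/asboolP/ker_phi.
by rewrite phiB gP subrr.
Qed.

Lemma difference_of_sums (V : zmodType) (a b c x y z : V) :
  c + z = a + x - (b + y) -> a - b - c = z - (x - y).
Proof.
move=> E; apply: (addrI c); rewrite addrC subrK addrA E.
by rewrite opprD addrACA -addrA subrr addr0.
Qed.

Section CellularHomology.
Variables (disp : Order.disp_t) (P : finPOrderType disp).
Variables (inc : P -> P -> int) (aug : P -> int) (dim : P -> nat).
Implicit Types (c e : P -> int).

Local Notation bd := (cell_boundary inc).
Local Notation subdiv := (subdivision inc aug).

Hypothesis inc_lt : forall x y, inc x y != 0 -> (y < x)%O.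
Hypothesis inc_dim : forall x y, inc x y != 0 -> dim x = (dim y).+1.
Hypothesis aug_dim : forall x, aug x != 0 -> dim x = 0%N.
Hypothesis incK : forall x y, \sum_w inc x w * inc w y = 0.
Hypothesis inc_aug : forall x, \sum_y inc x y * aug y = 0.
Hypothesis local_exact : forall x c (e : int),
  (forall y, c y != 0 -> (y <= x)%O) ->
  (forall y, bd c y = 0) -> \sum_y c y * aug y = 0 ->
  exists c', [/\ forall y, c' y != 0 -> (y <= x)%O,
                 forall y, bd c' y = c y & \sum_y c' y * aug y = e].

Definition cell_chain k c := forall x, c x != 0 -> dim x = k.

Definition cell_cycle k c := cell_chain k c /\ forall y, bd c y = 0.

Definition homogeneous k c x := if dim x == k then c x else 0.

Lemma homogeneousP k c : cell_chain k (homogeneous k c).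
Proof. by move=> x; rewrite /homogeneous; case: (dim x =P k); rewrite ?eqxx. Qed.

Lemma boundary_homogeneous k c y :
  bd (homogeneous k.+1 c) y = homogeneous k (bd c) y.
Proof.
rewrite /homogeneous /cell_boundary; case: eqP => [dy|neq]; last first.
  rewrite big1 // => x _; case: eqP => dx; rewrite ?mulr0 //.
  have [->|/inc_dim] := eqVneq (inc x y) 0; first by rewrite mul0r.
  by rewrite dx => -[/esym].
apply: eq_bigr => x _; have [->|/inc_dim ->] := eqVneq (inc x y) 0.
  by rewrite !mul0r.
by rewrite dy eqxx.
Qed.

Lemma boundary_homogeneous0 c y : bd (homogeneous 0 c) y = 0.
Proof.
rewrite /cell_boundary big1 // => x _; rewrite /homogeneous; case: eqP => dx.
  have [->|/inc_dim] := eqVneq (inc x y) 0; first by rewrite mul0r.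
  by rewrite dx.
by rewrite mulr0.
Qed.

Lemma flag_weight_dim x s : flag_weight inc aug (x :: s) != 0 -> size s = dim x.
Proof.
elim: s x => [|y s IHs] x; first by move=> /aug_dim.
by rewrite /= !mulf_eq0 !negb_or => /andP[/andP[_ /inc_dim ->] /IHs <-].
Qed.

Lemma subdivision_homogeneous k c s : size s = k.+1 ->
  subdiv (homogeneous k c) s = subdiv c s.
Proof.
case: s => // x s [sz]; rewrite /subdivision /homogeneous.
case: (dim x =P k) => // neq; have [->|/flag_weight_dim dx] :=
  eqVneq (flag_weight inc aug (x :: s)) 0; first by rewrite !mulr0.
by case: neq; rewrite -dx.
Qed.

Lemma subdivision_size k c s : cell_chain k c -> subdiv c s != 0 -> size s = k.+1.
Proof.
move=> ck; case: s => [//|x s]; rewrite mulf_eq0 negb_or => /andP[/ck <-].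
by move/flag_weight_dim => /= ->.
Qed.

Lemma subdivision_in c : supported_in [set: P] (subdiv c).
Proof. by apply: (subdivision_supported inc_lt). Qed.

Definition subdivision_chain k c : chain P k := of_list k (subdiv c).

Lemma subdivision_cycle k c : cell_cycle k c -> subdivision_chain k c \in @is_cycle _ P k.
Proof.
case: k => [//|k] [_ dc]; rewrite unfold_in /= of_list_boundary; last exact: subdivision_in.
apply/eqP/ffunP => t; rewrite of_listE ffunE.
rewrite (subdivision_boundary incK inc_aug) -?size_eq0 ?size_rev ?size_tuple //.
by case: (rev t) => //= x s; rewrite dc mul0r.
Qed.

Let exactP : exact_in inc aug [set: P].
Proof. by apply: exact_in_down. Qed.

(** Exactness of the cone at [(z, 0)]: subdivision is onto in homology. *)
Lemma cycle_subdivision k (z : cycle P k) : exists c (w : chain P k.+1),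
  cell_cycle k c /\ chain_of z = boundary w + subdivision_chain k c.
Proof.
have [x|s s0|y|w [e [wP _ zE ce]]] :=
    exactP (z := to_list z) (c := fun=> 0) (@to_list_supported _ _ _ _).
- by rewrite eqxx.
- rewrite [subdivision _ _ _ _](_ : _ = 0); last by case: (s) => //= *; rewrite mul0r.
  case: k z => [|k] z.
    rewrite -[RHS](list_boundary0 s); apply: eq_in_list_boundary => u su.
    apply/eqP; apply: contraTT isT => /to_list_simplex[t eq_u]; case: s s0 su => //=.
    by rewrite eq_u size_rev size_tuple.
  rewrite -to_list_boundary //; case: z => z /=; rewrite unfold_in /= => /eqP->.
  by rewrite /to_list big1 // => t _; rewrite ffunE mul0r.
- by rewrite /cell_boundary big1 // => x _; rewrite mulr0.
exists (homogeneous k e), (of_list k.+1 w); split.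
  split; first exact: homogeneousP.
  move=> y; case: (k) => [|k']; first exact: boundary_homogeneous0.
  by rewrite boundary_homogeneous /homogeneous -ce if_same.
rewrite of_list_boundary //; apply/ffunP => t; rewrite ffunE -to_listE zE.
  by rewrite !of_listE subdivision_homogeneous // size_rev size_tuple.
by rewrite -size_eq0 size_rev size_tuple.
Qed.

(** Exactness of the cone at a chain [w] and a cellular cycle [c] whose subdivision
it bounds: subdivision is injective in homology. *)
Lemma subdivision_boundaryP k c : cell_cycle k c ->
  (exists w : chain P k.+1, boundary w = subdivision_chain k c) <->
  (exists2 e, cell_chain k.+1 e & forall y, c y = bd e y).
Proof.
case=> ck dc; split=> [[w dw]|[e ek ce]]; last first.
  exists (of_list k.+1 (subdiv e)); rewrite of_list_boundary; last exact: subdivision_in.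
  apply/ffunP => t; rewrite !of_listE (subdivision_boundary incK inc_aug).
    by case: (rev t) => //= x s; rewrite ce.
  by rewrite -size_eq0 size_rev size_tuple.
have [x|s s0|w' [e [_ _ _ ce]]] := exactP (@to_list_supported _ _ _ w) _ _ dc.
- by rewrite inE.
- rewrite -to_list_boundary // dw.
  have [sz|neq] := eqVneq (size s) k.+1; first by rewrite of_listK //; apply: subdivision_in.
  transitivity (0 : int); last first.
    by apply/eqP; rewrite eq_sym; apply: contraNT neq => /(subdivision_size ck)->.
  apply/eqP; apply: contraNT neq => /to_list_simplex[t ->].
  by rewrite size_rev size_tuple.
exists (homogeneous k.+1 e); first exact: homogeneousP.
move=> y; rewrite boundary_homogeneous /homogeneous -ce; case: eqP => // dy.
by apply/eqP; apply: contra_notT dy => /ck.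
Qed.

(** A coordinate system [phi] on cellular homology is transported to the order
complex by choosing for each cycle a cellular cycle homologous to it. *)
Theorem cellular_homology k r (phi : (P -> int) -> 'rV[int]_r) :
  (forall c e, phi (fun x => c x - e x) = phi c - phi e) ->
  (forall v, exists2 c, cell_cycle k c & phi c = v) ->
  (forall c, cell_cycle k c ->
     phi c = 0 <-> exists2 e, cell_chain k.+1 e & forall y, c y = bd e y) ->
  free_abelian_of_rank (homology P k) r.
Proof.
move=> phiB phi_surj ker_phi.
pose rep (z : cycle P k) := projT1 (cid (cycle_subdivision z)).
have repP z : exists w, cell_cycle k (rep z) /\
    chain_of z = boundary w + subdivision_chain k (rep z).
  by rewrite /rep; case: cid.
have cycleB c e : cell_cycle k c -> cell_cycle k e -> cell_cycle k (fun x => c x - e x).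
  move=> [ck dc] [ek de]; split=> [x|y]; last by rewrite cell_boundaryD cell_boundaryN dc de subrr.
  by have [->|/ck //] := eqVneq (c x) 0; rewrite sub0r oppr_eq0 => /ek.
have sdB c e : subdivision_chain k (fun x => c x - e x)
               = subdivision_chain k c - subdivision_chain k e.
  apply/ffunP => t; rewrite [RHS]ffunE [X in _ + X]ffunE !of_listE.
  by rewrite subdivisionD subdivisionN.
have phi_eq c e : cell_cycle k c -> cell_cycle k e ->
    (exists w : chain P k.+1, boundary w = subdivision_chain k c - subdivision_chain k e) -> phi c = phi e.
  move=> ck ek; rewrite -sdB => bd_w; apply/eqP; rewrite -subr_eq0 -phiB; apply/eqP.
  by apply/(ker_phi _ (cycleB _ _ ck ek))/subdivision_boundaryP => //; apply: cycleB.
apply: (@free_homology _ P k r (fun z => phi (rep z))).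
- move=> z z'; have [w [c1 e1]] := repP z; have [w' [c2 e2]] := repP z'.
  have [w'' [c3 e3]] := repP (z - z').
  rewrite -phiB; apply: phi_eq => //; first exact: cycleB.
  exists (w - w' - w''); rewrite !raddfB /= sdB.
  have : chain_of (z - z') = chain_of z - chain_of z' by [].
  rewrite e1 e2 e3; exact: difference_of_sums.
- move=> v; have [c ck <-] := phi_surj v.
  exists (Cycle (subdivision_cycle ck)); have [w [ck' /= E]] := repP (Cycle (subdivision_cycle ck)).
  apply: phi_eq => //.
  exists (- w); move: (subdivision_chain k (rep _)) E => u ->.
  by rewrite raddfN opprD addrCA subrr addr0.
- move=> z; have [w [ck E]] := repP z.
  rewrite (ker_phi _ ck) -subdivision_boundaryP //.
  split=> -[w' dw].
    by exists (w + w'); rewrite raddfD /= dw E.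
  by exists (w' - w); rewrite raddfB /= dw E addrC addKr.
Qed.

End CellularHomology.

(** * Triangular systems along a matching *)

Section TriangularMatching.
Variables (X : Type) (op : (X -> int) -> X -> int) (U L : pred X).
Variables (m s : X -> X) (eps : X -> int) (rk : X -> nat) (B : nat).
Implicit Types (u v t : X -> int) (x l : X).

Hypothesis opD : forall u v l, op (fun x => u x + v x) l = op u l + op v l.
Hypothesis mU : forall l, L l -> U (m l).
Hypothesis sL : forall x, U x -> L (s x).
Hypothesis mK : forall l, L l -> s (m l) = l.
Hypothesis sK : forall x, U x -> m (s x) = x.
Hypothesis eps2 : forall l, eps l * eps l = 1.
Hypothesis rk_bound : forall x, U x -> (rk x < B)%N.
Hypothesis triangular : forall v l, L l -> (forall x, v x != 0 -> U x) ->
  (forall x, U x -> (rk (m l) < rk x)%N -> v x = 0) -> op v l = eps l * v (m l).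

(** Back substitution, from the pairs of highest rank downwards. *)
Lemma triangular_solve t :
  exists2 u, forall x, u x != 0 -> U x & forall l, L l -> op u l = t l.
Proof.
suff /(_ B)[u uU eq_u] k : exists2 u, forall x, u x != 0 -> U x &
    forall l, L l -> (B - k <= rk (m l))%N -> op u l = t l.
  by exists u => // l Ll; apply: eq_u; rewrite // subnn.
elim: k => [|k [u uU eq_u]].
  exists (fun=> 0) => [x|l /mU/rk_bound]; first by rewrite eqxx.
  by move=> lt le; lia.
have [leBk|ltkB] := leqP B k.
  by exists u => // l Ll; rewrite (_ : (B - k.+1 = B - k)%N); [apply: eq_u | lia].
pose v x := if U x && (rk x == B - k.+1)%N then eps (s x) * (t (s x) - op u (s x)) else 0.
have vU x : v x != 0 -> U x by rewrite /v; case: ifP => [/andP[]|_]; rewrite ?eqxx.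
exists (fun x => u x + v x) => [x|l Ll le_rk].
  by have [->|/uU //] := eqVneq (u x) 0; rewrite add0r => /vU.
rewrite opD (triangular Ll vU) => [|x Ux lt_rk]; last first.
  by rewrite /v Ux; case: eqP => // eq_rk; move: lt_rk le_rk; rewrite eq_rk; lia.
rewrite /v mU //= mK //; case: eqP => [_|neq].
  by rewrite mulrA eps2 mul1r addrC subrK.
by rewrite mulr0 addr0 eq_u //; lia.
Qed.

Lemma triangular_unique v : (forall x, v x != 0 -> U x) ->
  (forall l, L l -> op v l = 0) -> forall x, v x = 0.
Proof.
move=> vU opv0; suff H k x : U x -> (B - k <= rk x)%N -> v x = 0.
  move=> x; apply/eqP; apply: contraT => nz; have Ux := vU x nz.
  by rewrite (H B) ?subnn // eqxx in nz.
elim: k x => [|k IHk] x Ux le_rk; first by have := rk_bound Ux; lia.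
have [le|gt] := leqP (B - k) (rk x); first exact: IHk.
have : op v (s x) = eps (s x) * v (m (s x)).
  apply: triangular vU _ => [|y Uy]; first exact: sL.
  by rewrite sK // => lt; apply: IHk => //; lia.
rewrite opv0 ?sL // sK // => /(congr1 (fun a => eps (s x) * a)).
by rewrite mulrA eps2 mul1r mulr0.
Qed.

End TriangularMatching.

(** * Faces of ordered block functions *)

(** The simplicial identity pairs the term [(i.+1, j)] with the term [(j, i)], for
[j <= i], and these have opposite signs. *)
Lemma alternating_double_sum k (f : nat -> nat -> int) :
  (forall i j, (j < i <= k)%N -> f i j = f j i.-1) ->
  \sum_(i < k.+1) (-1) ^+ i * (\sum_(j < k) (-1) ^+ j * f i j) = 0.
Proof.
move=> ff; pose g i j := (-1) ^+ i * ((-1) ^+ j * f i j).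
have E (i : 'I_k.+1) : true -> (-1) ^+ i * (\sum_(j < k) (-1) ^+ j * f i j)
    = \sum_(j < k | (j < i)%N) g i j + \sum_(j < k | ~~ (j < i)%N) g i j.
  by rewrite mulr_sumr (bigID (fun j : 'I_k => (j < i)%N)).
rewrite (eq_bigr _ E) {E}.
rewrite big_split /= big_ord_recl [X in X + _ + _]big1 // add0r.
rewrite [X in _ + X]big_ord_recr /= [X in _ + (_ + X)]big1 ?addr0; last first.
  by move=> j; rewrite ltn_ord.
rewrite [X in _ + X](exchange_big_dep predT) //= -big_split big1 // => i _ /=.
rewrite [X in X + _](eq_bigl (fun j : 'I_k => ~~ (i < j)%N)); last first.
  by move=> j; rewrite -leqNgt /bump.
rewrite -big_split big1 // => j; rewrite -leqNgt => leji /=.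
rewrite /g /bump ff; last by rewrite ltnS leji /=; have := ltn_ord i; lia.
by rewrite /= add1n exprS; ring.
Qed.

Section Positions.
Variable T : finType.
Implicit Types (F G : {ffun T -> nat}) (x y : T) (u : {ffun T -> nat} -> int).

Definition top F := \max_x F x.

Definition onto F := [forall v : 'I_(top F).+1, [exists x, F x == v]].

Lemma ontoP F :
  reflect (forall v, (v <= top F)%N -> exists x, F x = v) (onto F).
Proof.
apply: (iffP forallP) => [F_onto v lev|F_onto v].
  have /existsP[x /eqP eqx] := F_onto (Ordinal (lev : v < (top F).+1)%N).
  by exists x.
by have [x eq_x] := F_onto v (leq_ord v); apply/existsP; exists x; apply/eqP.
Qed.

Lemma le_top F x : (F x <= top F)%N. Proof. exact: leq_bigmax. Qed.

Lemma top_eq F k : (forall x, F x <= k)%N -> (exists x, F x = k) -> top F = k.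
Proof.
move=> leFk [x eqk]; apply/eqP; rewrite eqn_leq -{2}eqk le_top andbT.
by apply/bigmax_leqP => y _; apply: leFk.
Qed.

(** Block [i.+1] joins block [i], and the last block [k] joins block 0. *)
Definition merge k i v :=
  if (i < k)%N then (if v <= i then v else v.-1)%N else if v == k then 0%N else v.

Definition face_at i F : {ffun T -> nat} := [ffun x => merge (top F) i (F x)].

Lemma merge_onto k i v : (0 < k)%N -> (i <= k)%N -> (v < k)%N ->
  exists2 w, (w <= k)%N & merge k i w = v.
Proof.
move=> k0 lei lev; exists (if (i < v)%N then v.+1 else v); rewrite /merge;
  case: (ltnP i v) => ?; repeat case: ifP => ?; lia.
Qed.

Lemma merge_lt k i v :
  (0 < k)%N -> (i <= k)%N -> (v <= k)%N -> (merge k i v < k)%N.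
Proof. by rewrite /merge; repeat case: ifP => ?; lia. Qed.

Lemma face_top F i : onto F -> (0 < top F)%N -> (i <= top F)%N ->
  top (face_at i F) = (top F).-1 /\ onto (face_at i F).
Proof.
move=> /ontoP F_onto k0 lei.
have hit v : (v < top F)%N -> exists x, face_at i F x = v.
  case/(merge_onto k0 lei) => w /F_onto[x eqx] eqw.
  by exists x; rewrite ffunE eqx.
have topE : top (face_at i F) = (top F).-1.
  apply: top_eq => [x|]; last by apply: hit; lia.
  by rewrite ffunE; have := merge_lt k0 lei (le_top F x); lia.
by split=> //; apply/ontoP => v; rewrite topE => lev; apply: hit; lia.
Qed.

Lemma face_face F i j : onto F -> (j < i <= top F)%N ->
  face_at j (face_at i F) = face_at i.-1 (face_at j F).
Proof.
move=> F_onto /andP[ltji lei]; apply/ffunP => x; rewrite !ffunE.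
have k0 : (0 < top F)%N by lia.
have [-> _] := face_top F_onto k0 lei.
have [-> _] := face_top F_onto k0 (ltnW (leq_trans ltji lei)).
have := le_top F x; move: (F x) (top F) lei => v k lei lev; rewrite /merge.
by case: (ltnP i k) => ?; case: (ltnP j k) => ?; case: (leqP v i) => ?;
  case: (leqP v j) => ?; case: (v =P k) => ?; repeat case: ifP => ?; lia.
Qed.

(** As the faces merge blocks, this is the coboundary of the simplicial torus, and
the boundary of the dual cells, which are refined by splitting blocks. *)
Definition coboundary u F := \sum_(i < (top F).+1) (-1) ^+ i * u (face_at i F).

Lemma coboundaryK u F : onto F -> (0 < top F)%N -> coboundary (coboundary u) F = 0.
Proof.
move=> F_onto k0; pose f i j := u (face_at j (face_at i F)).
rewrite -[RHS](alternating_double_sum (k := top F) (f := f)) => [|i j lt]; last first.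
  by rewrite /f face_face.
apply: eq_bigr => i _; congr (_ * _); rewrite /coboundary.
have [-> _] := face_top F_onto k0 (leq_ord i).
by rewrite prednK.
Qed.

Lemma coboundaryD u v F :
  coboundary (fun G => u G + v G) F = coboundary u F + coboundary v F.
Proof. by rewrite -big_split; apply: eq_bigr => i _; rewrite mulrDr. Qed.

End Positions.

(** * Splitting off and joining a point *)

Section SplitOff.
Variable T : finType.
Implicit Types (F G : {ffun T -> nat}) (a b x y : T).

Definition alone F a := [forall b, (F b == F a) ==> (b == a)].

Lemma aloneP F a : reflect (forall b, F b = F a -> b = a) (alone F a).
Proof.
apply: (iffP forallP) => [al b /eqP eqF|al b].
  by apply/eqP; move/implyP: (al b); apply.
by apply/implyP => /eqP/al->.
Qed.

(** The point [a] becomes a block of its own, just after the rest of its block;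
[join_left] undoes this. *)
Definition split_off a F : {ffun T -> nat} :=
  [ffun x => if x == a then (F x).+1 else if (F x <= F a)%N then F x else (F x).+1].

Definition join_left a F := face_at (F a).-1 F.

Lemma merge_innerE k i v : (i < k)%N -> merge k i v = if (v <= i)%N then v else v.-1.
Proof. by rewrite /merge => ->. Qed.

Lemma merge_inner_eq0 k i v : (0 < i < k)%N -> (merge k i v == 0%N) = (v == 0%N).
Proof. by rewrite /merge; repeat case: ifP => ?; lia. Qed.

Lemma face_atE F i x : face_at i F x = merge (top F) i (F x).
Proof. by rewrite ffunE. Qed.

Lemma split_off_monotone a F s t :
  (split_off a F s <= split_off a F t)%N -> (F s <= F t)%N.
Proof.
rewrite !ffunE; have [->|_] := eqVneq s a; have [->|_] := eqVneq t a => //.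
- by case: (leqP (F t) (F a)) => _; [apply: ltnW | rewrite ltnS].
- by case: (leqP (F s) (F a)) => // lt; rewrite ltnS leqNgt lt.
- case: (leqP (F s) (F a)) => le1; case: (leqP (F t) (F a)) => le2 //.
  + by move=> _; rewrite (leq_trans le1) // ltnW.
  + exact: ltnW.
Qed.

Section Split.
Variables (a : T) (F : {ffun T -> nat}).
Hypotheses (F_onto : onto F) (nal : ~~ alone F a).
Let G := split_off a F.

Lemma split_offE x : x != a -> G x = if (F x <= F a)%N then F x else (F x).+1.
Proof. by move=> /negPf ne; rewrite ffunE ne. Qed.

Lemma split_off_at : G a = (F a).+1.
Proof. by rewrite ffunE eqxx. Qed.

Lemma split_off_alone : alone G a.
Proof.
apply/aloneP => x; rewrite split_off_at.
case: (eqVneq x a) => [//|/split_offE ->]; case: ltnP => [lt [E]|le E].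
  by rewrite E ltnn in lt.
by rewrite E ltnn in le.
Qed.

Lemma split_off_onto : top G = (top F).+1 /\ onto G.
Proof.
have [c Fc ne_ca] : exists2 c, F c = F a & c != a.
  move: nal; rewrite negb_forall => /existsP[c]; rewrite negb_imply.
  by case/andP=> /eqP Fc ne; exists c.
have hit v : (v <= (top F).+1)%N -> exists x, G x = v.
  move=> lev; case: (ltngtP v (F a)) => [lt|gt|->]; last first.
  - by exists c; rewrite split_offE // Fc leqnn.
  - have [eqv|ne] := eqVneq v (F a).+1; first by exists a; rewrite split_off_at.
    have [x Fx] : exists x, F x = v.-1 by apply: (ontoP _ F_onto); lia.
    have lt : (F a < F x)%N by rewrite Fx; lia.
    exists x; rewrite split_offE; first by rewrite leqNgt lt /= Fx; lia.
    by apply: contraTneq lt => ->; rewrite ltnn.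
  have [x Fx] := ontoP _ F_onto v (ltnW (leq_trans lt (le_top F a))).
  exists x; rewrite split_offE ?Fx ?(ltnW lt) //.
  by apply: contraTneq lt => eqx; rewrite -Fx eqx ltnn.
have topG : top G = (top F).+1.
  apply: top_eq => [x|]; last exact: hit.
  case: (eqVneq x a) => [->|/split_offE ->]; first by rewrite split_off_at ltnS le_top.
  by case: ifP => _; rewrite ?ltnS ?le_top // leqW // le_top.
by split=> //; apply/ontoP => v; rewrite topG; apply: hit.
Qed.

Lemma split_offK : join_left a G = F.
Proof.
rewrite /join_left split_off_at /=.
apply/ffunP => x; rewrite face_atE split_off_onto.1 merge_innerE ?ltnS ?le_top //.
case: (eqVneq x a) => [->|/split_offE ->]; first by rewrite split_off_at ltnn.
by case: (leqP (F x) (F a)) => [->//|gt]; rewrite ltnNge (ltnW gt).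
Qed.

End Split.

Section Join.
Variables (a : T) (F : {ffun T -> nat}).
Hypotheses (F_onto : onto F) (al : alone F a) (Fa : (0 < F a)%N).
Let G := join_left a F.

Let lt_top : ((F a).-1 < top F)%N.
Proof. by rewrite prednK // le_top. Qed.

Lemma join_leftE x : G x = if (F x <= (F a).-1)%N then F x else (F x).-1.
Proof. by rewrite face_atE merge_innerE. Qed.

Lemma join_left_onto : top G = (top F).-1 /\ onto G.
Proof. by apply: face_top => //; [apply: leq_ltn_trans lt_top | apply: ltnW]. Qed.

Lemma join_left_at : G a = (F a).-1.
Proof. by rewrite join_leftE leqNgt prednK // leqnn. Qed.

Lemma join_left_not_alone : ~~ alone G a.
Proof.
have [c Fc] := ontoP _ F_onto _ (ltnW lt_top).
apply/aloneP => /(_ c); rewrite join_left_at join_leftE Fc leqnn => /(_ erefl) eqc.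
by move: Fc Fa; rewrite eqc; move: (F a) => v; lia.
Qed.

Lemma join_leftK : split_off a G = F.
Proof.
apply/ffunP => x; rewrite ffunE join_left_at join_leftE.
have [->|ne] := eqVneq x a; first by rewrite leqNgt prednK // leqnn prednK.
have neF : F x <> F a by move/aloneP: al => /(_ x) H /H eqx; rewrite eqx eqxx in ne.
have [le|gt] := leqP (F x) (F a).-1; first by rewrite le.
have gt' : (F a < F x)%N by move: neF gt Fa; move: (F x) (F a) => v w; lia.
rewrite leqNgt (_ : (F a).-1 < (F x).-1)%N /=; first by rewrite prednK // (leq_trans _ gt').
by move: gt' Fa; move: (F x) (F a) => v w; lia.
Qed.

End Join.
End SplitOff.

(** * A matching of the cells of the torus *)

Section Pivots.
Variable n : nat.
Local Notation T := 'I_n.+1.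
Implicit Types (F G : {ffun T -> nat}) (a b x y : T).

Let le_top F x : (F x <= top F)%N. Proof. exact: le_top. Qed.

Let face_atE F i x : face_at i F x = merge (top F) i (F x).
Proof. exact: face_atE. Qed.

Let ontoP F : onto F -> forall v, (v <= top F)%N -> exists x, F x = v.
Proof. by move/ontoP. Qed.

Definition normal F := onto F && (F ord0 == 0%N).

Definition rank_before F m := #|[set b : T | (b < m)%N & F b != 0%N]|.

(** What an increasing arrangement of singletons requires of the point [a]: to be in
the base block, or alone just after the smaller points outside of it. *)
Definition in_order F a :=
  (F a == 0%N) || (F a == (rank_before F a).+1) && alone F a.

Definition is_pivot F a :=
  ~~ in_order F a && [forall b : T, (b < a)%N ==> in_order F b].

Lemma pivotP F a : reflect (~~ in_order F a /\ forall b, (b < a)%N -> in_order F b)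
  (is_pivot F a).
Proof.
apply: (iffP andP) => [[na /forallP ord]|[na ord]]; split=> //.
  by move=> b lt; apply: (implyP (ord b)).
by apply/forallP => b; apply/implyP/ord.
Qed.

Lemma pivot_uniq F a b : is_pivot F a -> is_pivot F b -> a = b.
Proof.
move=> /pivotP[na ora] /pivotP[nb orb]; apply/val_inj.
by case: (ltngtP a b) => [/orb|/ora|//]; [rewrite (negPf na) | rewrite (negPf nb)].
Qed.

Lemma pivot_exists F b : ~~ in_order F b -> exists2 a, is_pivot F a & (a <= b)%N.
Proof.
move=> nb; pose P := [pred c : T | ~~ in_order F c].
case: (@arg_minnP _ b P val nb) => a na mina; exists a; last exact: mina.
apply/pivotP; split=> // c lt; apply: contraTT lt => nc; rewrite -leqNgt.
exact: mina.
Qed.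

Definition pivot F := odflt ord0 [pick a | is_pivot F a].

Lemma pivotE F a : is_pivot F a -> pivot F = a.
Proof.
by move=> pa; rewrite /pivot; case: pickP => [b /(pivot_uniq pa)|/(_ a)/[!pa]].
Qed.

Lemma rank_beforeS F (a : T) : rank_before F a.+1 = (rank_before F a + (F a != 0%N))%N.
Proof.
rewrite /rank_before (cardsD1 a) addnC !inE ltnS leqnn /=; congr (#|pred_of_set _| + _)%N.
by apply/setP => b; rewrite !inE ltnS (ltn_neqAle b) -(inj_eq val_inj) andbA.
Qed.

Lemma rank_before_leq F m p : (m <= p)%N -> (rank_before F m <= rank_before F p)%N.
Proof.
move=> le; apply/subset_leq_card/subsetP => c; rewrite !inE => /andP[lt ->].
by rewrite (leq_trans lt le).
Qed.

Lemma in_orderE F a : in_order F a -> F a != 0%N ->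
  F a = (rank_before F a).+1 /\ forall b, F b = F a -> b = a.
Proof. by move=> /orP[/eqP->//|/andP[/eqP eqF /aloneP al]] _. Qed.

Lemma prefix_le F m b : (forall b : T, (b < m)%N -> in_order F b) ->
  (b < m)%N -> (F b <= rank_before F m)%N.
Proof.
move=> ord lt; have [->//|nz] := eqVneq (F b) 0%N.
have [-> _] := in_orderE (ord b lt) nz.
by apply: leq_trans (rank_before_leq F lt); rewrite rank_beforeS nz addn1.
Qed.

(** Points in order occupy the blocks 1, 2, ... one after the other, without gaps. *)
Lemma prefix_hit F m v : (forall b : T, (b < m)%N -> in_order F b) ->
  (m <= n.+1)%N -> (0 < v <= rank_before F m)%N -> exists2 b : T, (b < m)%N & F b = v.
Proof.
elim: m => [|m IHm] ord lem.
  rewrite (_ : rank_before F 0 = 0)%N; first by case: v.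
  by apply/eqP; rewrite cards_eq0; apply/eqP/setP => c; rewrite !inE ltn0.
rewrite (rank_beforeS F (Ordinal lem)) => /andP[v0].
have [lev _|ltv] := leqP v (rank_before F m).
  have [|||b lt <-] := IHm.
  - by move=> b lt; apply/ord/ltnW.
  - exact: ltnW.
  - by rewrite v0.
  by exists b => //; apply: ltnW.
have [z|nz le] := eqVneq (F (Ordinal lem)) 0%N; first by rewrite addn0 leqNgt ltv.
exists (Ordinal lem) => //; have [|-> _] := in_orderE _ nz; first exact: ord.
by apply/eqP; rewrite eqn_leq ltv -[X in (_ <= X)%N]addn1.
Qed.

Lemma prefix_gt F m (c : T) : (forall b : T, (b < m)%N -> in_order F b) ->
  (m <= c)%N -> F c != 0%N -> (rank_before F m < F c)%N.
Proof.
move=> ord le nz; rewrite ltnNge; apply/negP => leF.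
have [||b lt eqF] := prefix_hit (v := F c) ord.
- exact: leq_trans le (ltnW (ltn_ord c)).
- by rewrite lt0n nz.
have [|_ al] := in_orderE (ord b lt); first by rewrite eqF.
by rewrite (al c) ?eqF // leqNgt lt in le.
Qed.

Definition lower F := normal F && [exists a, is_pivot F a && alone F a].

Definition upper F := normal F && [exists a, is_pivot F a && ~~ alone F a].

Lemma lowerP F : reflect (exists a, [/\ normal F, is_pivot F a & alone F a]) (lower F).
Proof.
apply: (iffP andP) => [[nF /existsP[a /andP[pa al]]]|[a [nF pa al]]]; first by exists a.
by split=> //; apply/existsP; exists a; rewrite pa.
Qed.

Lemma upperP F :
  reflect (exists a, [/\ normal F, is_pivot F a & ~~ alone F a]) (upper F).
Proof.
apply: (iffP andP) => [[nF /existsP[a /andP[pa al]]]|[a [nF pa al]]]; first by exists a.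
by split=> //; apply/existsP; exists a; rewrite pa.
Qed.

Lemma lower_upper_or_ordered F :
  normal F -> [\/ lower F, upper F | forall a, in_order F a].
Proof.
move=> nF; have [/forallP ord|/forallPn[b /pivot_exists[a pa _]]] :=
  boolP [forall a, in_order F a]; first by constructor 3.
have [al|nal] := boolP (alone F a); first by constructor 1; apply/lowerP; exists a.
by constructor 2; apply/upperP; exists a.
Qed.

Lemma pivot_gt F a : is_pivot F a -> (rank_before F a < F a)%N.
Proof.
case/pivotP=> na ord; apply: prefix_gt => //.
by apply: contraNneq na => z; rewrite /in_order z.
Qed.

Lemma pivot_alone_gt F a : is_pivot F a -> alone F a -> ((rank_before F a).+1 < F a)%N.
Proof.
move=> pa al; rewrite ltn_neqAle pivot_gt // andbT eq_sym.
by have [na _] := pivotP _ _ pa; apply: contra na => eqF; rewrite /in_order eqF al orbT.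
Qed.

Definition join_pivot F := join_left (pivot F) F.

Definition split_pivot F := split_off (pivot F) F.

Lemma rank_before_support F G m : (forall x, (G x == 0%N) = (F x == 0%N)) ->
  rank_before G m = rank_before F m.
Proof. by move=> E; apply: eq_card => x; rewrite !inE E. Qed.

(** Merging blocks beyond the ordered prefix does not disturb it. *)
Lemma face_prefix F a i : (forall b : T, (b < a)%N -> in_order F b) ->
  (rank_before F a < i < top F)%N ->
  forall b : T, (b < a)%N -> in_order (face_at i F) b.
Proof.
move=> ord /andP[lti ltk] b lt; have leb := prefix_le ord lt.
have i0 : (0 < i < top F)%N by rewrite ltk (leq_ltn_trans _ lti).
have supp x : (face_at i F x == 0%N) = (F x == 0%N) by rewrite face_atE merge_inner_eq0.
rewrite /in_order (rank_before_support _ supp) supp.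
have [//|nz /=] := eqVneq (F b) 0%N; have [eqF al] := in_orderE (ord b lt) nz.
have Gb : face_at i F b = F b.
  by rewrite face_atE merge_innerE // (leq_trans leb) // ltnW.
rewrite Gb eqF eqxx /=; apply/aloneP => c; rewrite Gb => eqG; apply: al.
move: eqG; rewrite face_atE merge_innerE //; case: (leqP (F c) i) => // ltc E.
by move: leb lti; rewrite -E; move: ltc; clear; case: (F c) => //= v; lia.
Qed.

Lemma normal_face F i : normal F -> (0 < top F)%N -> (i <= top F)%N ->
  normal (face_at i F).
Proof.
case/andP=> F_onto /eqP F0 k0 lei; rewrite /normal (face_top F_onto k0 lei).2.
by rewrite face_atE F0 /merge; repeat case: ifP => ?; lia.
Qed.

Lemma join_pivot_upper F : lower F ->
  [/\ upper (join_pivot F), top (join_pivot F) = (top F).-1,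
   pivot (join_pivot F) = pivot F, join_pivot F (pivot F) = (F (pivot F)).-1 &
   split_pivot (join_pivot F) = F].
Proof.
case/lowerP=> a [nF pa al]; rewrite /split_pivot /join_pivot (pivotE pa).
have [na ord] := pivotP _ _ pa; have gt := pivot_alone_gt pa al.
have leF := le_top F a; have [F_onto _] := andP nF.
have Fa : (0 < F a)%N by apply: leq_ltn_trans gt.
set G := join_left a F; have [topG G_onto] : top G = (top F).-1 /\ onto G.
  exact: join_left_onto.
have inner : (0 < (F a).-1 < top F)%N by lia.
have nG : normal G.
  by case/andP: inner => lt0 lt1; apply: normal_face; rewrite ?(ltn_trans lt0) // ltnW.
have supp x : (G x == 0%N) = (F x == 0%N).
  by rewrite /G /join_left face_atE merge_inner_eq0.
have nal : ~~ alone G a by apply: join_left_not_alone.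
have pG : is_pivot G a.
  apply/pivotP; split; last by apply: face_prefix => //; rewrite ltn_predRL gt; case/andP: inner.
  by rewrite /in_order negb_or supp negb_and nal orbT andbT -lt0n.
rewrite (pivotE pG); split=> //; first by apply/upperP; exists a.
  exact: join_left_at.
exact: join_leftK.
Qed.

Lemma split_pivot_lower F : upper F ->
  [/\ lower (split_pivot F), top (split_pivot F) = (top F).+1 &
   join_pivot (split_pivot F) = F].
Proof.
case/upperP=> a [nF pa nal]; rewrite /join_pivot /split_pivot (pivotE pa).
have [na ord] := pivotP _ _ pa; have gt := pivot_gt pa.
have [F_onto /eqP F0] := andP nF; set G := split_off a F.
have Ga : G a = (F a).+1 by apply: split_off_at.
have GE x : x != a -> G x = if (F x <= F a)%N then F x else (F x).+1.
  exact: split_offE.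
have [topG G_onto] : top G = (top F).+1 /\ onto G by apply: split_off_onto.
have supp x : (G x == 0%N) = (F x == 0%N).
  have [->|/GE ->] := eqVneq x a; first by rewrite Ga [RHS]gtn_eqF // (leq_ltn_trans (leq0n _) gt).
  by case: leqP => // lt; rewrite [RHS]gtn_eqF // (leq_ltn_trans (leq0n _) lt).
have nG : normal G by rewrite /normal G_onto supp F0.
have alG : alone G a by apply: split_off_alone.
have pG : is_pivot G a.
  apply/pivotP; split.
    rewrite /in_order supp Ga (rank_before_support _ supp) eqSS negb_or negb_and.
    by rewrite -lt0n (leq_ltn_trans (leq0n _) gt) /= gtn_eqF.
  move=> b lt; have leb := prefix_le ord lt; rewrite /in_order supp.
  rewrite (rank_before_support _ supp).
  have [//|nz /=] := eqVneq (F b) 0%N; have [eqF al] := in_orderE (ord b lt) nz.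
  have ltb : (F b < F a)%N by apply: leq_ltn_trans leb gt.
  have Gb : G b = F b.
    by rewrite GE ?(ltnW ltb) //; apply: contraTneq lt => ->; rewrite ltnn.
  rewrite Gb eqF eqxx; apply/aloneP => x; rewrite Gb.
  case: (eqVneq x a) => [-> E|/GE ->].
    by move: ltb; rewrite -E Ga ltnNge leqnSn.
  case: leqP => [_|gt' E]; first exact: al.
  by move: ltb; rewrite -E ltnNge ltnW // ltnW.
rewrite (pivotE pG); split=> //; first by apply/lowerP; exists a.
exact: split_offK.
Qed.

End Pivots.

Lemma onto_top_lt (T : finType) (F : {ffun T -> nat}) : onto F -> (top F < #|T|)%N.
Proof.
move=> F_onto.
have E (v : 'I_(top F).+1) : exists x, F x == v by move/forallP/(_ v)/existsP: F_onto.
pose g v := xchoose (E v).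
have gK v : F (g v) = v by apply/eqP/(xchooseP (E v)).
rewrite -[X in (X <= _)%N](card_ord (top F).+1); apply: (@leq_card _ _ g) => v w eqg.
by apply: val_inj; rewrite /= -!gK eqg.
Qed.

Lemma lex_lt K a b a' b' :
  (b < K)%N -> (a < a')%N -> (a * K + b < a' * K + b')%N.
Proof.
move=> ltb lta; apply: (@leq_trans (a'* K)); last exact: leq_addr.
by rewrite (leq_trans _ (leq_mul lta (leqnn K))) // mulSn addnC ltn_add2r.
Qed.

Lemma merge_inj_away i v w : i != w -> i != w.-1 ->
  (if (v <= i)%N then v else v.-1) = (if (w <= i)%N then w else w.-1) -> v = w.
Proof. by case: (leqP v i) => ?; case: (leqP w i) => ?; lia. Qed.

Section PivotRank.
Variable n : nat.
Local Notation T := 'I_n.+1.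
Implicit Types (F G : {ffun T -> nat}) (a b x y : T).

Definition base_size F := #|[set x | F x == 0%N]|.

(** The lexicographic rank of the size of the base block, the pivot (counted
downwards) and the position of the pivot; the two lower digits are at most [n]. *)
Definition pivot_rank F :=
  ((base_size F * n.+1 + (n - pivot F)) * n.+1 + F (pivot F))%N.

Let le_top F x : (F x <= top F)%N. Proof. exact: le_top. Qed.

Let face_atE F i x : face_at i F x = merge (top F) i (F x).
Proof. by rewrite ffunE. Qed.

Lemma normal_top_le F : normal F -> (top F <= n)%N.
Proof. by case/andP=> /onto_top_lt; rewrite card_ord ltnS. Qed.

Lemma pivot_rank_bound F : normal F -> (pivot_rank F < n.+2 * n.+1 * n.+1)%N.
Proof.
move=> nF; rewrite -[X in (_ < X)%N]addn0; apply: lex_lt.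
  by rewrite ltnS (leq_trans (le_top F _)) // normal_top_le.
rewrite -[X in (_ < X)%N]addn0; apply: lex_lt; first by rewrite ltnS leq_subr.
by rewrite ltnS (leq_trans (max_card _)) // card_ord.
Qed.

(** An outer face enlarges the base block.  A face inside the ordered prefix spoils
the order of a point before the pivot.  Of the faces beyond the prefix only the
two that merge the pivot with a neighbour leave a pivot that is not alone, and
the one other than [join_pivot] keeps the pivot one position further on. *)
Lemma upper_face F i : lower F -> (i <= top F)%N -> i != (F (pivot F)).-1 ->
  upper (face_at i F) -> (pivot_rank (join_pivot F) < pivot_rank (face_at i F))%N.
Proof.
move=> lF lei nei /upperP[a' [nG pG nal]].
have [_ _ pjoin jpiv _] := join_pivot_upper lF.
have /lowerP[a [nF pF alF]] := lF; rewrite (pivotE pF) in pjoin jpiv nei *.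
have [na ord] := pivotP _ _ pF; have gt := pivot_alone_gt pF alF.
have leF := le_top F a; have [F_onto /eqP F0] := andP nF.
set G := face_at i F in nG pG nal *; set J := join_pivot F in pjoin jpiv *.
have Gle x : (G x <= n)%N by rewrite (leq_trans (le_top G x)) // normal_top_le.
have JE : J = face_at (F a).-1 F by rewrite /J /join_pivot (pivotE pF).
have Jle x : (J x <= n)%N.
  by rewrite JE (leq_trans (le_top _ x)) // normal_top_le // normal_face //; lia.
have suppJ x : (J x == 0%N) = (F x == 0%N).
  by rewrite JE face_atE merge_inner_eq0 //; lia.
have baseJ : base_size J = base_size F.
  by apply: eq_card => x; rewrite !inE suppJ.
have [inner|outer] := boolP (0 < i < top F)%N; last first.
  (* an outer face moves a whole block into the base block *)
  apply: lex_lt; rewrite ?ltnS ?Jle //; apply: lex_lt; first by rewrite ltnS leq_subr.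
  rewrite baseJ; apply: proper_card; apply/properP; split.
    apply/subsetP => x; rewrite !inE => /eqP Fx; rewrite face_atE Fx.
    by rewrite /merge; repeat case: ifP.
  have [x Fx] : exists x, F x = (if i == 0 then 1 else top F)%N.
    by apply: (ontoP _ F_onto); case: ifP => _; lia.
  exists x; rewrite !inE ?face_atE Fx; last by case: ifP => _; apply/eqP; lia.
  rewrite /merge; have [->|nei0] := eqVneq i 0%N.
    by rewrite (_ : 0 < top F)%N //; lia.
  by rewrite (_ : (i < top F) = false)%N ?eqxx //; lia.
have [lt0i ltik] := andP inner.
have suppG x : (G x == 0%N) = (F x == 0%N) by rewrite face_atE merge_inner_eq0.
have baseG : base_size G = base_size F by apply: eq_card => x; rewrite !inE suppG.
have GE x : G x = if (F x <= i)%N then F x else (F x).-1.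
  by rewrite face_atE merge_innerE.
have [leh|gth] := leqP i (rank_before F a).
  (* merging inside the ordered prefix makes the pivot smaller *)
  have [||b lt Fb] := prefix_hit (v := i) ord; first exact: ltnW.
    by rewrite lt0i.
  have Gb : G b = i by rewrite GE Fb leqnn.
  have [c Fc] : exists c, F c = i.+1 by apply: (ontoP _ F_onto).
  have Gc : G c = i by rewrite GE Fc ltnn.
  have nb : ~~ in_order G b.
    rewrite /in_order negb_or Gb -lt0n lt0i negb_and; apply/orP; right.
    apply/aloneP => /(_ c); rewrite Gb Gc => /(_ erefl) eqc.
    by move: Fc; rewrite eqc Fb => /eqP; rewrite ltn_eqF.
  have [a'' pa'' lea''] := pivot_exists nb.
  have lt_pivot : (pivot G < a)%N by rewrite (pivotE pa'') (leq_ltn_trans lea'').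
  rewrite /pivot_rank pjoin baseJ baseG; apply: lex_lt; first by rewrite ltnS Jle.
  by rewrite ltn_add2l ltn_sub2l // (leq_trans lt_pivot) // -ltnS.
have preG := face_prefix ord (introT andP (conj gth ltik)).
have Ga : ((rank_before F a).+1 < G a)%N.
  rewrite GE; case: (leqP (F a) i) => // lt_iF; rewrite ltn_predRL.
  have : (i.+1 < F a)%N; last by apply: leq_ltn_trans.
  by rewrite ltn_neqAle lt_iF andbT; apply: contra nei => /eqP <-.
have pGa : is_pivot G a.
  apply/pivotP; split=> //; rewrite /in_order (rank_before_support _ suppG).
  by rewrite negb_or negb_and -lt0n (leq_ltn_trans _ Ga) //= gtn_eqF.
rewrite (pivot_uniq pG pGa) in nal.
have [eqi|neqi] := eqVneq i (F a).
  rewrite /pivot_rank pjoin baseJ baseG (pivotE pGa) ltn_add2l jpiv GE eqi leqnn.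
  by rewrite prednK // (leq_ltn_trans _ gt).
case/negP: nal; apply/aloneP => x eqG; apply: (aloneP _ _ alF); move: eqG.
by rewrite !GE; apply: merge_inj_away.
Qed.

End PivotRank.

(** * Cocycles of the torus *)

Section TorusCohomology.
Variable n : nat.
Local Notation T := 'I_n.+1.
Implicit Types (F G : {ffun T -> nat}) (a b x y : T) (S : {set T}).
Implicit Types (c u v : {ffun T -> nat} -> int).

Let le_top F x : (F x <= top F)%N. Proof. exact: le_top. Qed.

Definition cochain j c := forall F, c F != 0 -> normal F /\ top F = j.

Lemma coboundary_upper j v F : (forall G, v G != 0 -> upper G && (top G == j)) ->
  lower F -> top F = j.+1 ->
  (forall G, upper G && (top G == j) ->
     (pivot_rank (join_pivot F) < pivot_rank G)%N -> v G = 0) ->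
  coboundary v F = (-1) ^+ (F (pivot F)).-1 * v (join_pivot F).
Proof.
move=> vU lF topF vrk; have lt : ((F (pivot F)).-1 < (top F).+1)%N.
  by rewrite ltnS (leq_trans (leq_pred _)) // le_top.
rewrite /coboundary (bigD1 (Ordinal lt)) //= big1 ?addr0 // => i nei.
rewrite [v _](_ : _ = 0) ?mulr0 //; apply/eqP; apply: contraT => nz.
have uG := vU _ nz; rewrite vrk ?eqxx // in nz *; apply: upper_face => //.
- by rewrite -ltnS.
- by case/andP: uG.
Qed.

Section Degree.
Variable j : nat.

Definition upper_in F := upper F && (top F == j).
Definition lower_in F := lower F && (top F == j.+1).

Let joinU F : lower_in F -> upper_in (join_pivot F).
Proof.
by case/andP=> /join_pivot_upper[uJ topJ _ _ _] /eqP topF; rewrite /upper_in uJ topJ topF /=.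
Qed.

Let splitL G : upper_in G -> lower_in (split_pivot G).
Proof.
by case/andP=> /split_pivot_lower[lS topS _] /eqP topG; rewrite /lower_in lS topS topG /=.
Qed.

Let joinK F : lower_in F -> split_pivot (join_pivot F) = F.
Proof. by case/andP=> /join_pivot_upper[]. Qed.

Let splitK G : upper_in G -> join_pivot (split_pivot G) = G.
Proof. by case/andP=> /split_pivot_lower[]. Qed.

Let sign2 F : (-1) ^+ (F (pivot F)).-1 * (-1) ^+ (F (pivot F)).-1 = 1 :> int.
Proof. by rewrite -expr2 sqrr_sign. Qed.

Let rank_bound G : upper_in G -> (pivot_rank G < n.+2 * n.+1 * n.+1)%N.
Proof. by case/andP=> /upperP[a [nG _ _]] _; apply: pivot_rank_bound. Qed.

Let triangular v F : lower_in F -> (forall G, v G != 0 -> upper_in G) ->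
  (forall G, upper_in G -> (pivot_rank (join_pivot F) < pivot_rank G)%N -> v G = 0) ->
  coboundary v F = (-1) ^+ (F (pivot F)).-1 * v (join_pivot F).
Proof. by case/andP=> lF /eqP topF vU; apply: coboundary_upper. Qed.

Lemma solve_lower t : exists2 u, forall G, u G != 0 -> upper_in G &
  forall F, lower_in F -> coboundary u F = t F.
Proof. exact: triangular_solve (@coboundaryD T) joinU joinK sign2 rank_bound triangular t. Qed.

Lemma upper_cocycle v : (forall G, v G != 0 -> upper_in G) ->
  (forall F, lower_in F -> coboundary v F = 0) -> forall F, v F = 0.
Proof. exact: triangular_unique splitL splitK sign2 rank_bound triangular v. Qed.

End Degree.

(** A cocycle that vanishes off the upper cells is an upper cochain whose coboundary
vanishes on the lower cells, so triangularity applies. *)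
Lemma cocycle_eq0 j c : cochain j c ->
  (forall F, normal F -> top F = j.+1 -> coboundary c F = 0) ->
  (forall F, lower F -> c F = 0) ->
  (forall F, normal F -> top F = j -> (forall a, in_order F a) -> c F = 0) ->
  forall F, c F = 0.
Proof.
move=> cj dc cl co; apply: (@upper_cocycle j) => [G nz|F /andP[lF /eqP topF]].
  have [nG topG] := cj G nz; rewrite /upper_in topG eqxx andbT.
  have [lG|//|oG] := lower_upper_or_ordered nG; first by rewrite cl ?eqxx in nz.
  by rewrite co ?eqxx in nz.
by apply: dc => //; case/lowerP: lF => a [].
Qed.

Section Arrangements.
Variables (S : {set T}) (j : nat).
Hypotheses (S0 : ord0 \notin S) (cardS : #|S| = j.+1).

Definition rank_in x := #|[set b in S | (b < x)%N]|.

(** The points of [S] as singleton blocks, in the order given by the permutation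
[s]; all other points are in the base block. *)
Definition arrangement (s : 'S_j.+1) : {ffun T -> nat} :=
  [ffun x => if x \in S then (s (inord (rank_in x))).+1 else 0%N].

Lemma rank_in_lt x : x \in S -> (rank_in x < j.+1)%N.
Proof.
move=> Sx; rewrite -cardS; apply: proper_card; apply/properP; split.
  by apply/subsetP => b; rewrite inE => /andP[].
by exists x; rewrite // inE Sx ltnn.
Qed.

Lemma rank_in_mono x y : x \in S -> (x < y)%N -> (rank_in x < rank_in y)%N.
Proof.
move=> Sx lt; apply: proper_card; apply/properP; split.
  by apply/subsetP => b; rewrite !inE => /andP[-> lb]; rewrite (ltn_trans lb).
by exists x; rewrite inE Sx ?ltnn // lt.
Qed.

Lemma rank_in_inj : {in S &, injective rank_in}.
Proof.
move=> x y Sx Sy eqr; apply/val_inj; case: (ltngtP x y) => [lt|lt|//].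
  by have := rank_in_mono Sx lt; rewrite eqr ltnn.
by have := rank_in_mono Sy lt; rewrite eqr ltnn.
Qed.

Lemma rank_in_hit (i : 'I_j.+1) : exists2 x, x \in S & inord (rank_in x) = i.
Proof.
suff : [set inord (rank_in x) | x in S] = [set: 'I_j.+1].
  by move/setP/(_ i); rewrite inE => /imsetP[x Sx eqi]; exists x.
apply/eqP; rewrite eqEcard subsetT cardsT card_ord card_in_imset ?cardS //=.
move=> x y Sx Sy /(congr1 val) /=; rewrite !inordK ?rank_in_lt //.
exact: rank_in_inj.
Qed.

Lemma arrangementE s x : x \in S -> arrangement s x = (s (inord (rank_in x))).+1.
Proof. by rewrite ffunE => ->. Qed.

Lemma arrangement_eq0 s x : (arrangement s x == 0%N) = (x \notin S).
Proof. by rewrite ffunE; case: ifP. Qed.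

Lemma arrangement_onto s : top (arrangement s) = j.+1 /\ onto (arrangement s).
Proof.
have hit (v : nat) : (v <= j.+1)%N -> exists x, arrangement s x = v.
  case: v => [_|v lev]; first by exists ord0; apply/eqP; rewrite arrangement_eq0.
  have [x Sx eqx] := rank_in_hit ((s^-1)%g (Ordinal lev)).
  by exists x; rewrite arrangementE // eqx permKV.
have topA : top (arrangement s) = j.+1.
  apply: top_eq => [x|]; last exact: hit.
  by rewrite ffunE; case: ifP.
by split=> //; apply/ontoP => v; rewrite topA; apply: hit.
Qed.

Lemma arrangement_normal s : normal (arrangement s).
Proof. by rewrite /normal (arrangement_onto s).2 arrangement_eq0. Qed.

Lemma arrangement_alone s x : x \in S -> alone (arrangement s) x.
Proof.
move=> Sx; apply/aloneP => y; rewrite (arrangementE _ Sx) ffunE.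
case: ifP => // Sy [] /val_inj/perm_inj/(congr1 val) /=.
by rewrite !inordK ?rank_in_lt //; apply: rank_in_inj.
Qed.

Lemma rank_before_arrangement s m :
  rank_before (arrangement s) m = #|[set b in S | (b < m)%N]|.
Proof. by apply: eq_card => b; rewrite !inE arrangement_eq0 negbK andbC. Qed.

(** All blocks other than the base block are singletons, so the pivot, if there is
one, is alone; there is none only for the increasing arrangement. *)
Lemma arrangement_lower s : s != 1%g -> lower (arrangement s).
Proof.
move=> s1; have [//|/upperP[a [_ pa]]|ord] := lower_upper_or_ordered (arrangement_normal s).
  rewrite arrangement_alone //; apply/negPn; rewrite -(arrangement_eq0 s).
  by apply: contra (pivotP _ _ pa).1; rewrite /in_order => ->.
case/eqP: s1; apply/permP => i; rewrite perm1; have [x Sx <-] := rank_in_hit i.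
have [|+ _] := in_orderE (ord x); first by rewrite arrangement_eq0 Sx.
rewrite arrangementE // rank_before_arrangement => -[eqr]; apply/val_inj.
by rewrite /= eqr inordK ?rank_in_lt.
Qed.

End Arrangements.
End TorusCohomology.

(** * Fundamental cycles and cup products *)

Lemma merge_eqS k i v r : (0 < i < k)%N -> (merge k i v == r.+1) =
  (v == (r + (i <= r)).+1) || (v == (r + (i.-1 <= r)).+1).
Proof.
case/andP=> i0 ltik; rewrite merge_innerE //.
by case: (leqP v i) => ?; case: (leqP i r) => ?; case: (leqP i.-1 r) => ?; lia.
Qed.

Section TorusPairing.
Variable n : nat.
Local Notation T := 'I_n.+1.
Implicit Types (F G : {ffun T -> nat}) (a b x y : T).
Implicit Types (c u v : {ffun T -> nat} -> int).

Let le_top F x : (F x <= top F)%N. Proof. exact: le_top. Qed.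

Lemma ordered_arrangement F j : normal F -> top F = j.+1 ->
  (forall a, in_order F a) ->
  exists S : {set T}, [/\ ord0 \notin S, #|S| = j.+1 & F = arrangement S (1 : 'S_j.+1)].
Proof.
move=> /andP[F_onto /eqP F0] topF ord; pose S := [set x : T | F x != 0%N].
have S0 : ord0 \notin S by rewrite inE F0.
have rS x : rank_before F x = rank_in S x.
  by apply: eq_card => b; rewrite !inE andbC.
have cardS : #|S| = j.+1.
  have cardE : #|S| = rank_before F n.+1 by apply: eq_card => b; rewrite !inE ltn_ord.
  have ord' (b : T) : (b < n.+1)%N -> in_order F b by move=> _; apply: ord.
  apply/eqP; rewrite eqn_leq -topF; apply/andP; split.
    have [->//|nz] := eqVneq #|S| 0%N; rewrite cardE in nz *.
    have [|b _ <-] := prefix_hit ord' (leqnn _) (v := rank_before F n.+1).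
      by rewrite lt0n nz leqnn.
    exact: le_top.
  have [x <-] := ontoP _ F_onto _ (leqnn _).
  by rewrite cardE prefix_le.
exists S; split=> //; apply/ffunP => x; rewrite ffunE inE.
have [->//|nz /=] := eqVneq (F x) 0%N.
have [-> _] := in_orderE (ord x) nz; rewrite perm1 inordK ?rS //.
by rewrite (rank_in_lt cardS) // inE.
Qed.

Section Pairing.
Variables (S : {set T}) (j : nat).
Hypotheses (S0 : ord0 \notin S) (cardS : #|S| = j.+1).

(** Evaluation on the fundamental cycle of the subtorus on which only the points of
[S] move: its top simplices are the orderings of these points. *)
Definition pairing u : int := \sum_(s : 'S_j.+1) (-1) ^+ s * u (arrangement S s).

Lemma pairingB u v : pairing (fun F => u F - v F) = pairing u - pairing v.
Proof. by rewrite -sumrB; apply: eq_bigr => s _; rewrite mulrBr. Qed.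

Let face_arrangement i (s : 'S_j.+1) : face_at i (arrangement S s) =
  [ffun x => if x \in S then merge j.+1 i (s (inord (rank_in S x))).+1 else 0%N].
Proof.
apply/ffunP => x; rewrite !ffunE (arrangement_onto S0 cardS s).1.
by case: ifP => // _; rewrite /merge; repeat case: ifP.
Qed.

(** Orderings that differ by the transposition of two neighbours share the face where
these are merged. *)
Lemma inner_face_pairing u i : (0 < i < j.+1)%N ->
  \sum_(s : 'S_j.+1) (-1) ^+ s * u (face_at i (arrangement S s)) = 0.
Proof.
case/andP=> i0 ltij; pose t := tperm (inord i.-1 : 'I_j.+1) (inord i).
pose A := \sum_(s : 'S_j.+1) (-1) ^+ s * u (face_at i (arrangement S s)).
suff : A = - A by rewrite -/A; lia.
rewrite {1}/A (reindex_inj (mulIg t)) -sumrN; apply: eq_bigr => s _ /=.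
rewrite odd_permM odd_tperm -(inj_eq val_inj) /= !inordK //; last first.
  by rewrite (leq_ltn_trans (leq_pred _)).
have -> : i.-1 != i by lia.
rewrite addbT signrN mulNr; congr (- (_ * u _)).
apply/ffunP => x; rewrite !face_arrangement !ffunE; case: ifP => // _.
rewrite permM; move: (s _) => w; have ilt := leq_ltn_trans (leq_pred i) ltij.
have [E1 E2] : merge j.+1 i i.+1 = i /\ merge j.+1 i i = i.
  by rewrite !merge_innerE // ltnn leqnn.
by case: tpermP => [->|->|//]; rewrite !inordK // prednK // E1 E2.
Qed.

(** Dropping the last point of an ordering amounts to dropping the first point of
the cyclically rotated ordering, and a rotation of [j.+1] points has sign
[(-1) ^+ j]. *)
Lemma outer_face_pairing u :
  \sum_(s : 'S_j.+1) (-1) ^+ s * u (face_at j.+1 (arrangement S s))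
  = (-1) ^+ j * \sum_(s : 'S_j.+1) (-1) ^+ s * u (face_at 0 (arrangement S s)).
Proof.
pose c : 'S_j.+1 := lift_perm ord0 ord_max 1.
rewrite (reindex_inj (mulIg c)) mulr_sumr; apply: eq_bigr => s _.
have -> : (-1) ^+ (s * c)%g = (-1) ^+ j * (-1) ^+ s :> int.
  by rewrite odd_permM odd_lift_perm odd_perm1 addbF addFb signr_addb signr_odd mulrC.
rewrite -mulrA; congr (_ * (_ * u _)).
apply/ffunP => x; rewrite !face_arrangement !ffunE; case: ifP => // _.
rewrite permM /c; move: (s _) => w; rewrite /merge ltnn /=.
have [k ->|->] := unliftP ord0 w.
  by rewrite lift_perm_lift perm1 /= /bump leqNgt ltn_ord /= add0n eqSS ltn_eqF //.
by rewrite lift_perm_id /= eqxx.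
Qed.

Lemma pairing_coboundary u : pairing (coboundary u) = 0.
Proof.
rewrite /pairing /coboundary.
under eq_bigr => s _ do rewrite (arrangement_onto S0 cardS s).1 mulr_sumr.
rewrite exchange_big big_ord_recl big_ord_recr /=.
have swap i : \sum_(s : 'S_j.+1) (-1) ^+ s * ((-1) ^+ i * u (face_at i (arrangement S s)))
    = (-1) ^+ i * \sum_(s : 'S_j.+1) (-1) ^+ s * u (face_at i (arrangement S s)).
  by rewrite mulr_sumr; apply: eq_bigr => s _; rewrite mulrCA.
rewrite [X in _ + (X + _)]big1 => [|i _]; last first.
  by rewrite swap inner_face_pairing ?mulr0 //; apply: (ltn_ord i).
rewrite !swap /bump /= add1n outer_face_pairing add0r.
move: (\sum_(_ : 'S__) _) => A; rewrite mulrA -exprD addSn addnn -mul2n exprS exprM.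
by rewrite (_ : (-1) ^+ 2 = 1) // expr1n; ring.
Qed.

Lemma pairing_lower u : (forall F, lower F -> top F = j.+1 -> u F = 0) ->
  pairing u = u (arrangement S (1 : 'S_j.+1)).
Proof.
move=> u0; rewrite /pairing (bigD1 1%g) //= big1 ?addr0; last first.
  move=> s s1; rewrite u0 ?mulr0 //; first exact: arrangement_lower.
  exact: (arrangement_onto S0 cardS s).1.
by rewrite odd_perm1 mul1r.
Qed.

(** The cup product, in increasing order, of the 1-cocycles dual to the points of
[S]. *)
Definition cup F : int :=
  (normal F && (top F == j.+1) && [forall x in S, F x == (rank_in S x).+1])%:R.

(** At a face of [F] that merges neighbouring blocks the cup product sees one of
the two ways of skipping a single value, and these come in consecutive pairs. *)
Lemma cup_face F i (A := fun t =>
    [forall x in S, F x == (rank_in S x + (t <= rank_in S x)).+1]%N%:R : int) :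
  normal F -> top F = j.+2 -> (i <= j.+2)%N -> cup (face_at i F) =
  (if (i <= j.+1)%N then A i else 0) + (if (0 < i)%N then A i.-1 else 0).
Proof.
move=> nF topF lei; have k0 : (0 < top F)%N by rewrite topF.
have lei' : (i <= top F)%N by rewrite topF.
have -> : cup (face_at i F) =
    [forall x in S, merge j.+2 i (F x) == (rank_in S x).+1]%:R.
  have [F_onto _] := andP nF; have [topE _] := face_top F_onto k0 lei'.
  rewrite /cup normal_face // topE topF /= eqxx /=.
  by congr ((nat_of_bool _)%:R); apply: eq_forallb => x; rewrite ffunE topF.
have rlt x : x \in S -> (rank_in S x < j.+1)%N by move=> Sx; rewrite (rank_in_lt cardS).
have [->|nz] := eqVneq i 0%N.
  rewrite leq0n addr0; congr ((nat_of_bool _)%:R); apply: eq_forallb_in => x Sx.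
  by rewrite /merge leq0n addn1 /=; case: (F x).
have i0 : (0 < i)%N by rewrite lt0n.
rewrite i0; have [lt|gt] := leqP i j.+1; last first.
  have -> : i = j.+2 by lia.
  rewrite add0r; congr ((nat_of_bool _)%:R); apply: eq_forallb_in => x Sx.
  rewrite /merge ltnn [in RHS]leqNgt (rlt x Sx) addn0.
  by case: (F x =P _) => [->|//]; apply/esym/negbTE; rewrite eqSS gtn_eqF // rlt.
have ilt : (i.-1 < j.+1)%N by rewrite prednK.
have [x0 Sx0 /(congr1 val)] := rank_in_hit cardS (Ordinal ilt).
rewrite /= inordK ?rlt // => rx0.
pose P t x := (F x == (rank_in S x + (t <= rank_in S x)).+1)%N.
have E x : (merge j.+2 i (F x) == (rank_in S x).+1) = P i x || P i.-1 x.
  by apply: merge_eqS; rewrite i0.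
have P' x : x \in S -> x != x0 -> P i x = P i.-1 x.
  move=> Sx neq; rewrite /P; congr (_ == (_ + _).+1); congr nat_of_bool.
  have : rank_in S x != i.-1.
    by apply: contra neq => /eqP eqr; apply/eqP/(rank_in_inj Sx Sx0); rewrite rx0.
  by move: (rank_in _ _) => r; lia.
have N : P i x0 -> P i.-1 x0 = false.
  by rewrite /P rx0 leqnn leqNgt prednK // leqnn addn0 addn1 => /eqP ->; lia.
under eq_forallb do rewrite E.
rewrite /A -/(P i) -/(P i.-1).
have forallF (Q : pred T) : Q x0 = false -> [forall x in S, Q x] = false.
  by move=> Q0; apply/negbTE/forallPn; exists x0; rewrite Sx0 Q0.
have [Pi|nPi] := boolP (P i x0).
  rewrite [X in _ + X](_ : _ = 0) ?addr0; last by rewrite (forallF (P i.-1)) ?N.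
  congr ((nat_of_bool _)%:R); apply: eq_forallb_in => x Sx.
  by rewrite -[RHS]/(P i x); have [->|/(P' x Sx) ->] := eqVneq x x0; rewrite ?Pi ?orbb.
rewrite [X in X + _](_ : _ = 0) ?add0r; last by rewrite (forallF (P i)) // (negPf nPi).
congr ((nat_of_bool _)%:R); apply: eq_forallb_in => x Sx.
rewrite -[RHS]/(P i.-1 x).
by have [->|/(P' x Sx) ->] := eqVneq x x0; rewrite ?(negPf nPi) ?orbb.
Qed.

Lemma cup_cocycle F : normal F -> top F = j.+2 -> coboundary cup F = 0.
Proof.
move=> nF topF; rewrite /coboundary topF.
under eq_bigr => i _ do rewrite cup_face ?leq_ord // mulrDr.
rewrite big_split /= big_ord_recr [X in _ + X]big_ord_recl /= ltnn !mulr0 addr0 add0r.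
by rewrite -big_split big1 // => i _ /=; rewrite leq_ord /= /bump add1n /= exprS; ring.
Qed.

End Pairing.

Lemma pairing_cup (S S' : {set T}) j : ord0 \notin S -> ord0 \notin S' ->
  #|S| = j.+1 -> #|S'| = j.+1 -> pairing S j (cup S' j) = (S == S')%:R.
Proof.
move=> S0 S0' cardS cardS'.
have cupE (s : 'S_j.+1) : cup S' j (arrangement S s) = ((S == S') && (s == 1%g))%:R.
  rewrite /cup arrangement_normal //= (arrangement_onto S0 cardS s).1 eqxx /=.
  congr ((nat_of_bool _)%:R); apply/forall_inP/andP => [ord|[/eqP<- /eqP->] x Sx]; last first.
    by rewrite arrangementE // perm1 inordK // rank_in_lt.
  have eqS : S = S'.
    apply/esym/eqP; rewrite eqEcard cardS cardS' leqnn andbT; apply/subsetP => x Sx'.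
    by have := ord x Sx'; rewrite ffunE; case: ifP.
  split; first by rewrite eqS.
  apply/eqP/permP => i; rewrite perm1; have [x Sx <-] := rank_in_hit cardS i.
  have := ord x; rewrite -eqS => /(_ Sx); rewrite arrangementE // eqSS => /eqP eqr.
  by apply: val_inj; rewrite /= eqr inordK // rank_in_lt.
rewrite /pairing (bigD1 1%g) //= big1 ?addr0; last first.
  by move=> s /negPf s1; rewrite cupE s1 andbF mulr0.
by rewrite cupE eqxx andbT odd_perm1 mul1r.
Qed.

End TorusPairing.

(** * Block functions of ordered partitions *)

Section BlockIndex.
Variable T : finType.
Implicit Types (A B : {set T}) (p q : seq {set T}) (F G Q : {ffun T -> nat}) (x y : T).

Definition block_index p : {ffun T -> nat} := [ffun x => find (fun B => x \in B) p].

Definition blocks F : seq {set T} := [seq [set x | F x == v] | v <- iota 0 (top F).+1].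

(** For ordered partitions, that the first refines the second. *)
Definition monotone F Q := forall x y, (F x <= F y)%N -> (Q x <= Q y)%N.

Lemma block_index_lt p x : ordered_partition [set: T] p -> (block_index p x < size p)%N.
Proof. by case/ordered_partitionP=> _ /(_ x); rewrite inE ffunE -has_find has_count => ->. Qed.

Lemma block_index_mem p x v : ordered_partition [set: T] p -> (v < size p)%N ->
  (x \in nth set0 p v) = (block_index p x == v).
Proof.
move=> pP ltv; have lt := block_index_lt x pP.
have xB : x \in nth set0 p (block_index p x).
  have : has (fun B => x \in B) p by rewrite has_find; move: lt; rewrite ffunE.
  by move/(nth_find set0); rewrite ffunE.
have [/eqP<-//|neq] := boolP (block_index p x == v).
have [p_uniq /and3P[_ /trivIsetP triv _]] := andP pP.
have /triv : nth set0 p (block_index p x) \in [set:: p] by rewrite inE mem_nth.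
move=> /(_ (nth set0 p v)); rewrite inE mem_nth // nth_uniq // => /(_ isT neq).
by move/disjointFr/(_ xB).
Qed.

Lemma top_block_index p : (0 < #|T|)%N -> ordered_partition [set: T] p ->
  [/\ (0 < size p)%N, top (block_index p) = (size p).-1 & onto (block_index p)].
Proof.
case/card_gt0P=> x0 _ pP; have p0 : (0 < size p)%N by apply: leq_ltn_trans (block_index_lt x0 pP).
have hit v : (v < size p)%N -> exists x, block_index p x = v.
  move=> ltv; have /set0Pn[x] : nth set0 p v != set0.
    by case/ordered_partitionP: pP => n0 _; apply: contraNneq n0 => <-; rewrite mem_nth.
  by rewrite block_index_mem // => /eqP; exists x.
have topE : top (block_index p) = (size p).-1.
  by apply: top_eq => [x|]; [have := block_index_lt x pP; lia | apply: hit; lia].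
by split=> //; apply/ontoP => v; rewrite topE => lev; apply: hit; lia.
Qed.

Lemma size_blocks F : size (blocks F) = (top F).+1.
Proof. by rewrite size_map size_iota. Qed.

Lemma nth_blocks F v : (v <= top F)%N -> nth set0 (blocks F) v = [set x | F x == v].
Proof. by move=> lev; rewrite (nth_map 0%N) ?size_iota // nth_iota. Qed.

Lemma blocks_partition F : onto F -> ordered_partition [set: T] (blocks F).
Proof.
move/ontoP=> F_onto; apply/ordered_partitionP; split=> [|x].
  apply/mapP => -[v]; rewrite mem_iota add0n ltnS => /F_onto[x Fx] /setP/(_ x).
  by rewrite !inE Fx eqxx.
rewrite count_map inE -[RHS](_ : count_mem (F x) (iota 0 (top F).+1) = 1%N).
  by apply: eq_count => v /=; rewrite inE eq_sym.
by rewrite count_uniq_mem ?iota_uniq // mem_iota add0n ltnS le_top.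
Qed.

Lemma blocksK F : onto F -> block_index (blocks F) = F.
Proof.
move=> F_onto; apply/ffunP => x; apply/eqP.
by rewrite -block_index_mem ?blocks_partition ?size_blocks ?ltnS ?le_top //
  nth_blocks ?le_top // inE.
Qed.

Lemma block_indexK p : (0 < #|T|)%N -> ordered_partition [set: T] p ->
  blocks (block_index p) = p.
Proof.
move=> T0 pP; have [p0 topE _] := top_block_index T0 pP.
have szE : size (blocks (block_index p)) = size p by rewrite size_blocks topE prednK.
apply: (eq_from_nth szE (x0 := set0)) => v; rewrite szE => ltv.
rewrite nth_blocks ?topE; last by lia.
by apply/setP => x; rewrite inE block_index_mem.
Qed.

Lemma block_index_inj p q : (0 < #|T|)%N -> ordered_partition [set: T] p ->
  ordered_partition [set: T] q -> block_index p = block_index q -> p = q.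
Proof. by move=> T0 pP qP E; rewrite -(block_indexK T0 pP) E block_indexK. Qed.

Definition shift r F : {ffun T -> nat} := [ffun x => (F x + r) %% (top F).+1]%N.

Lemma nth_rot p i v : (i <= size p)%N -> (v < size p)%N ->
  nth set0 (rot i p) v = nth set0 p ((i + v) %% size p).
Proof.
move=> lei ltv; rewrite nth_cat size_drop nth_drop; case: ltnP => [lt|ge].
  by rewrite modn_small //; lia.
rewrite nth_take; last by lia.
congr nth; have -> : (i + v = (v - (size p - i)) + size p)%N by lia.
by rewrite modnDr modn_small //; lia.
Qed.

Lemma block_index_rot p i : (0 < #|T|)%N -> ordered_partition [set: T] p ->
  ordered_partition [set: T] (rot i p) -> (i <= size p)%N ->
  block_index (rot i p) = shift (size p - i) (block_index p).
Proof.
move=> T0 pP rP lei; have [p0 topE _] := top_block_index T0 pP.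
apply/ffunP => x; apply/eqP; have lt := block_index_lt x pP.
rewrite [shift _ _ x]ffunE topE prednK // -block_index_mem //; last first.
  by rewrite size_rot ltn_mod.
rewrite nth_rot ?ltn_mod // block_index_mem ?ltn_mod //.
rewrite modnDmr addnCA subnKC // modnDr modn_small //.
Qed.

Lemma linear_refines_monotone p q : linear_refines p q ->
  monotone (block_index p) (block_index q).
Proof.
case=> ps -> {p} + x y; rewrite !ffunE.
elim: q ps => [|A q IHq] [|s ps] //= /andP[/ordered_partitionP[_ cntA] /IHq IH].
have inA z : has (fun B => z \in B) s = (z \in A) by rewrite has_count cntA; case: (z \in A).
rewrite !find_cat !inA; case xA: (x \in A) => //; case yA: (y \in A).
  move=> le; have : (find (fun B => y \in B) s < size s)%N by rewrite -has_find inA.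
  by rewrite ltnNge (leq_trans (leq_addr _ _) le).
by rewrite leq_add2l => /IH; rewrite ltnS.
Qed.

Lemma flatten_sorted_filter (key : {set T} -> nat) p s m :
  sorted leq (map key p) -> all (fun B => s <= key B < s + m)%N p ->
  flatten [seq [seq B <- p | key B == v] | v <- iota s m] = p.
Proof.
elim: m s p => [|m IHm] s p p_sorted; first by case: p p_sorted => //= B p _; lia.
move=> p_bound /=; pose p' := [seq B <- p | s < key B]%N.
have eq_p : p = [seq B <- p | key B == s] ++ p'.
  rewrite /p' {p'}; elim: p p_sorted p_bound => //= B p IHp pth /andP[bB bp].
  case: (eqVneq (key B) s) => [eqB|neB].
    rewrite -eqB ltnn /= eqB; congr (_ :: _); apply: IHp bp.
    exact: path_sorted pth.
  have ltB : (s < key B)%N by rewrite ltn_neqAle eq_sym neB; case/andP: bB.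
  have all_gt : all (fun C => s < key C)%N p.
    have := order_path_min leq_trans pth; rewrite all_map => /allP le.
    by apply/allP => C /le /= le'; apply: leq_trans ltB le'.
  rewrite ltB (all_filterP all_gt) (_ : [seq C <- p | key C == s] = [::]) //.
  by apply/eqP; rewrite -(negbK (_ == _)) -has_filter; apply/hasPn => C /(allP all_gt);
    rewrite ltn_neqAle eq_sym => /andP[].
have {}IHm : flatten [seq [seq B <- p' | key B == v] | v <- iota s.+1 m] = p'.
  apply: IHm.
    by rewrite /p' sorted_map; apply: sorted_filter; rewrite -?sorted_map //;
      move=> ? ? ?; apply: leq_trans.
  apply/allP => B; rewrite mem_filter => /andP[lt /(allP p_bound)].
  by rewrite lt addSnnS => /andP[].
rewrite [RHS]eq_p -[in RHS]IHm; congr (_ ++ flatten _).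
apply/eq_in_map => v; rewrite mem_iota => /andP[lt _].
rewrite /p' -filter_predI; apply: eq_filter => B /=.
by case: eqP => //= ->.
Qed.

(** The parts of [p] inside a given part of [q] are consecutive, because the index
in [q] is a nondecreasing function of the index in [p]. *)
Lemma monotone_linear_refines p q : ordered_partition [set: T] p ->
  ordered_partition [set: T] q -> monotone (block_index p) (block_index q) ->
  linear_refines p q.
Proof.
move=> pP qP mono; have [pn0 pcnt] := ordered_partitionP _ _ pP.
pose key B := if [pick x in B] is Some x then block_index q x else 0%N.
have keyE B x : B \in p -> x \in B -> key B = block_index q x.
  move=> pB xB; rewrite /key; case: pickP => [y yB|/(_ x)]; last by rewrite xB.
  have /(nthP set0)[v ltv eqB] := pB.
  move: xB yB; rewrite -eqB !block_index_mem // => /eqP xv /eqP yv.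
  by apply/eqP; rewrite eqn_leq !mono ?xv ?yv.
have keyP B : B \in p -> exists2 x, x \in B & key B = block_index q x.
  move=> pB; have /set0Pn[x xB] : B != set0 by apply: contraNneq pn0 => <-.
  by exists x => //; apply: keyE.
exists [seq [seq B <- p | key B == v] | v <- iota 0 (size q)].
  apply/esym/flatten_sorted_filter.
    apply/(sortedP 0%N) => i; rewrite size_map => lti.
    have lti' := ltnW lti; rewrite !(nth_map set0) //.
    have [x xB ->] := keyP _ (mem_nth set0 lti').
    have [y yB ->] := keyP _ (mem_nth set0 lti).
    by apply: mono; move: xB yB; rewrite !block_index_mem // => /eqP-> /eqP->.
  by apply/allP => B /keyP[x _ ->]; rewrite add0n block_index_lt.
rewrite all2E size_map size_iota eqxx /=; apply/allP => -[A s].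
move/(nthP (set0, [::])) => [v]; rewrite size_zip size_map size_iota minnn => ltv.
rewrite nth_zip ?size_map ?size_iota // (nth_map 0%N) ?size_iota // nth_iota // add0n.
case=> <- <- /=; apply/ordered_partitionP; split=> [|x].
  by rewrite mem_filter negb_and pn0 orbT.
rewrite block_index_mem // count_filter.
have [eqv|nev] := eqVneq (block_index q x) v.
  have := pcnt x; rewrite inE => <-; apply: eq_in_count => B pB /=.
  by case xB: (x \in B) => //=; rewrite (keyE B x) // eqv eqxx.
apply/eqP; rewrite eqn0Ngt -has_count; apply/hasPn => B pB /=.
by case xB: (x \in B) => //=; rewrite (keyE B x).
Qed.

Lemma block_monotone F i : (i < top F)%N -> monotone F (face_at i F).
Proof.
move=> lti a b le; rewrite !ffunE !merge_innerE //.
by case: (leqP (F a) i) => ?; case: (leqP (F b) i) => ?; lia.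
Qed.

End BlockIndex.

(** * Block functions of cyclic partitions *)

Lemma modnS_small k v : (v <= k)%N -> ((v + 1) %% k.+1 = if v == k then 0 else v.+1)%N.
Proof.
rewrite addn1 leq_eqVlt; case: eqP => [-> _|_ /= lt]; first by rewrite modnn.
by rewrite modn_small.
Qed.

Lemma merge_next k i v : (0 < k)%N -> (i <= k)%N -> (v <= k)%N ->
  merge k (if i == k then 0 else i.+1)%N (if v == k then 0 else v.+1)%N =
  if i == k then merge k i v
  else if merge k i v == k.-1 then 0%N else (merge k i v).+1.
Proof.
move=> k0 lei lev; case: (eqVneq i k) => [->|nei].
  rewrite /merge ltnn; case: (eqVneq v k) => [_|nev]; first by rewrite k0.
  by rewrite k0.
have ltik : (i < k)%N by rewrite ltn_neqAle nei.
rewrite (merge_innerE v ltik); have [lt|ge] := ltnP i.+1 k.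
  rewrite merge_innerE //; case: (eqVneq v k) => [->|nev].
    by rewrite [(k <= i)%N]leqNgt ltik /= eqxx.
  rewrite ltnS; case: (leqP v i) => [le|gt]; first by case: eqP => //; lia.
  by case: eqP => [|_]; [move/eqP: nev; lia | rewrite prednK //; lia].
have -> : k = i.+1 by lia.
rewrite {1}/merge ltnn /=; case: (leqP v i) => [le|gt].
  by rewrite [v == i.+1]ltn_eqF // eqSS.
by have -> : v = i.+1; [lia | rewrite eqxx /= eqxx].
Qed.

Section Representatives.
Variable T : finType.
Hypothesis T_gt0 : (0 < #|T|)%N.
Implicit Types (F G Q : {ffun T -> nat}) (a b : T) (x y z : cpart T) (p q : opart T).

Lemma shift_top r F : onto F -> top (shift r F) = top F /\ onto (shift r F).
Proof.
move/ontoP=> F_onto; set k := top F in F_onto *.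
have hit v : (v <= k)%N -> exists a, shift r F a = v.
  move=> lev; have [|a Fa] := F_onto ((v + (k.+1 - r %% k.+1)) %% k.+1)%N.
    by rewrite -ltnS ltn_mod.
  exists a; rewrite ffunE Fa -/k modnDml -addnA -modnDmr -(modnDmr _ r) subnK.
    by rewrite modnn addn0 modn_small.
  by rewrite ltnW // ltn_mod.
have topE : top (shift r F) = k.
  by apply: top_eq => [a|]; [rewrite ffunE -ltnS ltn_mod | apply: hit].
by split=> //; apply/ontoP => v; rewrite topE; apply: hit.
Qed.

Lemma shift_shift r s F : onto F -> shift r (shift s F) = shift (s + r) F.
Proof.
by move=> F_onto; apply/ffunP => a; rewrite !ffunE (shift_top _ F_onto).1 modnDml addnA.
Qed.

Lemma shift_id r F : (r %% (top F).+1 = 0)%N -> shift r F = F.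
Proof.
move=> r0; apply/ffunP => a; rewrite ffunE -modnDmr r0 addn0 modn_small //.
by rewrite ltnS le_top.
Qed.

(** A cyclic partition has one block function for each choice of its first block. *)
Definition represents F x := exists2 p : opart T, x = (\pi_(cpart T) p)%qT & F = block_index p.

Lemma opartP p : ordered_partition [set: T] p.
Proof. by case: p. Qed.

Lemma represents_onto F x : represents F x -> onto F.
Proof. by case=> p _ ->; have [] := top_block_index T_gt0 (opartP p). Qed.

Lemma onto_opart F : onto F -> exists p, F = block_index p.
Proof.
move=> F_onto; have sz : (size (blocks F) <= #|T|)%N by rewrite size_blocks onto_top_lt.
by exists (@OPart T (Bseq sz) (blocks_partition F_onto)); rewrite /= blocksK.
Qed.

Lemma onto_represents F : onto F -> exists x, represents F x.
Proof. by case/onto_opart=> p ->; exists (\pi_(cpart T) p)%qT, p. Qed.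

Lemma represents_inj F x y : represents F x -> represents F y -> x = y.
Proof.
case=> p -> -> [q -> /(block_index_inj T_gt0 (opartP p) (opartP q)) E].
by congr (\pi_ _ _)%qT; apply/val_inj/val_inj.
Qed.

Lemma represents_parts F x : represents F x -> number_of_parts x = (top F).+1.
Proof.
case=> p -> ->; have [p0 -> _] := top_block_index T_gt0 (opartP p).
by rewrite number_of_partsE prednK.
Qed.

Lemma rot_partition (s : seq {set T}) i :
  ordered_partition [set: T] s -> ordered_partition [set: T] (rot i s).
Proof.
case/ordered_partitionP=> n0 cnt; apply/ordered_partitionP; rewrite mem_rot.
by split=> // a; rewrite -cnt; apply/seq.permP; rewrite perm_rot.
Qed.

Lemma represents_rot F G x : represents F x -> represents G x -> exists r, G = shift r F.
Proof.
case=> p -> -> [q /eqmodP/existsP[[i /=]]]; rewrite ltnS => lei /eqP eq_q ->.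
exists (size p - i)%N; rewrite eq_q block_index_rot //; first exact: opartP.
by apply: rot_partition; apply: opartP.
Qed.

Lemma represents_shift r F x : represents F x -> represents (shift r F) x.
Proof.
move=> rF; have F_onto := represents_onto rF.
have [_ /onto_opart[q qE]] := shift_top r F_onto; exists q => //.
case: rF => p -> eqF; apply/eqmodP/rotationP; pose k := size p.
have [p0 topE _] := top_block_index T_gt0 (opartP p).
exists (k - r %% k)%N; apply: (block_index_inj T_gt0 (opartP q)).
  exact/rot_partition/opartP.
rewrite block_index_rot ?leq_subr //; [|exact: opartP|exact/rot_partition/opartP].
rewrite -qE eqF subKn; last by rewrite ltnW // ltn_mod.
by apply/ffunP => a; rewrite !ffunE topE prednK // modnDmr.
Qed.

Lemma monotone_refines F Q y x : represents F y -> represents Q x -> monotone F Q ->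
  refines y x.
Proof.
case=> p -> -> [q -> ->] mono; apply/asboolP; exists p, q; split=> //.
exact: monotone_linear_refines (opartP p) (opartP q) mono.
Qed.

Lemma refines_monotone Q y x : refines y x -> represents Q x ->
  exists2 F, represents F y & monotone F Q.
Proof.
move=> + [q eqx ->]; rewrite -[y]reprK eqx.
case/refines_pi=> p [-> /linear_refines_monotone mono].
by exists (block_index p) => //; exists p.
Qed.

(** With at least two blocks in [Q], a nontrivial rotation puts an element of the
last block of [Q] before one of the first. *)
Lemma monotone_represents_inj F G Q x : represents F x -> represents G x ->
  onto Q -> (0 < top Q)%N -> monotone F Q -> monotone G Q -> F = G.
Proof.
move=> rF rG Q_onto Q1 mF mG; have F_onto := represents_onto rF.
have [r eqG] := represents_rot rF rG; set k := top F.
have [r0|r0] := eqVneq (r %% k.+1)%N 0%N; first by rewrite eqG shift_id.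
have [a Fa] := ontoP _ F_onto 0%N (leq0n _).
have [b Fb] := ontoP _ F_onto k (leqnn _).
have Qa : Q a = 0%N.
  have [c Qc] := ontoP _ Q_onto 0%N (leq0n _).
  by apply/eqP; rewrite -leqn0 -Qc mF // Fa.
have : (Q b <= Q a)%N.
  apply: mG; rewrite eqG !ffunE Fa Fb -/k add0n -(modnDmr k).
  have -> : (k + r %% k.+1 = (r %% k.+1).-1 + k.+1)%N by lia.
  by rewrite modnDr modn_small ?leq_pred // (leq_ltn_trans (leq_pred _)) // ltn_mod.
have [c Qc] := ontoP _ Q_onto (top Q) (leqnn _).
have : (Q c <= Q b)%N by apply: mF; rewrite Fb le_top.
by rewrite Qc Qa => le1 le2; move: Q1; rewrite ltnNge (leq_trans le1 le2).
Qed.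

(** Merging two cyclically adjacent blocks commutes with the choice of the first
block. *)
Lemma represents_face_shift r F i z : onto F -> (0 < top F)%N -> (i <= top F)%N ->
  represents (face_at i F) z ->
  represents (face_at ((i + r) %% (top F).+1) (shift r F)) z.
Proof.
move=> F_onto k0 lei rz; elim: r => [|r IHr].
  by rewrite shift_id ?mod0n // addn0 modn_small.
have [topE G_onto] := shift_top r F_onto; set G := shift r F in IHr topE G_onto *.
have -> : shift r.+1 F = shift 1 G by rewrite shift_shift // addn1.
have -> : ((i + r.+1) %% (top F).+1 = ((i + r) %% (top F).+1 + 1) %% (top F).+1)%N.
  by rewrite modnDml addn1 addnS.
have lei' : ((i + r) %% (top F).+1 <= top F)%N by rewrite -ltnS ltn_mod.
move: ((i + r) %% _)%N lei' IHr => i' lei' rz'; rewrite modnS_small //.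
clearbody G; have k0' : (0 < top G)%N by rewrite topE.
have [topf _] := face_top G_onto k0' (i := i') ltac:(by rewrite topE).
have -> : face_at (if i' == top F then 0 else i'.+1) (shift 1 G)
          = shift (i' != top F) (face_at i' G).
  apply/ffunP => a; have := merge_next k0 lei' (v := G a); rewrite -topE le_top => /(_ isT).
  rewrite ![face_at _ _ _]ffunE ![shift _ _ _]ffunE (shift_top 1 G_onto).1 topf.
  rewrite modnS_small ?le_top // => ->.
  have lt : (merge (top G) i' (G a) < top G)%N by rewrite merge_lt ?topE // -topE le_top.
  rewrite ffunE; case: eqP => /= _.
    by rewrite addn0 modn_small // prednK // topE.
  by rewrite modnS_small // -ltnS prednK.
exact: represents_shift.
Qed.

End Representatives.

(** * Cells of the cyclopermutohedron *)

Section NormalForm.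
Variable n : nat.
Local Notation T := 'I_n.+1.
Implicit Types (F G : {ffun T -> nat}) (x y z : cell T).
Implicit Types (c e : cell T -> int) (u : {ffun T -> nat} -> int).

Lemma card_T : (0 < #|T|)%N. Proof. by rewrite card_ord. Qed.
Local Hint Resolve card_T : core.

Definition normalize F := shift ((top F).+1 - F ord0) F.

Lemma normalize_normal F : onto F -> normal (normalize F).
Proof.
move=> F_onto; rewrite /normal (shift_top _ F_onto).2 ffunE /=.
by rewrite subnKC ?modnn // ltnW // ltnS le_top.
Qed.

(** The block function of [x] whose first block contains the base point. *)
Definition code x : {ffun T -> nat} := normalize (block_index (repr (label_of x))).

Lemma block_index_represents x : represents (block_index (repr (label_of x))) x.
Proof. by exists (repr (label_of x)); rewrite ?reprK. Qed.

Lemma code_represents x : represents (code x) x.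
Proof. exact/represents_shift/block_index_represents. Qed.

Lemma code_normal x : normal (code x).
Proof. exact/normalize_normal/(represents_onto card_T (block_index_represents x)). Qed.

Lemma code_onto x : onto (code x). Proof. by case/andP: (code_normal x). Qed.

Lemma code_unique F x : represents F x -> normal F -> F = code x.
Proof.
move=> rF /andP[_ /eqP F0]; have [r eqF] := represents_rot card_T (code_represents x) rF.
have [_ /eqP c0] := andP (code_normal x).
by rewrite eqF shift_id //; move: F0; rewrite eqF ffunE c0.
Qed.

Lemma code_inj : injective code.
Proof.
move=> x y eqc; apply: val_inj; apply: (represents_inj card_T (F := code x)).
  exact: code_represents.
by rewrite eqc; apply: code_represents.
Qed.

Lemma top_code x : (1 < top (code x))%N.
Proof.
have x3 : (2 < number_of_parts x)%N by case: x.
by rewrite (represents_parts card_T (code_represents x)) in x3.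
Qed.

Lemma code_exists F : normal F -> (1 < top F)%N -> exists x, code x = F.
Proof.
move=> nF F1; have [F_onto _] := andP nF.
have [y rF] := onto_represents F_onto.
have y3 : (2 < number_of_parts y)%N by rewrite (represents_parts card_T rF).
by exists (Cell y3); apply/esym/code_unique.
Qed.

(** A chain of cells as a cochain of the torus that vanishes in degrees 0 and 1,
where no cells are left. *)
Definition extend c F : int := \sum_x (F == code x)%:R * c x.

Lemma extend_code c x : extend c (code x) = c x.
Proof.
rewrite /extend (bigD1 x) //= eqxx mul1r big1 ?addr0 // => y ne.
by rewrite (inj_eq code_inj) eq_sym (negPf ne) mul0r.
Qed.

Lemma extend_eq0 c F : (forall x, F <> code x) -> extend c F = 0.
Proof. by move=> neq; rewrite /extend big1 // => x _; case: eqP => [/neq//|_]; rewrite mul0r. Qed.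

Lemma extend_neq0 c F : extend c F != 0 -> exists2 x, F = code x & c x != 0.
Proof.
move=> nz; case: (pickP (fun x => F == code x)) => [x /eqP eqF|neq].
  by exists x => //; rewrite -extend_code -eqF.
by rewrite extend_eq0 ?eqxx // in nz => x /eqP; rewrite neq.
Qed.

Lemma extendB c e F : extend (fun x => c x - e x) F = extend c F - extend e F.
Proof. by rewrite -sumrB; apply: eq_bigr => x _; rewrite mulrBr. Qed.

Definition incidence x y := coboundary (fun F => (F == code x)%:R) (code y).

Local Notation bd := (cell_boundary incidence).

Lemma boundary_code c y : bd c y = coboundary (extend c) (code y).
Proof.
rewrite /cell_boundary /incidence /coboundary.
under eq_bigr do rewrite mulr_suml.
rewrite exchange_big; apply: eq_bigr => i _ /=.
by rewrite mulr_sumr; apply: eq_bigr => x _; rewrite mulrA.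
Qed.

(** Faces of dimension at most 1 carry no cell, but then [extend c] vanishes on
them and on their faces alike. *)
Lemma extend_boundary c F : normal F -> (0 < top F)%N ->
  coboundary (extend c) F = extend (bd c) F.
Proof.
move=> nF F0; have [gt1|le1] := ltnP 1 (top F).
  by have [x <-] := code_exists nF gt1; rewrite extend_code boundary_code.
rewrite [RHS]extend_eq0 => [|x eqF]; last by have := top_code x; rewrite -eqF ltnNge le1.
rewrite /coboundary big1 // => i _; rewrite extend_eq0 ?mulr0 // => x eqF.
have [F_onto _] := andP nF; have [topE _] := face_top F_onto F0 (leq_ord i).
by have := top_code x; rewrite -eqF topE; lia.
Qed.

Lemma incidence_face x y : incidence x y != 0 ->
  exists2 i, (i <= top (code y))%N & face_at i (code y) = code x.
Proof.
move=> nz; case: (pickP (fun i : 'I_(top (code y)).+1 => face_at i (code y) == code x)).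
  by move=> i /eqP eqi; exists i => //; apply: leq_ord.
by move=> none; rewrite /incidence /coboundary big1 ?eqxx // in nz => i _;
  rewrite none mulr0.
Qed.

Lemma incidence_top x y : incidence x y != 0 -> top (code y) = (top (code x)).+1.
Proof.
case/incidence_face=> i lei <-.
have [-> _] := face_top (code_onto y) (ltnW (top_code y)) lei.
by rewrite prednK // ltnW // top_code.
Qed.

Lemma le_cell x y : (y <= x)%O = refines (label_of y) (label_of x).
Proof. by []. Qed.

Lemma incidence_lt x y : incidence x y != 0 -> (y < x)%O.
Proof.
move=> nz; rewrite lt_def; apply/andP; split.
  by apply: contraTneq nz => ->; apply/negP => /incidence_top /eqP; rewrite ltn_eqF.
have [i lei eqi] := incidence_face nz; rewrite le_cell.
have k0 := ltnW (top_code y).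
have rx : represents (face_at i (code y)) x by rewrite eqi; apply: code_represents.
have := represents_face_shift card_T ((top (code y)).+1 - i) (code_onto y) k0 lei rx.
rewrite subnKC ?modnn; last by rewrite ltnW.
set G := shift _ _ => rx'; have rG : represents G y.
  exact/represents_shift/code_represents.
apply: (monotone_refines rG rx').
apply: block_monotone; have [topG _] := shift_top ((top (code y)).+1 - i) (code_onto y).
by rewrite /G topG.
Qed.

Lemma incidence_delta x w : incidence x w = bd (fun z => (z == x)%:R) w.
Proof.
rewrite /cell_boundary (bigD1 x) //= eqxx mulr1 big1 ?addr0 // => z /negPf ->.
by rewrite mulr0.
Qed.

Lemma incidenceK x y : \sum_w incidence x w * incidence w y = 0.
Proof.
transitivity (bd (incidence x) y).
  by apply: eq_bigr => w _; rewrite mulrC.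
have k0 := ltnW (top_code y).
rewrite boundary_code -(coboundaryK (fun F => (F == code x)%:R) (code_onto y) k0).
apply: eq_bigr => i _; congr (_ * _).
have nF : normal (face_at i (code y)).
  by apply: normal_face (code_normal y) _ _ => //; apply: leq_ord.
have [topE _] := face_top (code_onto y) k0 (leq_ord i).
have deltaE F : (F == code x)%:R = extend (fun z => (z == x)%:R) F.
  rewrite /extend (bigD1 x) //= eqxx mulr1 big1 ?addr0 // => z /negPf ->.
  by rewrite mulr0.
rewrite [RHS](_ : _ = coboundary (extend (fun z => (z == x)%:R)) (face_at i (code y))).
  rewrite extend_boundary //; last by rewrite topE -ltnS prednK // top_code.
  by apply: eq_bigr => w _; rewrite incidence_delta.
by apply: eq_bigr => k _; rewrite deltaE.
Qed.

(** The vertices are the orderings of all points, oriented by their signs. *)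
Definition augmentation x : int :=
  pairing [set~ ord0 : T] n.-1 (fun F => (F == code x)%:R).

Lemma sum_augmentation c :
  \sum_x c x * augmentation x = pairing [set~ ord0] n.-1 (extend c).
Proof.
rewrite /augmentation /pairing; under eq_bigr do rewrite mulr_sumr.
rewrite exchange_big; apply: eq_bigr => s _; rewrite mulr_sumr.
by apply: eq_bigr => x _; rewrite mulrCA [c x * _]mulrC.
Qed.

End NormalForm.

(** * Acyclicity of a closed cell *)

Lemma monotone_top (T : finType) (F Q : {ffun T -> nat}) :
  onto Q -> monotone F Q -> (top Q <= top F)%N.
Proof.
move=> Q_onto mono.
suff /(_ (top Q) (leqnn _))[a _ le] v : (v <= top Q)%N -> exists2 a, Q a = v & (v <= F a)%N.
  exact: leq_trans le (le_top F a).
elim: v => [|v IHv] lev; first by have [a Qa] := ontoP _ Q_onto _ lev; exists a.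
have [a Qa le] := IHv (ltnW lev); have [b Qb] := ontoP _ Q_onto _ lev; exists b => //.
apply: leq_ltn_trans le _; rewrite ltnNge; apply/negP => /mono.
by rewrite Qa Qb ltnn.
Qed.

Lemma monotone_eq (T : finType) (F Q : {ffun T -> nat}) (a b : T) :
  monotone F Q -> F a = F b -> Q a = Q b.
Proof. by move=> mono eqF; apply/eqP; rewrite eqn_leq !mono ?eqF. Qed.

Section LocalStep.
Variable n : nat.
Local Notation T := 'I_n.+1.
Implicit Types (F G Q : {ffun T -> nat}) (a b : T) (x y z : cell T).
Implicit Types (c e v : cell T -> int).

Local Notation bd := (cell_boundary (@incidence n)).
Let T0 : (0 < #|T|)%N := card_T n.

Lemma represents_normalize F z : represents F z -> normalize F = code z.
Proof.
move=> rF; apply: code_unique; first exact: represents_shift.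
exact/normalize_normal/(represents_onto T0 rF).
Qed.

Lemma normal_represents_inj F G (x : cpart T) :
  represents F x -> represents G x -> normal F -> normal G -> F = G.
Proof.
move=> rF rG /andP[_ /eqP F0] /andP[_ /eqP G0]; have [r eqG] := represents_rot T0 rF rG.
by rewrite eqG shift_id //; move: G0; rewrite eqG ffunE F0.
Qed.

(** Changing the starting block permutes the faces cyclically, so the boundary
keeps its shape up to signs. *)
Lemma boundary_representative F y : represents F y ->
  exists2 eps : nat -> int, forall i, eps i * eps i = 1 &
  forall c, bd c y = \sum_(i < (top F).+1) eps i * extend c (normalize (face_at i F)).
Proof.
move=> rF; have [r eqF] := represents_rot T0 (code_represents y) rF.
have [topF F_onto] := shift_top r (code_onto y); rewrite -eqF in topF F_onto.
set k := top (code y) in topF *; have k0 : (0 < k)%N := ltnW (top_code y).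
pose s i := ((i + (k.+1 - r %% k.+1)) %% k.+1)%N.
have sK i : (i <= k)%N -> ((s i + r) %% k.+1 = i)%N.
  move=> lei; rewrite /s modnDml -addnA -modnDmr -(modnDmr _ r) subnK.
    by rewrite modnn addn0 modn_small.
  by rewrite ltnW // ltn_mod.
exists (fun i => (-1) ^+ s i) => [i|c]; first by rewrite -expr2 sqrr_sign.
rewrite boundary_code /coboundary -/k topF.
have s_lt (i : 'I_k.+1) : (s i < k.+1)%N by rewrite ltn_mod.
rewrite (reindex_inj (h := fun i : 'I_k.+1 => Ordinal (s_lt i))) /=; last first.
  move=> i j /(congr1 val) /= eqs; apply/val_inj => /=.
  by rewrite -(sK i (leq_ord i)) -(sK j (leq_ord j)) eqs.
apply: eq_bigr => i _; congr (_ * extend _ _).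
have les : (s i <= k)%N by rewrite -ltnS.
have [topf f_onto] := face_top (code_onto y) k0 les.
have [z rz] := onto_represents f_onto.
have := represents_face_shift T0 r (code_onto y) k0 les rz.
rewrite -/k sK ?leq_ord // -eqF => rz'.
have k0' : (0 < top F)%N by rewrite topF.
have [_ fF_onto] := face_top F_onto k0' (i := i) ltac:(by rewrite topF leq_ord).
apply: (@normal_represents_inj _ _ z) => //.
- exact: represents_shift.
- by apply: normal_face => //; apply: code_normal.
- exact: normalize_normal.
Qed.

Lemma represents_cell F : onto F -> (1 < top F)%N -> exists x : cell T, represents F x.
Proof.
move=> F_onto F1; have [y rF] := onto_represents F_onto.
have y3 : (2 < number_of_parts y)%N by rewrite (represents_parts T0 rF).
by exists (Cell y3).
Qed.

Lemma represents_cell_inj F x y : represents F x -> represents F y -> x = y.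
Proof. by move=> rx ry; apply/val_inj/(represents_inj T0 rx ry). Qed.

Lemma card_nonbase : (0 < n)%N -> #|[set~ ord0 : T]| = n.-1.+1.
Proof. by move=> n0; rewrite cardsC1 card_ord /= prednK. Qed.

Lemma base_notin : (ord0 : T) \notin [set~ ord0].
Proof. by rewrite !inE eqxx. Qed.

Lemma augmentation_boundary c : (0 < n)%N -> \sum_y bd c y * augmentation y = 0.
Proof.
move=> n0; have cardS := card_nonbase n0; rewrite sum_augmentation.
rewrite -[RHS](pairing_coboundary base_notin cardS (extend c)).
apply: eq_bigr => s _; congr (_ * _).
have [topA _] := arrangement_onto base_notin cardS s.
by apply/esym/extend_boundary; rewrite ?topA //; apply: arrangement_normal base_notin cardS _.
Qed.

Lemma augmentation_arrangement x : augmentation x != 0 ->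
  exists s : 'S_n.-1.+1, code x = arrangement [set~ ord0] s.
Proof.
move=> nz; case: (pickP (fun s : 'S_n.-1.+1 => arrangement [set~ ord0] s == code x)).
  by move=> s /eqP <-; exists s.
move=> none; rewrite /augmentation /pairing big1 ?eqxx // in nz => s _.
by rewrite none mulr0.
Qed.

Lemma augmentation_alone x t : (0 < n)%N -> augmentation x != 0 -> alone (code x) t.
Proof.
move=> n0 /augmentation_arrangement[s ->]; have cardS := card_nonbase n0.
have [->|ne] := eqVneq t ord0; last by apply: arrangement_alone; rewrite ?inE.
have A0 : arrangement [set~ ord0 : T] s ord0 = 0%N.
  by apply/eqP; rewrite arrangement_eq0 base_notin.
apply/aloneP => b /eqP; rewrite A0 arrangement_eq0 !inE negbK.
by move/eqP.
Qed.

Lemma alone_shift r F t : alone F t -> alone (shift r F) t.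
Proof.
move/aloneP=> al; apply/aloneP => b; rewrite !ffunE => /eqP.
by rewrite eqn_modDr !modn_small ?ltnS ?le_top // => /eqP/al.
Qed.

Definition local_exact_at x := forall c (e : int),
  (forall y, c y != 0 -> (y <= x)%O) ->
  (forall y, bd c y = 0) -> \sum_y c y * augmentation y = 0 ->
  exists c', [/\ forall y, c' y != 0 -> (y <= x)%O,
                 forall y, bd c' y = c y & \sum_y c' y * augmentation y = e].

Lemma boundary_support c y : bd c y != 0 -> exists2 z, c z != 0 & (y < z)%O.
Proof.
move=> nz; case: (pickP (fun z => incidence z y * c z != 0)) => [z|none].
  by rewrite mulf_eq0 negb_or => /andP[/incidence_lt lt cz]; exists z.
by rewrite /cell_boundary big1 ?eqxx // in nz => z _; apply/eqP/negbFE/none.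
Qed.

Section Step.
Variables (x x' : cell T) (Q Q' : {ffun T -> nat}) (a : T).
Hypotheses (rQ : represents Q x) (rQ' : represents Q' x').
Hypotheses (Qa : Q a = 0%N) (Q'a : Q' a = 0%N).
Hypothesis Q'E : forall t, t != a -> Q' t = (Q t).+1.

Let Q_onto : onto Q. Proof. exact: represents_onto rQ. Qed.
Let Q_top : (1 < top Q)%N.
Proof.
have x3 : (2 < number_of_parts x)%N by case: x.
by rewrite (represents_parts T0 rQ) in x3.
Qed.

(** For [y] below [x], the block function of [y] that refines [Q] as a linear order,
and a dummy value elsewhere; by [linear_code_unique] there is no choice. *)
Definition linear_code y : {ffun T -> nat} :=
  if pselect (exists2 F, represents F y & monotone F Q) is left ex
  then projT1 (cid2 ex) else [ffun=> 0%N].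

Lemma linear_codeP y : (y <= x)%O ->
  represents (linear_code y) y /\ monotone (linear_code y) Q.
Proof.
rewrite le_cell => /refines_monotone/(_ rQ) ex; rewrite /linear_code.
by case: pselect => [ex'|//]; case: cid2.
Qed.

Lemma linear_code_unique F y : represents F y -> monotone F Q ->
  (y <= x)%O /\ linear_code y = F.
Proof.
move=> rF mF; have le : (y <= x)%O by rewrite le_cell (monotone_refines rF rQ).
have [rL mL] := linear_codeP le; split=> //.
by apply: (monotone_represents_inj T0 rL rF Q_onto _ mL mF); apply: ltnW.
Qed.

(** The three kinds of cells below [x]: in those below [x'] the point [a] is alone
at the front of its part of [Q], in the near ones it is alone but further back,
and in the far ones it shares its block.  [pull] and
[push] match near and far cells. *)
Definition far y := (y <= x)%O && ~~ alone (linear_code y) a.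
Definition near y :=
  [&& (y <= x)%O, alone (linear_code y) a & (0 < linear_code y a)%N].

Definition cell_at F : cell T := odflt x [pick y | code y == normalize F].

Lemma cell_atP F : onto F -> (1 < top F)%N -> represents F (cell_at F).
Proof.
move=> F_onto F1; have [y rF] := represents_cell F_onto F1.
rewrite /cell_at; case: pickP => [z /eqP eqz|/(_ y)].
  by move: eqz; rewrite (represents_normalize rF) => /code_inj ->.
by rewrite (represents_normalize rF) eqxx.
Qed.

Definition pull y := cell_at (join_left a (linear_code y)).
Definition push y := cell_at (split_off a (linear_code y)).

Lemma below_step y : (y <= x')%O -> [/\ (y <= x)%O, ~~ far y & ~~ near y].
Proof.
rewrite le_cell => /refines_monotone/(_ rQ')[F rF mF].
have mQ' : monotone Q' Q.
  move=> s t; have [->|/Q'E ->] := eqVneq s a; first by rewrite Qa.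
  by have [->|/Q'E ->] := eqVneq t a; rewrite ?Q'a.
have [le eqL] := linear_code_unique rF (fun s t st => mQ' _ _ (mF s t st)).
have eq_a t : (Q' t <= 0)%N -> t = a.
  by have [//|/Q'E ->] := eqVneq t a; rewrite ltn0.
have al : alone F a by apply/aloneP => t eqF; apply: eq_a; rewrite -Q'a mF ?eqF.
have Fa : F a = 0%N.
  have [t Ft] := ontoP _ (represents_onto T0 rF) _ (leq0n _).
  by rewrite -(eq_a t) ?Ft // -Q'a mF ?Ft.
by rewrite /far /near le eqL al Fa ltnn.
Qed.

Lemma step_cover y : (y <= x)%O -> [\/ far y, near y | (y <= x')%O].
Proof.
move=> le; have [rL mL] := linear_codeP le; rewrite /far /near le.
have [al|_] := boolP (alone _ a); last by constructor 1.
have [La|_] := posnP (linear_code y a); last by constructor 2.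
constructor 3; rewrite le_cell; apply: (monotone_refines rL rQ') => s t st.
have [->|ns] := eqVneq s a; first by rewrite Q'a.
have [eqt|nt] := eqVneq t a; last by rewrite !Q'E // ltnS mL.
case/eqP: ns; apply: (aloneP _ _ al); apply/eqP.
by rewrite La -leqn0 -La -eqt.
Qed.

Lemma pull_far y : near y -> [/\ far (pull y),
  linear_code (pull y) = join_left a (linear_code y) & push (pull y) = y].
Proof.
case/and3P=> le al La; have [rL mL] := linear_codeP le; rewrite /pull /push.
set F := linear_code y in al La rL mL *; have F_onto := represents_onto T0 rL.
set G := join_left a F; have [topG G_onto] : top G = (top F).-1 /\ onto G.
  exact: join_left_onto.
have mG : monotone G Q.
  move=> s t; rewrite /G !join_leftE //; have [->|ns] := eqVneq s a; first by rewrite Qa.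
  move=> st; apply: mL; move: st.
  have : F s <> F a by move/(aloneP _ _ al) => eqs; rewrite eqs eqxx in ns.
  move: (F s) (F t) (F a) La => p q r r0 ne.
  by case: (leqP p r.-1) => ?; case: (leqP q r.-1) => ?; lia.
have G1 : (1 < top G)%N by apply: leq_trans Q_top (monotone_top Q_onto mG).
have rG := cell_atP G_onto G1; have [leG eqG] := linear_code_unique rG mG.
split; first by rewrite /far leG eqG join_left_not_alone.
  exact: eqG.
rewrite eqG join_leftK //; apply: represents_cell_inj rL; apply: cell_atP => //.
by apply: leq_trans G1 _; rewrite topG leq_pred.
Qed.

Lemma push_near y : far y -> near (push y) /\ pull (push y) = y.
Proof.
case/andP=> le nal; have [rL mL] := linear_codeP le; rewrite /pull /push.
set F := linear_code y in nal rL mL *; have F_onto := represents_onto T0 rL.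
set G := split_off a F; have [topG G_onto] : top G = (top F).+1 /\ onto G.
  exact: split_off_onto.
have mG : monotone G Q by move=> s t /split_off_monotone; apply: mL.
have G1 : (1 < top G)%N by apply: leq_trans Q_top (monotone_top Q_onto mG).
have rG := cell_atP G_onto G1; have [leG eqG] := linear_code_unique rG mG.
rewrite /near leG eqG split_off_alone split_off_at; split=> //.
rewrite split_offK //; apply: represents_cell_inj rL; apply: cell_atP => //.
exact: leq_trans Q_top (monotone_top Q_onto mL).
Qed.

(** A face below [x] cannot merge the last block with the first one, as these lie in
different blocks of [Q]; so it is again linear with respect to [Q]. *)
Lemma far_face F y i z : represents F y -> monotone F Q -> (i <= top F)%N ->
  (0 < top F)%N -> far z -> code z = normalize (face_at i F) ->
  [/\ (i < top F)%N, linear_code z = face_at i F & ~~ alone (face_at i F) a].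
Proof.
move=> rF mF lei F0 /andP[le nal] eqz; have F_onto := represents_onto T0 rF.
set H := face_at i F in eqz *; have [_ H_onto] := face_top F_onto F0 lei.
have [rL mL] := linear_codeP le; set L := linear_code z in nal rL mL *.
have rH : represents H z.
  have [w rw] := onto_represents H_onto.
  suff <- : w = z by [].
  apply: (represents_inj T0 (F := normalize H)); first exact: represents_shift.
  by rewrite -eqz; apply: code_represents.
have [r eqL] := represents_rot T0 rH rL.
have constQ s t : H s = H t -> Q s = Q t.
  by move=> eqH; apply: (monotone_eq mL); rewrite eqL [LHS]ffunE [RHS]ffunE eqH.
have lti : (i < top F)%N.
  rewrite ltn_neqAle lei andbT; apply/eqP => eqi.
  have [s Fs] := ontoP _ F_onto 0%N (leq0n _).
  have [t Ft] := ontoP _ F_onto _ (leqnn (top F)).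
  have [c Qc] := ontoP _ Q_onto 0%N (leq0n _).
  have [d Qd] := ontoP _ Q_onto _ (leqnn (top Q)).
  have Qs : (Q s <= 0)%N by rewrite -Qc mF // Fs.
  have Qt : (top Q <= Q t)%N by rewrite -Qd mF // Ft le_top.
  have : Q s = Q t.
    by apply: constQ; rewrite !ffunE Fs Ft eqi /merge ltnn eqxx; case: ifP.
  by move=> eqQ; move: Q_top; rewrite ltnNge (leq_trans Qt) // -eqQ (leq_trans Qs).
have mH : monotone H Q.
  move=> s t st; have [/mF //|lt] := leqP (F s) (F t).
  suff -> : Q s = Q t by [].
  by apply: constQ; apply/eqP; rewrite eqn_leq st (block_monotone lti) // ltnW.
have [_ eqLH] := linear_code_unique rH mH.
by split=> //; rewrite -eqLH.
Qed.

(** The only faces of a near cell that are far merge the block of [a] with one of its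
neighbours; merging to the right leaves [a] in a later position. *)
Lemma near_triangular : exists2 eps : cell T -> int, forall l, eps l * eps l = 1 &
  forall v l, near l -> (forall y, v y != 0 -> far y) ->
  (forall y, far y -> (linear_code (pull l) a < linear_code y a)%N -> v y = 0) ->
  bd v l = eps l * v (pull l).
Proof.
suff H l : exists e : int, e * e = 1 /\ (near l ->
    forall v, (forall y, v y != 0 -> far y) ->
    (forall y, far y -> (linear_code (pull l) a < linear_code y a)%N -> v y = 0) ->
    bd v l = e * v (pull l)).
  have [eps epsP] := choice H; exists eps => [l|v l nl vU vrk]; first by case: (epsP l).
  by have [_ ->] := epsP l.
have [nl|] := boolP (near l); last by exists 1.
have [_ lin_pull _] := pull_far nl; case/and3P: (nl) => le al La.
have [rL mL] := linear_codeP le; set F := linear_code l in al La rL mL lin_pull.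
have F_onto := represents_onto T0 rL.
have [eps eps2 bdE] := boundary_representative rL.
exists (eps (F a).-1); split=> // _ v vU vrk.
have leF : (F a <= top F)%N := le_top F a.
have lt : ((F a).-1 < (top F).+1)%N by rewrite ltnS (leq_trans (leq_pred _)).
rewrite bdE (bigD1 (Ordinal lt)) //= big1 ?addr0 => [|i ne].
  congr (_ * _); rewrite -[RHS]extend_code; congr (extend _ _).
  rewrite -(@represents_normalize (face_at (F a).-1 F) (pull l)) //.
  have [lepull _ _] := pull_far nl; case/andP: lepull => lepull _.
  by have [+ _] := linear_codeP lepull; rewrite lin_pull.
rewrite [extend _ _](_ : _ = 0) ?mulr0 //; apply/eqP; apply: contraT.
case/extend_neq0=> z eqz nz; have fz := vU z nz.
have F0 : (0 < top F)%N by apply: leq_trans La leF.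
have [lti linz nalz] := far_face rL mL (leq_ord i) F0 fz (esym eqz).
have eqi : i = F a :> nat.
  apply: contraNeq nalz => nei; apply/aloneP => t; rewrite !face_atE !merge_innerE //.
  by move/(merge_inj_away nei ne)/(aloneP _ _ al).
move: nz; rewrite vrk ?eqxx // linz lin_pull join_left_at // face_atE.
by rewrite merge_innerE // eqi leqnn prednK.
Qed.

Lemma linear_code_bound y : far y -> (linear_code y a < n.+1)%N.
Proof.
case/andP=> le _; have [rL _] := linear_codeP le.
have := onto_top_lt (represents_onto T0 rL); rewrite card_ord.
by apply: leq_ltn_trans (le_top _ _).
Qed.

(** The cells in which [a] is not yet alone in front of its block cancel in
pairs, so a chain below [x] can be pushed below [x']. *)
Lemma local_exact_step : (0 < n)%N -> (x' <= x)%O -> local_exact_at x' -> local_exact_at x.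
Proof.
move=> n0 le_x'x IHx c e cx dc aug_c.
have [eps eps2 tri] := near_triangular.
have bdD u v l : bd (fun y => u y + v y) l = bd u l + bd v l by apply: cell_boundaryD.
have pull_U l : near l -> far (pull l) by case/pull_far.
have pullK l : near l -> push (pull l) = l by case/pull_far.
have push_L l : far l -> near (push l) by case/push_near.
have pushK l : far l -> pull (push l) = l by case/push_near.
have tri' v l (nl : near l) vU vrk : bd v l = eps l * v (pull l) := tri v l nl vU vrk.
have [u uU uE] := triangular_solve bdD pull_U pullK eps2 linear_code_bound tri' c.
pose c1 y := c y - bd u y.
have dc1 y : bd c1 y = 0.
  rewrite /c1 cell_boundaryD cell_boundaryN dc sub0r.
  by rewrite cell_boundaryK ?oppr0 //; apply: incidenceK.
have c1x y : c1 y != 0 -> (y <= x)%O.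
  rewrite /c1; have [->|/cx //] := eqVneq (c y) 0; rewrite sub0r oppr_eq0.
  case/boundary_support=> z /uU /andP[le _] lt; exact: le_trans (ltW lt) le.
pose v y := if far y then c1 y else 0; pose w y := if far y then 0 else c1 y.
have c1E y : c1 y = v y + w y by rewrite /v /w; case: ifP; rewrite ?addr0 ?add0r.
have wx' y : w y != 0 -> (y <= x')%O.
  rewrite /w; case: ifP => [_|nf nz]; first by rewrite eqxx.
  have [|ny|//] := step_cover (c1x y nz); first by rewrite nf.
  by rewrite /c1 uE ?subrr ?eqxx // in nz.
have vU y : v y != 0 -> far y by rewrite /v; case: ifP => //; rewrite eqxx.
have v0 y : v y = 0.
  apply: (triangular_unique push_L pushK eps2 linear_code_bound tri' vU) => l nl.
  have : bd c1 l = bd v l + bd w l.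
    by rewrite -bdD; apply: eq_bigr => z _; rewrite -c1E.
  rewrite dc1 => /esym/eqP; rewrite addr_eq0 => /eqP->; apply/eqP; rewrite oppr_eq0.
  apply: contraT => /boundary_support[z /wx' lez lt].
  by have [_ _] := below_step (le_trans (ltW lt) lez); rewrite nl.
have c1w y : c1 y = w y by rewrite c1E v0 add0r.
have [|||c' [c'x' bdc' augc']] := IHx c1 e.
- by move=> y; rewrite c1w; apply: wx'.
- exact: dc1.
- rewrite -[RHS](subr0 0) -[X in X - _]aug_c -[X in _ - X](augmentation_boundary u n0).
  by rewrite -sumrB; apply: eq_bigr => y _; rewrite mulrBl.
exists (fun y => c' y + u y); split=> [y|y|].
- have [->|/c'x' le] := eqVneq (c' y) 0; last by rewrite (le_trans le).
  by rewrite add0r => /uU /andP[].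
- by rewrite bdD bdc' /c1 subrK.
- rewrite -augc' -[RHS]addr0; transitivity
    (\sum_y c' y * augmentation y + \sum_y u y * augmentation y).
    by rewrite -big_split; apply: eq_bigr => y _; rewrite mulrDl.
  congr (_ + _); rewrite big1 // => y _.
  have [->|/uU /andP[le nal]] := eqVneq (u y) 0; first by rewrite mul0r.
  have [->|/augmentation_alone al] := eqVneq (augmentation y) 0; first by rewrite mulr0.
  have [rL _] := linear_codeP le.
  have [r eqL] := represents_rot T0 (code_represents y) rL.
  by rewrite eqL alone_shift ?al in nal.
Qed.

End Step.
End LocalStep.

Section LocalExactness.
Variable n : nat.
Hypothesis n_gt0 : (0 < n)%N.
Local Notation T := 'I_n.+1.
Implicit Types (F G Q : {ffun T -> nat}) (a b t : T) (x y z : cell T).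

Local Notation bd := (cell_boundary (@incidence n)).
Let T0 : (0 < #|T|)%N := card_T n.

Let cardS : #|[set~ ord0 : T]| = n.-1.+1 := card_nonbase n_gt0.

Lemma injective_arrangement F : normal F -> injective F ->
  exists s : 'S_n.-1.+1, F = arrangement [set~ ord0] s.
Proof.
move=> nF F_inj; have [_ /eqP F0] := andP nF.
have hit (i : 'I_n.-1.+1) : exists t : T,
    t \in [set~ ord0] /\ inord (rank_in [set~ ord0] t) = i.
  by have [t St eqt] := rank_in_hit cardS i; exists t.
have [elt eltP] := choice hit.
have F_lt t : t != ord0 -> (F t).-1.+1 = F t.
  by move=> t0; rewrite prednK // lt0n -F0; apply: contra t0 => /eqP/F_inj ->.
have pred_lt t : ((F t).-1 < n.-1.+1)%N.
  rewrite ltnS -!subn1 leq_sub2r // (leq_trans (le_top F t)) //.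
  exact: normal_top_le.
have elt0 i : elt i != ord0 by have [] := eltP i; rewrite !inE.
pose f i : 'I_n.-1.+1 := inord (F (elt i)).-1.
have f_inj : injective f.
  move=> i j /(congr1 val); rewrite /= !inordK ?pred_lt // => /(congr1 S).
  by rewrite !F_lt // => /F_inj eqe; rewrite -(eltP i).2 eqe (eltP j).2.
exists (perm f_inj); apply/ffunP => t; rewrite ffunE !inE.
case: eqP => [-> //|/eqP t0 /=]; rewrite permE /f.
have -> : elt (inord (rank_in [set~ ord0] t)) = t.
  have [Se /(congr1 val)] := eltP (inord (rank_in [set~ ord0] t)).
  have St : t \in [set~ ord0] by rewrite !inE.
  rewrite /= !inordK ?(rank_in_lt cardS) // => eqr.
  exact: (rank_in_inj Se St eqr).
by rewrite inordK ?pred_lt // F_lt.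
Qed.

Lemma arrangement_inj :
  injective (fun s : 'S_n.-1.+1 => arrangement [set~ ord0 : T] s).
Proof.
move=> s s' eqA; apply/permP => i; have [t St <-] := rank_in_hit cardS i.
by apply/val_inj/succn_inj; rewrite -!(arrangementE _ St) eqA.
Qed.

Lemma augmentation_unit x : injective (code x) -> augmentation x * augmentation x = 1.
Proof.
case/(injective_arrangement (code_normal x)) => s eqs.
have -> : augmentation x = (-1) ^+ s.
  rewrite /augmentation /pairing eqs (bigD1 s) //= eqxx mulr1 big1 ?addr0 // => s' ne.
  by case: eqP => [/arrangement_inj eq_s|_]; [rewrite eq_s eqxx in ne | rewrite mulr0].
by rewrite -expr2 sqrr_sign.
Qed.

Lemma vertex_minimal x y : injective (code x) -> (y <= x)%O -> y = x.
Proof.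
move=> x_inj le; apply/eqP; rewrite eq_le le /=.
move: le; rewrite !le_cell => /refines_monotone/(_ (code_represents x))[F rF mF].
apply: (monotone_refines (code_represents x) rF) => s t st.
rewrite leqNgt; apply/negP => lt; have := mF _ _ (ltnW lt) => ts.
have eqst : s = t by apply: x_inj; apply/eqP; rewrite eqn_leq st ts.
by rewrite eqst ltnn in lt.
Qed.

Lemma local_exact_vertex x : injective (code x) -> local_exact_at x.
Proof.
move=> x_inj c e cx dc aug_c.
have c0 y : y != x -> c y = 0.
  by move=> ne; apply/eqP; apply: contraNT ne => /cx/(vertex_minimal x_inj)/eqP.
have cx0 : c x = 0.
  move: aug_c; rewrite (bigD1 x) //= big1 ?addr0 => [|y /c0 ->]; last by rewrite mul0r.
  by move/(congr1 (fun r => r * augmentation x)); rewrite -mulrA augmentation_unit // mulr1 mul0r.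
exists (fun y => if y == x then e * augmentation x else 0); split=> [y|y|].
- by case: (y =P x) => [->|]; rewrite ?eqxx ?lexx.
- transitivity (0 : int); last by have [->|/c0 ->] := eqVneq y x.
  apply/eqP; apply: contraT => /boundary_support[z].
  case: (z =P x) => [-> _ lt|]; last by rewrite eqxx.
  have eqy : y = x by apply: vertex_minimal => //; apply: ltW.
  by rewrite eqy ltxx in lt.
- rewrite (bigD1 x) //= eqxx big1 ?addr0 => [|y /negPf->]; last by rewrite mul0r.
  by rewrite -mulrA augmentation_unit // mulr1.
Qed.

(** Moving an element of a larger block to the front as a new block gives a cell
with more parts, to which [local_exact_step] reduces the claim. *)
Theorem local_exact x : local_exact_at x.
Proof.
have [m] := ubnP (n.+1 - top (code x))%N; elim: m x => // m IHm x lem.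
have [/injectiveP x_inj|] := boolP (injectiveb (code x)); first exact: local_exact_vertex.
case/injectivePn=> a [b ne_ba eq_ab].
have [topQ Q_onto] := shift_top ((top (code x)).+1 - code x a) (code_onto x).
set Q := shift _ _ in topQ Q_onto.
have rQ : represents Q x by apply/represents_shift/code_represents.
have Qa : Q a = 0%N by rewrite ffunE subnKC ?modnn // ltnW // ltnS le_top.
have Qb : Q b = 0%N by rewrite -Qa [LHS]ffunE [RHS]ffunE eq_ab.
pose Q' : {ffun T -> nat} := [ffun t => if t == a then 0%N else (Q t).+1].
have Q'a : Q' a = 0%N by rewrite ffunE eqxx.
have Q'E t : t != a -> Q' t = (Q t).+1 by rewrite ffunE => /negPf ->.
have hit v : (v <= (top Q).+1)%N -> exists t, Q' t = v.
  case: v => [_|v lev]; first by exists a.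
  have [v0|v0] := eqVneq v 0%N; first by exists b; rewrite Q'E 1?eq_sym // Qb v0.
  have [t Qt] := ontoP _ Q_onto _ lev; exists t; rewrite Q'E ?Qt //.
  by apply: contraNneq v0 => eqt; rewrite -Qt eqt Qa.
have topQ' : top Q' = (top Q).+1.
  apply: top_eq => [t|]; last exact: hit.
  by have [->|/Q'E ->] := eqVneq t a; rewrite ?Q'a // ltnS le_top.
have Q'_onto : onto Q' by apply/ontoP => v; rewrite topQ'; apply: hit.
have Q'1 : (1 < top Q')%N by rewrite topQ' topQ ltnW // ltnS top_code.
have [x' rQ'] := represents_cell Q'_onto Q'1.
have mQ' : monotone Q' Q.
  move=> s t; have [->|/Q'E ->] := eqVneq s a; first by rewrite Qa.
  by have [->|/Q'E ->] := eqVneq t a; rewrite ?Q'a.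
apply: (@local_exact_step n x x' Q Q' a) => //.
  by rewrite le_cell (monotone_refines rQ' rQ).
apply: IHm; have : top (code x') = (top (code x)).+1.
  rewrite -topQ -topQ'; apply: succn_inj.
  by rewrite -!(represents_parts T0 (code_represents x')) (represents_parts T0 rQ').
have := normal_top_le (code_normal x'); move: lem; clear; lia.
Qed.

End LocalExactness.

(** * Torus cocycles determined by their pairings *)

Section Cocycles.
Variable n : nat.
Local Notation T := 'I_n.+1.
Implicit Types (F G : {ffun T -> nat}) (S A : {set T}).
Implicit Types (c u v w : {ffun T -> nat} -> int).

Definition closed j c := forall F, normal F -> top F = j.+1 -> coboundary c F = 0.

(** The sets of points, other than the base point, that index a basis of the
cohomology of degree [j.+1]. *)
Definition supports j := [set S : {set T} | (ord0 \notin S) && (#|S| == j.+1)].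

Lemma subset_nonbase S : (S \subset [set~ ord0]) = (ord0 \notin S).
Proof. by rewrite -disjoints_subset disjoint_sym disjoints1. Qed.

Lemma card_supports j : #|supports j| = 'C(n, j.+1).
Proof.
have -> : supports j = [set S : {set T} | S \subset [set~ ord0] & #|S| == j.+1].
  by apply/setP => S; rewrite !inE subset_nonbase.
by rewrite cards_draws cardsC1 card_ord.
Qed.

Definition restrict j u F : int := if normal F && (top F == j) then u F else 0.

Lemma restrict_cochain j u : cochain j (restrict j u).
Proof. by move=> F; rewrite /restrict; case: ifP => [/andP[-> /eqP->]|]; rewrite ?eqxx. Qed.

Lemma restrictE j u F : normal F -> top F = j -> restrict j u F = u F.
Proof. by move=> nF topF; rewrite /restrict nF topF eqxx. Qed.

Lemma eq_coboundary j u v F : (forall G, normal G -> top G = j -> u G = v G) ->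
  normal F -> top F = j.+1 -> coboundary u F = coboundary v F.
Proof.
move=> eq_uv nF topF; apply: eq_bigr => i _; congr (_ * _).
have [F_onto _] := andP nF; have F0 : (0 < top F)%N by rewrite topF.
apply: eq_uv; first by apply: normal_face => //; apply: leq_ord.
by have [-> _] := face_top F_onto F0 (leq_ord i); rewrite topF.
Qed.

Lemma coboundary_closed j u : closed j.+1 (restrict j.+1 (coboundary u)).
Proof.
move=> F nF topF; rewrite (eq_coboundary (v := coboundary u) (restrictE _) nF topF).
by apply: coboundaryK; [case/andP: nF | rewrite topF].
Qed.

Lemma closedB j u v : closed j u -> closed j v -> closed j (fun F => u F - v F).
Proof.
move=> du dv F nF topF; rewrite -[RHS](subr0 0) -[X in X - _](du F nF topF).
by rewrite -[X in _ - X](dv F nF topF) -sumrB; apply: eq_bigr => i _; rewrite mulrBr.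
Qed.

Lemma eq_pairing S j u v : S \in supports j ->
  (forall F, normal F -> top F = j.+1 -> u F = v F) -> pairing S j u = pairing S j v.
Proof.
rewrite inE => /andP[S0 /eqP cS] eq_uv; apply: eq_bigr => s _; congr (_ * _).
by apply: eq_uv; [apply: arrangement_normal | rewrite (arrangement_onto S0 cS s).1].
Qed.

Lemma pairing_restrict S j u : S \in supports j ->
  pairing S j (restrict j.+1 (coboundary u)) = 0.
Proof.
move=> Sj; rewrite (eq_pairing (v := coboundary u) Sj) => [|F nF topF].
  by move: Sj; rewrite inE => /andP[S0 /eqP cS]; apply: pairing_coboundary.
exact: restrictE.
Qed.

Lemma cocycle_unique j c : cochain j.+1 c -> closed j.+1 c ->
  (forall F, lower F -> top F = j.+1 -> c F = 0) ->
  (forall S, S \in supports j -> pairing S j c = 0) -> forall F, c F = 0.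
Proof.
move=> cj dc cl cS; apply: (cocycle_eq0 cj dc) => [F lF|F nF topF ordF].
  by have [//|nz] := eqVneq (c F) 0; apply: cl; case: (cj F nz).
have [S [S0 cardS eqF]] := ordered_arrangement nF topF ordF.
by rewrite eqF -pairing_lower // cS // inE S0 cardS eqxx.
Qed.

(** The coboundary of a suitable upper cochain agrees with [c] on the lower cells;
the difference is a cocycle to which [cocycle_unique] applies. *)
Lemma exact_of_pairings j c : cochain j.+1 c -> closed j.+1 c ->
  (forall S, S \in supports j -> pairing S j c = 0) ->
  exists2 u, cochain j u & forall F, normal F -> top F = j.+1 -> c F = coboundary u F.
Proof.
move=> cj dc cS; have [u uU uE] := solve_lower j c; exists u => [F nz|F nF topF].
  by have /andP[/upperP[a [nF _ _]] /eqP] := uU F nz.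
pose w F := c F - restrict j.+1 (coboundary u) F.
suff /(_ F) : forall F, w F = 0 by rewrite /w restrictE // => /eqP; rewrite subr_eq0 => /eqP.
apply: (@cocycle_unique j) => [G|||S Sj].
- rewrite /w; have [->|/cj //] := eqVneq (c G) 0.
  by rewrite sub0r oppr_eq0; apply: restrict_cochain.
- exact: closedB dc (coboundary_closed u).
- move=> G lG topG; have [a [nG _ _]] := lowerP _ lG.
  by rewrite /w restrictE // uE ?subrr // /lower_in lG topG eqxx.
- by rewrite /w pairingB cS // pairing_restrict // subrr.
Qed.

Lemma cup_combination_closed (I : finType) j (S : I -> {set T}) (v : I -> int) :
  (forall i, S i \in supports j) -> let c F := \sum_i v i * cup (S i) j F in
  [/\ cochain j.+1 c, closed j.+1 c &
      forall S', S' \in supports j -> pairing S' j c = \sum_i v i * (S' == S i)%:R].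
Proof.
move=> Sj c; split=> [F|F nF topF|S' S'j].
- have [/andP[nF /eqP topF] _|nn] := boolP (normal F && (top F == j.+1)); first by [].
  by rewrite /c big1 ?eqxx // => i _; rewrite /cup (negPf nn) mulr0.
- rewrite /coboundary /c; under eq_bigr do rewrite mulr_sumr.
  rewrite exchange_big big1 // => i _.
  have := Sj i; rewrite inE => /andP[S0 /eqP cS].
  transitivity (v i * coboundary (cup (S i) j) F); last by rewrite cup_cocycle ?mulr0.
  rewrite mulr_sumr.
  by apply: eq_bigr => k _; rewrite mulrCA.
- rewrite /pairing /c; under eq_bigr do rewrite mulr_sumr.
  rewrite exchange_big; apply: eq_bigr => i _.
  have := Sj i; rewrite inE => /andP[S0 /eqP cS].
  move: S'j; rewrite inE => /andP[S0' /eqP cS'].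
  rewrite -(pairing_cup S0' S0 cS' cS) mulr_sumr.
  by apply: eq_bigr => k _; rewrite mulrCA.
Qed.

(** A combination of cup products takes care of the pairings, and a coboundary, which
does not change them, of the values on lower cells. *)
Lemma cocycle_exists (I : finType) j (S : I -> {set T}) (v : I -> int) t :
  (forall i, S i \in supports j) -> exists c,
  [/\ cochain j.+1 c, closed j.+1 c,
      forall F, lower F -> top F = j.+1 -> c F = t F &
      forall S', S' \in supports j -> pairing S' j c = \sum_i v i * (S' == S i)%:R].
Proof.
move=> Sj; have [c1 d1 p1] := cup_combination_closed v Sj.
set c := fun F => _ in c1 d1 p1.
have [u uU uE] := solve_lower j (fun F => c F - t F).
exists (fun F => c F - restrict j.+1 (coboundary u) F); split=> [G||F lF topF|S' S'j].
- have [->|/c1 //] := eqVneq (c G) 0.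
  by rewrite sub0r oppr_eq0; apply: restrict_cochain.
- exact: closedB d1 (coboundary_closed u).
- have [a [nF _ _]] := lowerP _ lF.
  by rewrite restrictE // uE ?subKr // /lower_in lF topF eqxx.
- by rewrite pairingB p1 // pairing_restrict // subr0.
Qed.

Definition indicator A : {ffun T -> nat} := [ffun x => (x \in A : nat)].

Definition large_sets := [set A : {set T} | (ord0 \notin A) && (1 < #|A|)%N].

Lemma card_large_sets : (#|large_sets| + n.+1 = 2 ^ n)%N.
Proof.
have cB : #|[set~ ord0 : T]| = n by rewrite cardsC1 card_ord.
pose P := powerset [set~ ord0 : T].
have -> : large_sets = P :\: [set A in P | (#|A| <= 1)%N].
  by apply/setP => A; rewrite !inE subset_nonbase ltnNge; case: (ord0 \in A); rewrite ?andbT.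
have small : #|[set A in P | (#|A| <= 1)%N]| = n.+1.
  have -> : [set A in P | (#|A| <= 1)%N] =
      [set A : {set T} | A \subset [set~ ord0] & #|A| == 0%N] :|:
      [set A : {set T} | A \subset [set~ ord0] & #|A| == 1%N].
    by apply/setP => A; rewrite !inE -andb_orr; case: #|A| => [|[]].
  rewrite cardsU !cards_draws cB bin0 bin1 add1n (_ : _ :&: _ = set0) ?cards0 ?subn0 //.
  by apply/setP => A; rewrite !inE; case: #|A| => [|v]; rewrite ?andbF.
have cP : #|P| = (2 ^ n)%N by rewrite card_powerset cB.
rewrite -cP -(cardsID [set A in P | (#|A| <= 1)%N] P) addnC; congr (_ + _)%N.
by apply: (etrans (esym small)); apply: eq_card => A; rewrite !inE andbA andbb.
Qed.

Lemma indicator_upper A : A \in large_sets -> upper (indicator A) /\ top (indicator A) = 1%N.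
Proof.
rewrite inE => /andP[A0 A1]; have [a Aa] : exists a, a \in A by apply/card_gt0P; lia.
have IA x : indicator A x = (x \in A) by rewrite ffunE.
have topI : top (indicator A) = 1%N.
  by apply: top_eq => [x|]; [rewrite IA leq_b1 | exists a; rewrite IA Aa].
have nI : normal (indicator A).
  rewrite /normal IA (negPf A0) andbT; apply/ontoP => v; rewrite topI.
  by case: v => [|[|//]] _; [exists ord0; rewrite IA (negPf A0) | exists a; rewrite IA Aa].
have nal x : x \in A -> ~~ alone (indicator A) x.
  move=> Ax; apply/aloneP => al; move: A1; rewrite ltnNge => /negP[].
  rewrite -(cards1 x); apply/subset_leq_card/subsetP => y Ay.
  by rewrite inE; apply/eqP/al; rewrite !IA Ax Ay.
have na : ~~ in_order (indicator A) a.
  by rewrite /in_order IA Aa /= negb_and nal ?orbT.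
split=> //; have [p pp _] := pivot_exists na; apply/upperP; exists p; split=> //.
apply: nal; have [np _] := pivotP _ _ pp; apply: contraR np => nAp.
by rewrite /in_order IA (negPf nAp).
Qed.

(** Upper simplices of dimension 1 are given by their one nonbase block, a set of at
least two points. *)
Lemma lower_indicator F : lower F -> top F = 2%N ->
  exists2 A, A \in large_sets & F = split_pivot (indicator A).
Proof.
move=> lF topF; have [uJ topJ _ _ <-] := join_pivot_upper lF.
rewrite topF /= in topJ; have [p [nJ pp nal]] := upperP _ uJ.
set J := join_pivot F in uJ topJ nJ pp nal *; exists [set x | J x != 0%N].
  have [_ /eqP J0] := andP nJ; rewrite !inE J0 eqxx /=.
  move: nal; rewrite negb_forall => /existsP[q]; rewrite negb_imply => /andP[/eqP eqq ne].
  have Jp : J p != 0%N.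
    by have [np _] := pivotP _ _ pp; apply: contra np => /eqP z; rewrite /in_order z.
  by rewrite (cardsD1 p) (cardsD1 q) !inE Jp eqq Jp ne.
congr split_pivot; apply/ffunP => x; rewrite [RHS]ffunE inE.
by have := le_top J x; rewrite topJ; case: (J x) => [|[|]].
Qed.

Lemma split_indicator_inj : {in large_sets &, injective (fun A => split_pivot (indicator A))}.
Proof.
move=> A B /indicator_upper[uA _] /indicator_upper[uB _] eqs.
have eqI : indicator A = indicator B.
  by have [_ _ <-] := split_pivot_lower uA; have [_ _ <-] := split_pivot_lower uB; rewrite eqs.
by apply/setP => x; move/ffunP/(_ x): eqI; rewrite !ffunE; do 2 case: (x \in _).
Qed.

End Cocycles.

(** * Homology of the cyclopermutohedron *)

Section Homology.
Variable n : nat.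
Hypothesis n_gt1 : (1 < n)%N.
Local Notation T := 'I_n.+1.
Implicit Types (F G : {ffun T -> nat}) (S A : {set T}) (x y z : cell T).
Implicit Types (c e : cell T -> int) (u : {ffun T -> nat} -> int).

Local Notation bd := (cell_boundary (@incidence n)).
Let n_gt0 : (0 < n)%N := ltnW n_gt1.

Definition dimension x := (n - top (code x))%N.

Lemma dimension_top x k : (k <= n)%N -> (dimension x == k) = (top (code x) == n - k)%N.
Proof. by move=> le; have := normal_top_le (code_normal x); rewrite /dimension; lia. Qed.

Lemma incidence_dimension x y : incidence x y != 0 -> dimension x = (dimension y).+1.
Proof.
move/incidence_top => topE; have := normal_top_le (code_normal y).
by rewrite /dimension topE; lia.
Qed.

Lemma augmentation_dimension x : augmentation x != 0 -> dimension x = 0%N.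
Proof.
case/augmentation_arrangement=> s eqs; rewrite /dimension eqs.
have [-> _] := arrangement_onto (@base_notin n) (card_nonbase n_gt0) s.
by rewrite prednK // subnn.
Qed.

Lemma incidence_augmentation x : \sum_y incidence x y * augmentation y = 0.
Proof.
under eq_bigr do rewrite incidence_delta.
exact: augmentation_boundary.
Qed.

Lemma free_homology_of_cells k r (phi : (cell T -> int) -> 'rV[int]_r) :
  (forall c e, phi (fun x => c x - e x) = phi c - phi e) ->
  (forall v, exists2 c, cell_cycle (@incidence n) dimension k c & phi c = v) ->
  (forall c, cell_cycle (@incidence n) dimension k c -> phi c = 0 <->
     exists2 e, cell_chain dimension k.+1 e & forall y, c y = bd e y) ->
  free_abelian_of_rank (homology (cell T) k) r.
Proof.
apply: (@cellular_homology _ _ (@incidence n) (@augmentation n) dimension).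
- exact: incidence_lt.
- exact: incidence_dimension.
- exact: augmentation_dimension.
- exact: incidenceK.
- exact: incidence_augmentation.
- exact: local_exact.
Qed.

Lemma extend_restrict j u F : (1 < j)%N -> cochain j u ->
  extend (fun x => u (code x)) F = u F.
Proof.
move=> j1 cu; have [[x ->]|neq] := pselect (exists x, F = code x).
  exact: extend_code.
rewrite extend_eq0 => [|x eqF]; last by apply: neq; exists x.
apply/esym/eqP; apply: contra_notT neq => /cu[nF topF].
by have [|x <-] := code_exists nF; [rewrite topF | exists x].
Qed.

Lemma boundary_restrict j u y : (1 < j)%N -> cochain j u ->
  bd (fun x => u (code x)) y = coboundary u (code y).
Proof.
move=> j1 cu; rewrite boundary_code; apply: eq_bigr => i _.
by rewrite (extend_restrict _ j1 cu).
Qed.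

Lemma coboundary_degree j u F : cochain j u -> normal F -> (0 < top F)%N ->
  top F != j.+1 -> coboundary u F = 0.
Proof.
move=> cu nF F0 ne; rewrite /coboundary big1 // => i _.
have [->|/cu [_ topf]] := eqVneq (u (face_at i F)) 0; first by rewrite mulr0.
have [F_onto _] := andP nF; have [topE _] := face_top F_onto F0 (leq_ord i).
by move: ne; rewrite -topf topE prednK // eqxx.
Qed.

Section Degree.
Variables (k j : nat).
Hypotheses (kj : (k + j.+1 = n)%N) (j_gt0 : (0 < j)%N).

Let dim_top x : (dimension x == k) = (top (code x) == j.+1).
Proof. by clear j_gt0; rewrite dimension_top; [congr (_ == _); lia | lia]. Qed.

Lemma extend_cycle c : cell_cycle (@incidence n) dimension k c ->
  cochain j.+1 (extend c) /\ closed j.+1 (extend c).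
Proof.
case=> ck dc; split=> [F|F nF topF].
  case/extend_neq0=> x -> /ck/eqP; rewrite dim_top => /eqP ->.
  by split=> //; apply: code_normal.
by rewrite extend_boundary ?topF // /extend big1 // => x _; rewrite dc mulr0.
Qed.

Lemma restrict_cycle u : cochain j.+1 u -> closed j.+1 u ->
  cell_cycle (@incidence n) dimension k (fun x => u (code x)).
Proof.
move=> cu du; split=> [x /cu[_ topx]|y]; first by apply/eqP; rewrite dim_top topx.
rewrite (boundary_restrict _ _ cu) ?ltnS //.
have [topy|ne] := eqVneq (top (code y)) j.+2; first by rewrite du //; apply: code_normal.
by rewrite (coboundary_degree cu) //; [apply: code_normal | apply: ltnW (top_code y)].
Qed.

Lemma pairing_boundary S c e : S \in supports n j -> (forall y, c y = bd e y) ->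
  pairing S j (extend c) = 0.
Proof.
move=> Sj ce; rewrite -(pairing_restrict (extend e) Sj); apply: eq_pairing => // F nF topF.
rewrite restrictE // extend_boundary ?topF //.
by apply: eq_bigr => x _; rewrite ce.
Qed.

Definition pairings c : 'rV[int]_#|supports n j| :=
  \row_l pairing (enum_val l) j (extend c).

Lemma pairingsB c e : pairings (fun x => c x - e x) = pairings c - pairings e.
Proof.
apply/rowP => l; rewrite !mxE -pairingB; apply: eq_bigr => s _.
by rewrite extendB.
Qed.

Lemma pairings0 c S : pairings c = 0 -> S \in supports n j -> pairing S j (extend c) = 0.
Proof.
move=> /rowP p0 Sj; have := p0 (enum_rank_in Sj S).
by rewrite !mxE enum_rankK_in.
Qed.

Lemma cycle_exists (v : 'rV[int]_#|supports n j|) t :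
  exists c, [/\ cell_cycle (@incidence n) dimension k c, pairings c = v &
    forall F, lower F -> top F = j.+1 -> extend c F = t F].
Proof.
pose S (l : 'I_#|supports n j|) := enum_val l.
have [|u [cu du tu pu]] := @cocycle_exists n _ j S (v 0) t; first exact: enum_valP.
have ext F : extend (fun x => u (code x)) F = u F by apply: extend_restrict cu.
exists (fun x => u (code x)); split.
- exact: restrict_cycle.
- apply/rowP => l; rewrite !mxE.
  transitivity (pairing (enum_val l) j u); first by apply: eq_bigr => s _; rewrite ext.
  rewrite pu ?enum_valP // (bigD1 l) //= eqxx mulr1 big1 ?addr0 // => i ne.
  by rewrite (inj_eq enum_val_inj) eq_sym (negPf ne) mulr0.
- by move=> F lF topF; rewrite ext tu.
Qed.

End Degree.

(** Here [j.+1 > 2], so the primitives of degree [j] live on cells. *)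
Lemma homology_below k : (k < n - 2)%N ->
  free_abelian_of_rank (homology (cell T) k) 'C(n, k).
Proof.
move=> ltk; pose j := (n - k).-1.
have kj : (k + j.+1 = n)%N by rewrite /j; lia.
have j1 : (1 < j)%N by rewrite /j; lia.
have -> : 'C(n, k) = #|supports n j|.
  by rewrite card_supports -bin_sub; [congr 'C(_, _); lia | lia].
apply: (free_homology_of_cells (phi := @pairings j)) => [c e|v|c cc].
- exact: pairingsB.
- by have [c [cc pc _]] := cycle_exists kj (ltnW j1) v (fun=> 0); exists c.
have [cx dx] := extend_cycle kj cc; split=> [p0|[e _ ce]].
  have [u cu uE] := exact_of_pairings cx dx (fun S Sj => pairings0 p0 Sj).
  exists (fun x => u (code x)) => [x /cu[_ topx]|y].
    by rewrite /dimension topx; move: kj; clear; lia.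
  rewrite (boundary_restrict _ j1 cu).
  have [topy|ne] := eqVneq (top (code y)) j.+1.
    by rewrite -uE //; [rewrite extend_code | apply: code_normal].
  rewrite (coboundary_degree cu) //; [|exact: code_normal|exact: ltnW (top_code y)].
  by apply/eqP; apply: contraNT ne; rewrite -extend_code => /cx[_ ->].
apply/rowP => l; rewrite !mxE; apply: (pairing_boundary (e := e)) => //.
exact: enum_valP.
Qed.

(** There are no cells of higher dimension, so the cycles are all the cocycles of
degree 2; they are determined by their pairings and by their values on lower
simplices, which can be prescribed freely. *)
Lemma homology_top : free_abelian_of_rank (homology (cell T) (n - 2))
  (#|supports n 1| + #|large_sets n|).
Proof.
have kj : (n - 2 + 2 = n)%N by lia.
pose low (A : {set T}) := split_pivot (indicator A).
pose values c : 'rV[int]_#|large_sets n| := \row_l extend c (low (enum_val l)).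
pose phi c := row_mx (pairings 1 c) (values c).
apply: (free_homology_of_cells (phi := phi)) => [c e|v|c cc].
- rewrite /phi pairingsB opp_row_mx add_row_mx; congr row_mx.
  by apply/rowP => l; rewrite !mxE extendB.
- pose t F := \sum_l rsubmx v 0 l * (F == low (enum_val l))%:R.
  have [c [cc pc tc]] := cycle_exists kj isT (lsubmx v) t.
  exists c => //; rewrite /phi -[RHS]hsubmxK; congr row_mx => //.
  apply/rowP => l; rewrite mxE.
  have [uA topA] := indicator_upper (enum_valP l).
  have [lA topl _] := split_pivot_lower uA.
  rewrite tc //; last by rewrite topl topA.
  rewrite /t (bigD1 l) //= eqxx mulr1 big1 ?addr0 // => i ne.
  case: eqP => [/split_indicator_inj eqi|_]; last by rewrite mulr0.
  by case/eqP: ne; apply/enum_val_inj/esym/eqi; apply: enum_valP.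
have [cx dx] := extend_cycle kj cc; split=> [|[e ek ce]].
  rewrite /phi -[X in _ = X](row_mx0 _) => /eq_row_mx[p0 v0].
  have c0 F : extend c F = 0.
    apply: (cocycle_unique cx dx) => [G lG topG|S Sj]; last exact: pairings0 Sj.
    have [A bA ->] := lower_indicator lG topG.
    by have /rowP/(_ (enum_rank_in bA A)) := v0; rewrite !mxE enum_rankK_in.
  exists (fun=> 0) => [x|y]; first by rewrite eqxx.
  rewrite /cell_boundary big1 => [|x _]; last by rewrite mulr0.
  by rewrite -extend_code.
have e0 x : e x = 0.
  apply/eqP; apply: contraT => /ek; have := top_code x; rewrite /dimension; lia.
have c0 y : c y = 0 by rewrite ce /cell_boundary big1 // => x _; rewrite e0 mulr0.
have ext0 F : extend c F = 0 by rewrite /extend big1 // => x _; rewrite c0 mulr0.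
rewrite /phi -[RHS]row_mx0; congr row_mx; apply/rowP => l; rewrite !mxE ?ext0 //.
by rewrite /pairing big1 // => s _; rewrite ext0 mulr0.
Qed.

Lemma homology_above k : (n - 2 < k)%N -> free_abelian_of_rank (homology (cell T) k) 0.
Proof.
move=> ltk; apply: (free_homology_of_cells (phi := fun=> 0)) => [c e|v|c [ck dc]].
- by rewrite subr0.
- exists (fun=> 0); last by rewrite [v]thinmx0.
  split=> [x|y]; first by rewrite eqxx.
  by rewrite /cell_boundary big1 // => x _; rewrite mulr0.
split=> // _; exists (fun=> 0) => [x|y]; first by rewrite eqxx.
rewrite /cell_boundary big1 => [|x _]; last by rewrite mulr0.
apply/eqP; apply: contraT => /ck; have := top_code y; rewrite /dimension; lia.
Qed.

End Homology.

Theorem theorem2 (n k : nat) (n_gt2 : (2 < n)%N) :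
  exists2 r : nat,
    free_abelian_of_rank (homology (cell 'I_n.+1) k) r
  & r%:R = (if (k < n - 2)%N then 'C(n, k)%:R
            else if k == (n - 2)%N
                 then 2 ^+ n + (n%:R ^+ 2 - 3 * n%:R - 2) / 2
            else 0) :> rat.
Proof.
have n_gt1 : (1 < n)%N := ltnW n_gt2.
case: (ltngtP k (n - 2)) => [lt|gt|->].
- by exists 'C(n, k) => //; apply: homology_below.
- by exists 0%N => //; apply: homology_above.
exists (#|supports n 1| + #|large_sets n|)%N; first exact: homology_top.
have E1 : (#|supports n 1|%:R : rat) = n%:R * (n%:R - 1) / 2.
  have /(congr1 (fun m => m%:R : rat)) : (#|supports n 1| * 2 = n * n.-1)%N.
    by rewrite card_supports muln2 bin2 even_halfK //; case: (n) => // m; rewrite oddM /=; case: odd.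
  rewrite !natrM -subn1 natrB ?(ltnW n_gt1) // => E.
  by rewrite -E mulfK.
have E2 : (#|large_sets n|%:R : rat) = 2 ^+ n - n%:R - 1.
  have /(congr1 (fun m => m%:R : rat)) := card_large_sets n.
  by rewrite natrD natrX -natr1 => <-; ring.
by rewrite natrD E1 E2; field.
Qed.
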